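(* Let $n\ge3$. If $n$ is even, then $H_0(C_n(S^1))\cong H_{n-1}(C_n(S^1))\cong\mathbb{Z}$ and $H_k(C_n(S^1))=0$ for $k\notin\{0,n-1\}$. If $n$ is odd, then $H_0(C_n(S^1))\cong H_n(C_n(S^1))\cong\mathbb{Z}$ and $H_k(C_n(S^1))=0$ for $k\notin\{0,n\}$.
   Context: $C_n(S^1)$ is the set of nonempty subsets of the circle $S^1$ with at most $n$ elements, topologized as a quotient of $(S^1)^n$ via $(x_1,\dots,x_n)\mapsto\{x_1,\dots,x_n\}$. $H_k$ denotes integral (singular/simplicial) homology. *)

(* Defs.v *)
From HB Require Import structures.
From mathcomp Require Import all_boot all_order all_algebra.
From mathcomp Require Import all_classical all_reals.
Unset Printing Implicit Defensive.
Import Order.TTheory GRing.Theory Num.Theory.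
Local Open Scope classical_set_scope.
Local Open Scope ring_scope.

Section SingularHomologyCn.
Variable R : realType.

Definition pt := (R * R)%type.
Definition on_circle (p : pt) : Prop := p.1 ^+ 2 + p.2 ^+ 2 = 1.

Definition torus (n : nat) : set ('I_n -> pt) :=
  [set x | forall i, on_circle (x i)].

Definition torus_open (n : nat) (V : set ('I_n -> pt)) : Prop :=
  forall x, torus n x -> V x ->
    exists2 e : R, 0 < e &
      forall y, torus n y ->
        (forall i, `|(y i).1 - (x i).1| < e /\ `|(y i).2 - (x i).2| < e) -> V y.

Definition config (n : nat) (x : 'I_n -> pt) : set pt := range x.

Definition Cn (n : nat) : set (set pt) :=
  [set A | exists2 x, torus n x & A = config n x].

Definition Cn_open (n : nat) (U : set (set pt)) : Prop :=
  U `<=` Cn n /\ torus_open n [set x | torus n x /\ U (config n x)].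

Definition std_simplex (k : nat) : set ('I_k.+1 -> R) :=
  [set t | (forall i, 0 <= t i) /\ \sum_(i < k.+1) t i = 1].

Definition simplex_open (k : nat) (V : set ('I_k.+1 -> R)) : Prop :=
  forall t, std_simplex k t -> V t ->
    exists2 e : R, 0 < e &
      forall s, std_simplex k s -> (forall i, `|s i - t i| < e) -> V s.

Definition simplex_map (k : nat) := ('I_k.+1 -> R) -> set pt.

Definition sing_simplex (n k : nat) (s : simplex_map k) : Prop :=
  [/\ forall t, std_simplex k t -> Cn n (s t),
      forall t, ~ std_simplex k t -> s t = set0 &
      forall U, Cn_open n U -> simplex_open k [set t | std_simplex k t /\ U (s t)]].

Definition chain (k : nat) := simplex_map k -> int.

Definition is_chain (n k : nat) (c : chain k) : Prop :=
  finite_set [set s | c s != 0] /\ (forall s, c s != 0 -> sing_simplex n k s).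

Definition face (k : nat) (i : 'I_k.+2) (s : simplex_map k.+1) : simplex_map k :=
  fun t => s (fun j => if unlift i j is Some j' then t j' else 0).

Definition bd (k : nat) (c : chain k.+1) : chain k :=
  fun u => \sum_(s \in [set: simplex_map k.+1])
             (c s * \sum_(i < k.+2) ((-1) ^+ i * (`[< face k i s = u >])%:R)).

Definition is_cycle (n k : nat) (c : chain k) : Prop :=
  is_chain n k c /\
  (match k return chain k -> Prop with
   | 0 => fun _ => True
   | k'.+1 => fun c => forall u, bd k' c u = 0
   end c).

Definition is_boundary (n k : nat) (c : chain k) : Prop :=
  exists2 d : chain k.+1, is_chain n k.+1 d & bd k d = c.

Definition homology_trivial (n k : nat) : Prop :=
  forall c : chain k, is_cycle n k c -> is_boundary n k c.

(* H_k(C_n(S^1)) ~= Z : a surjective homomorphism from the k-cycles onto Z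
   whose kernel is exactly the group of k-boundaries *)
Definition homology_iso_Z (n k : nat) : Prop :=
  exists phi : chain k -> int,
    [/\ forall c d, is_cycle n k c -> is_cycle n k d -> phi (c \+ d) = phi c + phi d,
        forall m : int, exists2 c, is_cycle n k c & phi c = m &
        forall c, is_cycle n k c -> (phi c = 0 <-> is_boundary n k c)].

End SingularHomologyCn.

(* Main.v *)
(* Write P_n for the space of those A in C_n(S^1) that contain the base point 1. Unwrapping the
   circle identifies P_n with the space E_{n+1} of sets of at most n + 1 points of an interval
   that contain both of its end points.

   (1) Fix z_1 < z_2 < ... inside the interval and let X_k be the space of finite sets that contain
   both end points and miss one of z_1, ..., z_k. Contracting the arcs between the z_i shows that
   E_{k+1} -> X_k is a homology isomorphism. Excision and an induction show that H_*(X_{k+1}, X_k)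
   is Z, in degree k. Moreover X_k -> X_{k+1} is null-homotopic: compress a set towards the left
   and add the right end point. Hence the long exact sequences of the pairs split into short ones,
   and X_k is acyclic for odd k and a homology sphere of dimension k - 1 for even k.

   (2) Sets avoiding 1 are finite subsets of an open interval. Such sets having a point near the
   left end form a contractible space, as do those having a point near the right end, and the sets
   having both are deformed to E_n; so H_j(C_n, P_n) is the reduced homology of E_n in degree
   j - 2.

   One of P_n = E_{n+1} and E_n is acyclic, and the exact sequence of (C_n, P_n) concludes.
   All deformations, except those adding end points, are induced by motions of single points. *)
Require Import Defs.
From HB Require Import structures.
From mathcomp Require Import freeg.
From mathcomp Require Import all_boot all_order all_algebra.
From mathcomp Require Import ring lra.
From mathcomp Require Import all_classical all_reals.
From mathcomp Require topology normedtype.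
Set Implicit Arguments. Unset Strict Implicit. Unset Printing Implicit Defensive.
Import Order.TTheory GRing.Theory Num.Theory.
Local Open Scope classical_set_scope.
Local Open Scope ring_scope.

(** * Affine chains *)

(** Moving points one by one never raises their number, and it only has to be continuous at the
    points that occur: a set that misses z may be torn at z. Adding a point does raise the number.
    This is why the spaces X_k bound nothing but finiteness: the compression that adds an end point
    and the excision that adds a point between two marks would both leave a space of sets with at
    most m points. The bound returns only in the comparison of E_{k+1} with X_k. There X_k is
    covered by the sets that miss a given mark; the sets that miss a family S of marks contract
    along the arcs cut out by S, of which there are at most k + 1, and Mayer-Vietoris glues these
    contractions. That E_{k+1} lies in X_k is the pigeonhole principle.

    Since homology is reduced, with an empty simplex, the empty space X_0 counts as a sphere of
    dimension -1, and its class starts the induction on k. Continuity is expressed by the Hausdorff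
    metric throughout and matched with the quotient topology at the very end. *)

Section Supported.
Variable K : choiceType.
Implicit Types (P Q : K -> Prop) (c d : {freeg K / int}).

Definition supp P c := forall s, coeff s c != 0 -> P s.

Lemma supp0 P : supp P 0.
Proof. by move=> s; rewrite coeff0 eqxx. Qed.

Lemma suppD P c d : supp P c -> supp P d -> supp P (c + d).
Proof.
move=> hc hd s; rewrite coeffD => h.
have [c0|] := eqVneq (coeff s c) 0; last exact: hc.
by apply: hd; move: h; rewrite c0 add0r.
Qed.

Lemma suppN P c : supp P c -> supp P (- c).
Proof. by move=> hc s; rewrite raddfN oppr_eq0; exact: hc. Qed.

Lemma suppB P c d : supp P c -> supp P d -> supp P (c - d).
Proof. by move=> hc hd; apply: suppD => //; exact: suppN. Qed.

Lemma suppU P s : P s -> supp P << s >>.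
Proof.
by move=> hs t; rewrite coeffU mul1r; case: (eqVneq s t) => [<-|_] //=; rewrite eqxx.
Qed.

Lemma supp_sum P (I : Type) (r : seq I) (p : pred I) (F : I -> {freeg K / int}) :
  (forall i, p i -> supp P (F i)) -> supp P (\sum_(i <- r | p i) F i).
Proof.
move=> h; elim/big_rec: _ => [|i c pi hc]; first exact: supp0.
by apply: suppD => //; exact: h.
Qed.

Lemma supp_sub P Q c : (forall s, P s -> Q s) -> supp P c -> supp Q c.
Proof. by move=> h hc s /hc/h. Qed.

Lemma suppI P Q c : supp P c -> supp Q c -> supp (fun s => P s /\ Q s) c.
Proof. by move=> h1 h2 s hs; split; [exact: h1|exact: h2]. Qed.

Lemma suppMz P c m : supp P c -> supp P (c *~ m).
Proof.
have h n : supp P c -> supp P (c *+ n).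
  move=> hc; elim: n => [|n IH]; first by rewrite mulr0n; exact: supp0.
  by rewrite mulrS; exact: suppD.
by case: m => n hc; rewrite ?NegzE ?mulrNz; [|apply: suppN]; exact: h.
Qed.

Lemma fg_ind P (Q : {freeg K / int} -> Prop) c :
  Q 0 -> (forall c d, Q c -> Q d -> Q (c + d)) -> (forall c, Q c -> Q (- c)) ->
  (forall s, P s -> Q << s >>) -> supp P c -> Q c.
Proof.
move=> Q0 QD QN QU hc; rewrite -[c]freeg_sumE big_seq.
elim/big_rec: _ => [//|s d sc hd]; apply: (QD _ d) => //.
have Ps : P s by apply: hc; rewrite -mem_dom.
have Qn n : Q (<< s >> *+ n).
  elim: n => [|n IH]; first by rewrite mulr0n.
  by rewrite mulrS; apply: (QD) => //; exact: QU.
rewrite -[coeff s c]intz -freegU_mulz.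
by case: (coeff s c) => n; rewrite ?NegzE ?mulrNz; [|apply: QN]; exact: Qn.
Qed.

End Supported.

Definition lin (K L : choiceType) (f : K -> {freeg L / int}) (c : {freeg K / int}) :
  {freeg L / int} := fglift f c.

Section Lin.
Variables (K L : choiceType).
Implicit Types (f g : K -> {freeg L / int}).

Lemma lin_is_additive f : zmod_morphism (lin f).
Proof. exact: lift_is_additive. Qed.

HB.instance Definition _ f :=
  GRing.isZmodMorphism.Build {freeg K / int} {freeg L / int} (lin f) (lin_is_additive f).

Lemma linU f s : lin f << s >> = f s.
Proof. by rewrite /lin liftU scale1r. Qed.

Lemma supp_lin (P : K -> Prop) (Q : L -> Prop) f c :
  (forall s, P s -> supp Q (f s)) -> supp P c -> supp Q (lin f c).
Proof.
move=> h; apply: (@fg_ind _ P (fun c => supp Q (lin f c))) => [|a b ha hb|a ha|s Ps].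
- by rewrite raddf0; exact: supp0.
- by rewrite raddfD; exact: suppD.
- by rewrite raddfN; exact: suppN.
- by rewrite linU; exact: h.
Qed.

(** Chain identities are checked on generators. The predicate restricts them to sequences of the
    right length or to genuine singular simplices where the identity depends on that. *)
Lemma add_ext (M : zmodType) (F G : {additive {freeg K / int} -> M}) (P : K -> Prop) c :
  (forall s, P s -> F << s >> = G << s >>) -> supp P c -> F c = G c.
Proof.
move=> h; apply: (@fg_ind _ P (fun c => F c = G c)) => [|a b ha hb|a ha|s Ps]; last exact: h.
- by rewrite !raddf0.
- by rewrite !raddfD ha hb.
- by rewrite !raddfN ha.
Qed.

End Lin.

Section AffineChains.
Variables (R : numFieldType) (V : lmodType R).
Notation AC := {freeg (seq V) / int}.

Definition cone (b : V) : AC -> AC := lin (fun s => << b :: s >>).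

Lemma coneU b s : cone b << s >> = << b :: s >>.
Proof. exact: linU. Qed.

HB.instance Definition _ b := GRing.Additive.on (cone b).

(* The augmented boundary: [[::]] is the simplex of dimension -1, spanned by no point. *)
Fixpoint dA0 (s : seq V) : AC :=
  if s is b :: s' then << s' >> - cone b (dA0 s') else 0.

Definition dA : AC -> AC := lin dA0.
HB.instance Definition _ := GRing.Additive.on dA.

Lemma dAU s : dA << s >> = dA0 s. Proof. exact: linU. Qed.

(** There is no exception for the cone over a vertex or over the empty simplex, because the boundary
    is augmented. *)
Lemma dA_cone b c : dA (cone b c) = c - cone b (dA c).
Proof.
apply: (add_ext (F := dA \o cone b) (G := idfun \- (cone b \o dA)) (P := fun=> True)) => //.
by move=> s _ /=; rewrite coneU !dAU.
Qed.

Lemma dA_dA c : dA (dA c) = 0.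
Proof.
apply: (add_ext (F := dA \o dA) (G := \0) (P := fun=> True)) => // s _ /=.
elim: s => [|b s IH]; first by rewrite dAU raddf0.
by rewrite dAU /= raddfB /= dA_cone !dAU -(dAU s) IH raddf0 subr0 subrr.
Qed.

Definition bary (s : seq V) : V := (size s)%:R^-1 *: \sum_(x <- s) x.

(* Barycentric subdivision and its homotopy to the identity, on sequences of [n] points. *)
Fixpoint sd (n : nat) : AC -> AC :=
  if n is n'.+1 then lin (fun s => cone (bary s) (sd n' (dA0 s))) else id.

Fixpoint sdh (n : nat) : AC -> AC :=
  if n is n'.+1 then lin (fun s => cone (bary s) (<< s >> - sdh n' (dA0 s))) else fun=> 0.

Lemma sd_is_additive n : zmod_morphism (sd n).
Proof. by case: n => [|n] //; exact: lin_is_additive. Qed.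
HB.instance Definition _ n := GRing.isZmodMorphism.Build AC AC (sd n) (sd_is_additive n).

Lemma sdh_is_additive n : zmod_morphism (sdh n).
Proof. case: n => [|n] /=; [by move=> x y; rewrite subr0|exact: lin_is_additive]. Qed.
HB.instance Definition _ n := GRing.isZmodMorphism.Build AC AC (sdh n) (sdh_is_additive n).

Lemma dA_sd n c : dA (sd n.+1 c) = sd n (dA c).
Proof.
elim: n c => [|n IH] c.
  apply: (add_ext (F := dA \o sd 1) (G := sd 0 \o dA) (P := fun=> True)) => // s _ /=.
  by rewrite linU dA_cone dAU -dAU dA_dA raddf0 subr0.
apply: (add_ext (F := dA \o sd n.+2) (G := sd n.+1 \o dA) (P := fun=> True)) => // s _.
have := IH (dA0 s); rewrite -dAU dA_dA raddf0 => h.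
by rewrite [LHS]/= linU dA_cone -[lin _ _]/(sd n.+1 _) -dAU h raddf0 subr0.
Qed.

Lemma dA_sdh1 c : dA (sdh 1 c) = c - sd 1 c.
Proof.
apply: (add_ext (F := dA \o sdh 1) (G := idfun \- sd 1) (P := fun=> True)) => // s _ /=.
by rewrite !linU subr0 dA_cone dAU.
Qed.

(** With h for [sdh] and b for the barycentre of s, the boundary of b(s - h ds) is s - h ds - b(ds -
    dh ds). By induction dh ds = ds - sd ds, so the last cone is b(sd ds) = sd s. *)
Lemma dA_sdh n c : dA (sdh n.+1 c) = c - sd n.+1 c - sdh n (dA c).
Proof.
elim: n c => [|n IH] c; first by rewrite dA_sdh1 subr0.
apply: (add_ext (F := dA \o sdh n.+2) (G := idfun \- sd n.+2 \- (sdh n.+1 \o dA))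
  (P := fun=> True)) => // s _.
have h : dA (sdh n.+1 (dA0 s)) = dA0 s - sd n.+1 (dA0 s).
  by rewrite IH -dAU dA_dA raddf0 subr0.
have e1 : sd n.+2 << s >> = cone (bary s) (sd n.+1 (dA0 s)) by rewrite /= linU.
have e2 : sdh n.+2 << s >> = cone (bary s) (<< s >> - sdh n.+1 (dA0 s)).
  by rewrite /= linU.
transitivity (dA (sdh n.+2 << s >>)); first by [].
rewrite e2 dA_cone [dA (_ - _)]raddfB /= h dAU.
transitivity (<< s >> - sd n.+2 << s >> - sdh n.+1 (dA0 s)); last by rewrite -dAU.
by rewrite e1 opprB [dA0 s + _]addrC subrK addrAC.
Qed.

(** The telescoping homotopy from the identity to the m-th subdivision: the sum of [sdh] applied to
    the j-th subdivisions for j < m. *)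
Fixpoint sdhm (n m : nat) (c : AC) : AC :=
  if m is m'.+1 then sdhm n m' c + sdh n (iter m' (sd n) c) else 0.

Lemma sdm_is_additive n m : zmod_morphism (iter m (sd n)).
Proof. by elim: m => [|m IH] x y //=; rewrite IH raddfB. Qed.
HB.instance Definition _ n m :=
  GRing.isZmodMorphism.Build AC AC (iter m (sd n)) (sdm_is_additive n m).

Lemma sdhm_is_additive n m : zmod_morphism (sdhm n m).
Proof.
elim: m => [|m IH] x y /=; first by rewrite subrr.
by rewrite IH !raddfB /= opprD addrACA.
Qed.
HB.instance Definition _ n m :=
  GRing.isZmodMorphism.Build AC AC (sdhm n m) (sdhm_is_additive n m).

Lemma dA_sdm n m c : dA (iter m (sd n.+1) c) = iter m (sd n) (dA c).
Proof. by elim: m => [|m IH] //; rewrite !iterS dA_sd IH. Qed.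

Lemma dA_sdhm n m c :
  dA (sdhm n.+1 m c) = c - iter m (sd n.+1) c - sdhm n m (dA c).
Proof.
elim: m => [|m IH]; first by rewrite /= raddf0 subrr subr0.
rewrite [sdhm n.+1 _ _]/= raddfD /= IH dA_sdh dA_sdm -iterS opprD.
rewrite addrACA; congr (_ + _).
by rewrite addrA subrK.
Qed.

Lemma sdhm0 m c : sdhm 0 m c = 0.
Proof. by elim: m => [|m IH] //=; rewrite IH addr0. Qed.

Lemma sdm0 m c : iter m (sd 0) c = c.
Proof. by elim: m => [|m IH]. Qed.

Definition del (i : nat) (s : seq V) := take i s ++ drop i.+1 s.

Lemma dA0E s : dA0 s = \sum_(i < size s) << del i s >> *~ (-1) ^+ i.
Proof.
elim: s => [|b s IH]; first by rewrite big_ord0.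
rewrite /= IH big_ord_recl /= /del /= drop0 expr0; congr (_ + _).
rewrite raddf_sum -sumrN; apply: eq_bigr => i _.
by rewrite raddfMz /= coneU /del /= exprS mulN1r mulrNz.
Qed.

Lemma supp_dA (P Q : seq V -> Prop) c :
  (forall s i, P s -> (i < size s)%N -> Q (del i s)) -> supp P c -> supp Q (dA c).
Proof.
move=> h; apply: supp_lin => s Ps; rewrite dA0E; apply: supp_sum => i _.
by apply: suppMz; apply: suppU; exact: h.
Qed.

End AffineChains.

(** * Naturality of subdivision under linear maps *)

Section Natural.
Variables (R : numFieldType) (V W : lmodType R) (f : {linear V -> W}).

Definition mapA : {freeg (seq V) / int} -> {freeg (seq W) / int} :=
  lin (fun s => << map f s >>).
HB.instance Definition _ := GRing.Additive.on mapA.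

Lemma mapAU s : mapA << s >> = << map f s >>. Proof. exact: linU. Qed.

Lemma mapA_cone b c : mapA (cone b c) = cone (f b) (mapA c).
Proof.
apply: (add_ext (F := mapA \o cone b) (G := cone (f b) \o mapA) (P := fun=> True)) => //.
by move=> s _ /=; rewrite coneU !mapAU coneU.
Qed.

Lemma mapA_dA c : mapA (dA c) = dA (mapA c).
Proof.
apply: (add_ext (F := mapA \o @dA R V) (G := @dA R W \o mapA) (P := fun=> True)) => //.
move=> s _ /=; rewrite dAU mapAU dAU.
elim: s => [|b s IH] /=; first by rewrite raddf0.
by rewrite raddfB /= mapAU mapA_cone IH.
Qed.

Lemma bary_map s : bary (map f s) = f (bary s).
Proof.
by rewrite /bary size_map big_map linearZ_LR; congr (_ *: _); rewrite raddf_sum.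
Qed.

Lemma mapA_sd n c : mapA (sd n c) = sd n (mapA c).
Proof.
elim: n c => [|n IH] c //.
apply: (add_ext (F := mapA \o @sd R V n.+1) (G := @sd R W n.+1 \o mapA) (P := fun=> True)) => // s _.
by rewrite /= mapAU !linU mapA_cone bary_map IH -!dAU mapA_dA mapAU.
Qed.

Lemma mapA_sdh n c : mapA (sdh n c) = sdh n (mapA c).
Proof.
elim: n c => [|n IH] c; first by rewrite /= raddf0.
apply: (add_ext (F := mapA \o @sdh R V n.+1) (G := @sdh R W n.+1 \o mapA) (P := fun=> True)) => // s _.
by rewrite /= mapAU !linU mapA_cone bary_map raddfB /= IH -!dAU mapA_dA mapAU.
Qed.

Lemma mapA_sdm n m c : mapA (iter m (sd n) c) = iter m (sd n) (mapA c).
Proof. by elim: m => [|m IH] //=; rewrite mapA_sd IH. Qed.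

Lemma mapA_sdhm n m c : mapA (sdhm n m c) = sdhm n m (mapA c).
Proof.
by elim: m => [|m IH] /=; rewrite ?raddf0 // raddfD /= IH mapA_sdh mapA_sdm.
Qed.

End Natural.

(** * The prism operator *)

Section Prism.
Variables (R : numFieldType) (V : lmodType R).
Notation W := (V * R^o)%type.

Definition at_end (u : R) : {freeg (seq V) / int} -> {freeg (seq W) / int} :=
  lin (fun s => << [seq (v, u : R^o) | v <- s] >>).
HB.instance Definition _ u := GRing.Additive.on (at_end u).

Lemma at_endU u s : at_end u << s >> = << [seq (v, u : R^o) | v <- s] >>.
Proof. exact: linU. Qed.

(** Recursive form of the alternating sum of the simplices (v_0,0), ..., (v_i,0), (v_i,1), ...,
    (v_m,1). *)
Fixpoint prism0 (s : seq V) : {freeg (seq W) / int} :=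
  if s is v :: s' then
    << (v, 0 : R^o) :: (v, 1 : R^o) :: [seq (x, 1 : R^o) | x <- s'] >>
    - cone (v, 0 : R^o) (prism0 s')
  else 0.

Definition prism : {freeg (seq V) / int} -> {freeg (seq W) / int} := lin prism0.
HB.instance Definition _ := GRing.Additive.on prism.

Lemma prismU s : prism << s >> = prism0 s. Proof. exact: linU. Qed.

Lemma at_end_cone u b c : at_end u (cone b c) = cone (b, u : R^o) (at_end u c).
Proof.
apply: (add_ext (F := at_end u \o cone b) (G := cone (b, u : R^o) \o at_end u)
  (P := fun=> True)) => //.
by move=> s _ /=; rewrite coneU !at_endU coneU.
Qed.

Lemma at_end_dA u c : at_end u (dA c) = dA (at_end u c).
Proof.
apply: (add_ext (F := at_end u \o @dA _ V) (G := @dA _ W \o at_end u) (P := fun=> True)) => //.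
move=> s _ /=; rewrite dAU at_endU dAU.
elim: s => [|b s IH] /=; first by rewrite raddf0.
by rewrite raddfB /= at_endU at_end_cone IH.
Qed.

Lemma prism_cone b c : prism (cone b c) =
  cone (b, 0 : R^o) (cone (b, 1 : R^o) (at_end 1 c)) - cone (b, 0 : R^o) (prism c).
Proof.
apply: (add_ext (F := prism \o cone b) (G := (cone (b, 0 : R^o) \o
  (cone (b, 1 : R^o) \o at_end 1)) \- (cone (b, 0 : R^o) \o prism)) (P := fun=> True)) => //.
by move=> s _ /=; rewrite coneU !prismU at_endU !coneU.
Qed.

Lemma dA_prism c : dA (prism c) = at_end 1 c - at_end 0 c - prism (dA c).
Proof.
apply: (add_ext (F := @dA _ W \o prism)
  (G := at_end 1 \- at_end 0 \- (prism \o @dA _ V)) (P := fun=> True)) => // s _ /=.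
elim: s => [|b s IH].
  by rewrite prismU dAU /= !raddf0 !at_endU /= !subrr addr0.
rewrite -coneU prism_cone raddfB /= !dA_cone IH [prism (_ - _)]raddfB /= prism_cone.
rewrite !at_end_cone -at_end_dA ![cone (b, 0 : R^o) (_ - _)]raddfB /=.
set A := cone _ (at_end 1 << s >>); set B := cone _ (at_end 1 << s >>).
set C := cone _ (cone _ _); set D := prism << s >>; set E := cone _ (at_end 0 _).
set F := cone _ (prism _).
rewrite !opprB !addrA [cone _ (_ - at_end 0 _)]raddfB /=.
by rewrite -/B -/E addrA subrK [A + C - E]addrAC.
Qed.

End Prism.

(** * Simplices and singular chains *)

(* [nearby a e b] stands for dist(a, b) < e; maps on the standard simplex take the value [dflt]
   outside of it. *)
Record nspace (R : realType) := NSpace {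
  npt :> choiceType; nearby : npt -> R -> npt -> Prop; dflt : npt }.
Arguments nearby {R n}.
Arguments dflt {R}.

Section Simplices.
Variable R : realType.

Notation coord k := ('I_k -> R^o).

Definition std k (t : 'I_k -> R) : Prop := (forall i, 0 <= t i) /\ \sum_(i < k) t i = 1.

Definition dinj k (i : 'I_k.+1) (t : coord k) : coord k.+1 :=
  fun j => if unlift i j is Some j' then t j' else 0.

Lemma dinj_is_linear k (i : 'I_k.+1) : linear (dinj i).
Proof.
move=> a x y; apply/funext => j; rewrite /dinj !fctE.
by case: (unlift i j) => //; rewrite [a *: _]mulr0 addr0.
Qed.
HB.instance Definition _ k i :=
  GRing.isLinear.Build R (coord k) (coord k.+1) _ (dinj i) (@dinj_is_linear k i).

Lemma dinj_lift k (i : 'I_k.+1) t j : dinj i t (lift i j) = t j.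
Proof. by rewrite /dinj liftK. Qed.

Lemma dinj_same k (i : 'I_k.+1) t : dinj i t i = 0.
Proof. by rewrite /dinj unlift_none. Qed.

Lemma std_dinj k (i : 'I_k.+1) t : std (dinj i t) <-> std t.
Proof.
rewrite /std (bigD1_ord i) //= dinj_same add0r.
under eq_bigr do rewrite dinj_lift.
split=> -[h ->]; split=> // j; first by have := h (lift i j); rewrite dinj_lift.
by case: (unliftP i j) => [j'|] ->; rewrite ?dinj_lift ?dinj_same.
Qed.

Lemma std0 (t : 'I_0 -> R) : ~ std t.
Proof. by case=> _; rewrite big_ord0 => /eqP; rewrite eq_sym oner_eq0. Qed.

(** The vertices of the standard simplex. As an affine chain this is the identity simplex, on which
    natural operators are evaluated. *)
Definition ebas k : seq (coord k) := [seq (fun j => (j == i)%:R) | i <- enum 'I_k].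

Lemma size_ebas k : size (ebas k) = k.
Proof. by rewrite size_map size_enum_ord. Qed.

Lemma nth_ebas k (l : 'I_k) : nth 0 (ebas k) l = (fun j => (j == l)%:R).
Proof. by rewrite (nth_map l) ?size_enum_ord // nth_ord_enum. Qed.

Lemma nth_del (V : lmodType R) (w : seq V) i l : (i < size w)%N ->
  nth 0 (del i w) l = nth 0 w (bump i l).
Proof.
move=> h; rewrite nth_cat size_take h nth_drop /bump.
have [hl|hl] := ltnP l i; first by rewrite nth_take // leqNgt hl.
by rewrite add1n addSn subnKC.
Qed.

Lemma size_del (V : lmodType R) (w : seq V) i : (i < size w)%N ->
  size (del i w) = (size w).-1.
Proof.
move=> h; rewrite size_cat size_take h size_drop subnS -subn1.
by rewrite addnBA ?subn_gt0 // subnKC ?subn1 // ltnW.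
Qed.

Lemma ebas_dinj k (i : 'I_k.+1) : map (dinj i) (ebas k) = del i (ebas k.+1).
Proof.
apply: (@eq_from_nth _ 0).
  by rewrite size_map size_del !size_ebas.
move=> l; rewrite size_map size_ebas => hl; pose l' := Ordinal hl.
rewrite nth_del ?size_ebas // (nth_map 0) ?size_ebas //.
rewrite (nth_ebas l') -[bump i l]/(val (lift i l')) nth_ebas.
apply/funext => j; rewrite /dinj; case: unliftP => [j'|] -> //.
  by rewrite (inj_eq (@lift_inj _ i)).
by rewrite (negbTE (neq_lift _ _)).
Qed.

Definition comb (V : lmodType R) j (w : seq V) (t : 'I_j -> R) : V :=
  \sum_(l < j) t l *: nth 0 w l.

Lemma comb_ebas k (t : coord k) : comb (ebas k) t = t.
Proof.
rewrite /comb; under eq_bigr do rewrite nth_ebas.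
apply/funext => j; rewrite fct_sumE (bigD1 j) //= big1 => [|l lj].
  by rewrite !fctE eqxx [_ *: _]mulr1 addr0.
by rewrite !fctE eq_sym (negbTE lj) [_ *: _]mulr0.
Qed.

Lemma comb_map (V W : lmodType R) (f : {linear V -> W}) j w (t : 'I_j -> R) :
  comb (map f w) t = f (comb w t).
Proof.
rewrite /comb linear_sum; apply: eq_bigr => l _; rewrite linearZ_LR; congr (_ *: _).
have [h|h] := ltnP l (size w); first by rewrite (nth_map 0).
by rewrite !nth_default ?size_map // raddf0.
Qed.

Lemma comb_del (V : lmodType R) j (w : seq V) (i : 'I_j.+1) (t : 'I_j -> R) :
  size w = j.+1 -> comb (del i w) t = comb w (dinj i t).
Proof.
move=> sw; rewrite /comb [RHS](bigD1_ord i) //= dinj_same scale0r add0r.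
by apply: eq_bigr => l _; rewrite dinj_lift nth_del ?sw.
Qed.

Section Push.
Variable T : nspace R.

(* A k-simplex has k vertices, one less than usual. Index 0 holds the empty simplex, so that
   [bdry] is the boundary of the augmented complex and absolute homology is reduced. *)
Definition simplex k : choiceType := (('I_k -> R) -> T).

Definition sface k (i : 'I_k.+1) (s : simplex k.+1) : simplex k :=
  fun t => s (fun j => if unlift i j is Some j' then t j' else 0).

Definition bdry k : {freeg (simplex k.+1) / int} -> {freeg (simplex k) / int} :=
  lin (fun s => \sum_(i < k.+1) << sface i s >> *~ (-1) ^+ i).
HB.instance Definition _ k := GRing.Additive.on (@bdry k).

Lemma bdU k (s : simplex k.+1) : bdry << s >> = \sum_(i < k.+1) << sface i s >> *~ (-1) ^+ i.
Proof. exact: linU. Qed.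

Variable V : lmodType R.
Implicit Types (g : V -> T).

Definition affine_simplex g j (w : seq V) : simplex j :=
  fun t => if `[< std t >] then g (comb w t) else dflt T.
Arguments affine_simplex g j w : clear implicits.

Definition push g j : {freeg (seq V) / int} -> {freeg (simplex j) / int} :=
  lin (fun w => << affine_simplex g j w >>).
HB.instance Definition _ g j := GRing.Additive.on (push g j).

Lemma pushU g j w : push g j << w >> = << affine_simplex g j w >>. Proof. exact: linU. Qed.

Lemma sface_affine_simplex g j (i : 'I_j.+1) w : size w = j.+1 -> sface i (affine_simplex g j.+1 w) = affine_simplex g j (del i w).
Proof.
move=> sw; apply/funext => t; rewrite /sface /affine_simplex -/(dinj i t) (comb_del _ _ sw).
by congr (if _ then _ else _); apply/asboolP/asboolP => /std_dinj.
Qed.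

(** The support condition ties the index [j], which [push] does not check, to the number of
    vertices. *)
Lemma bdry_push g j c : supp (fun w => size w = j.+1) c ->
  bdry (push g j.+1 c) = push g j (dA c).
Proof.
apply: (add_ext (F := @bdry j \o push g j.+1) (G := push g j \o @dA _ V)) => w sw /=.
rewrite pushU bdU dAU dA0E raddf_sum sw; apply: eq_bigr => i _.
by rewrite raddfMz /= pushU sface_affine_simplex.
Qed.

End Push.
Arguments affine_simplex {T V} g j w.

Lemma push_map (T : nspace R) (V W : lmodType R) (f : {linear V -> W}) (g : W -> T) j c :
  push g j (mapA f c) = push (g \o f) j c.
Proof.
apply: (add_ext (F := push g j \o mapA f) (G := push (g \o f) j) (P := fun=> True)) => //.
move=> w _ /=; rewrite mapAU !pushU; congr (<< _ >>); apply/funext => t.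
by rewrite /affine_simplex comb_map.
Qed.

Lemma dA_ebas k : dA << ebas k.+1 >> =
  \sum_(i < k.+1) mapA (dinj i) << ebas k >> *~ (-1) ^+ i.
Proof.
rewrite dAU dA0E size_ebas; apply: eq_bigr => i _.
by rewrite mapAU ebas_dinj.
Qed.

Definition hull (V : lmodType R) n (Q : V -> Prop) (s : seq V) :=
  size s = n /\ {in s, forall x, Q x}.

Lemma mem_del (V : lmodType R) (w : seq V) i x : x \in del i w -> x \in w.
Proof. by rewrite mem_cat => /orP[/mem_take|/mem_drop]. Qed.

Lemma hull_dA (V : lmodType R) n (Q : V -> Prop) c :
  supp (hull n.+1 Q) c -> supp (hull n Q) (dA c).
Proof.
apply: supp_dA => s i [sn hs] hi; split; first by rewrite size_del // sn.
by move=> x /mem_del/hs.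
Qed.

Lemma hull_cone (V : lmodType R) n (Q : V -> Prop) b c : Q b ->
  supp (hull n Q) c -> supp (hull n.+1 Q) (cone b c).
Proof.
move=> Qb; apply: supp_lin => s [sn hs]; apply: suppU; split; first by rewrite /= sn.
by move=> x; rewrite inE => /orP[/eqP->|/hs].
Qed.

Section HullSd.
Variables (V : lmodType R) (Q : V -> Prop).
Hypothesis HQ : forall s, (0 < size s)%N -> {in s, forall x, Q x} -> Q (bary s).

Lemma hull_sd n c : supp (hull n Q) c -> supp (hull n Q) (sd n c).
Proof.
elim: n c => [//|n IH] c /=; apply: supp_lin => s hs; apply: hull_cone.
  by apply: HQ; [rewrite hs.1|exact: hs.2].
by apply: IH; rewrite -dAU; apply: hull_dA; exact: suppU.
Qed.

Lemma hull_sdh n c : supp (hull n Q) c -> supp (hull n.+1 Q) (sdh n c).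
Proof.
elim: n c => [|n IH] c /=; first by move=> _; exact: supp0.
apply: supp_lin => s hs; apply: hull_cone.
  by apply: HQ; [rewrite hs.1|exact: hs.2].
apply: suppB; first exact: suppU.
by apply: IH; rewrite -dAU; apply: hull_dA; exact: suppU.
Qed.

Lemma hull_sdm n m c : supp (hull n Q) c -> supp (hull n Q) (iter m (sd n) c).
Proof. by move=> h; elim: m => [|m IH] //=; exact: hull_sd. Qed.

Lemma hull_sdhm n m c : supp (hull n Q) c -> supp (hull n.+1 Q) (sdhm n m c).
Proof.
move=> h; elim: m => [|m IH] /=; first exact: supp0.
by apply: suppD => //; apply: hull_sdh; exact: hull_sdm.
Qed.

End HullSd.

Definition hstd j k : seq (coord k) -> Prop := @hull (coord k) j (@std k).

Lemma std_ebas k : supp (@hstd k k) << ebas k >>.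
Proof.
apply: suppU; split; first exact: size_ebas.
move=> x /mapP[i _ ->]; split=> [j|]; first exact: ler0n.
by rewrite (bigD1 i) //= eqxx big1 ?addr0 // => j /negbTE ->.
Qed.

Lemma std_comb (k j : nat) (w : seq (coord k)) (t : 'I_j -> R) : hstd j w -> std t -> std (comb w t).
Proof.
case=> sw hw [t0 t1].
have hn (l : 'I_j) : std (nth 0 w l) by apply: hw; rewrite mem_nth // sw.
split=> [i|].
  rewrite /comb fct_sumE; apply: sumr_ge0 => l _; rewrite fctE.
  by apply: mulr_ge0; [exact: t0|have [] := hn l].
under eq_bigr do rewrite /comb fct_sumE.
rewrite exchange_big /= -t1; apply: eq_bigr => l _; rewrite -mulr_sumr.
by have [_ ->] := hn l; rewrite mulr1.
Qed.

Lemma std_bary k (s : seq (coord k)) : (0 < size s)%N ->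
  {in s, forall x, std x} -> std (bary s).
Proof.
move=> s0 hs; have -> : bary s = comb s (fun _ : 'I_(size s) => (size s)%:R^-1).
  by rewrite /bary /comb -scaler_sumr; congr (_ *: _); rewrite (big_nth 0) big_mkord.
apply: std_comb => //; split=> [i|]; first by rewrite invr_ge0.
by rewrite sumr_const card_ord -[_^-1 *+ _]mulr_natr mulVf // pnatr_eq0 -lt0n.
Qed.

End Simplices.
Arguments affine_simplex {R T V} g j w.
Arguments push {R T V} g j c.
Arguments ebas R k : clear implicits.

(** * Singular chains and their subdivision *)

Section SingularChains.
Variable R : realType.
Notation coord k := ('I_k -> R^o).

Section Carriers.
Variable T : nspace R.
Notation SC k := {freeg (simplex T k) / int}.

Definition singular k (s : simplex T k) : Prop :=
  (forall t, ~ std t -> s t = dflt T) /\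
  (forall t, std t -> forall e : R, 0 < e -> exists2 d : R, 0 < d &
     forall u, std u -> (forall i, `|u i - t i| < d) -> nearby (s t) e (s u)).

(* (true, A) stands for the singular complex of A, and (false, _) for the zero complex, which
   unlike that of the empty set has no empty simplex. *)
Definition carrier := (bool * set T)%type.

Definition carried (X : carrier) k (s : simplex T k) :=
  [/\ X.1, singular s & forall t, std t -> X.2 (s t)].

Definition Ch (X : carrier) k (c : SC k) := supp (@carried X k) c.

Definition cyc (X : carrier) k : SC k -> Prop :=
  match k return SC k -> Prop with 0 => fun=> True | k'.+1 => fun c => Ch X (bdry c) end.

Lemma Ch_D X k (c d : SC k) : Ch X c -> Ch X d -> Ch X (c + d). Proof. exact: suppD. Qed.
Lemma Ch_N X k (c : SC k) : Ch X c -> Ch X (- c). Proof. exact: suppN. Qed.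
Lemma Ch_B X k (c d : SC k) : Ch X c -> Ch X d -> Ch X (c - d). Proof. exact: suppB. Qed.
Lemma Ch_0 X k : Ch X (0 : SC k). Proof. exact: supp0. Qed.

Definition subcar (X Y : carrier) := (X.1 -> Y.1) /\ X.2 `<=` Y.2.

Lemma Ch_sub X Y k (c : SC k) : subcar X Y -> Ch X c -> Ch Y c.
Proof.
move=> [h1 h2]; apply: supp_sub => s [b hs hA]; split=> //; first exact: h1.
by move=> t /hA/h2.
Qed.

Lemma cyc_sub X Y k (c : SC k) : subcar X Y -> cyc X c -> cyc Y c.
Proof. by case: k c => [|k] c //=; exact: Ch_sub. Qed.

Lemma cycD X k (c d : SC k) : cyc X c -> cyc X d -> cyc X (c + d).
Proof. by case: k c d => [|k] c d //=; rewrite raddfD; exact: Ch_D. Qed.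
Lemma cycN X k (c : SC k) : cyc X c -> cyc X (- c).
Proof. by case: k c => [|k] c //=; rewrite raddfN; exact: Ch_N. Qed.
Lemma cycB X k (c d : SC k) : cyc X c -> cyc X d -> cyc X (c - d).
Proof. by move=> h1 h2; apply: cycD => //; exact: cycN. Qed.

(** A functional at most 1 at the vertices varies by at most the sum of the changes of the j
    coordinates. Dividing by j + 1 makes the bound strict and covers j = 0. *)
Lemma comb_close (V : lmodType R) (phi : V -> R) j (w : seq V) (t u : 'I_j -> R) d :
  (forall v : 'I_j -> R, phi (comb w v) = \sum_(l < j) v l * phi (nth 0 w l)) ->
  (forall l : 'I_j, `|phi (nth 0 w l)| <= 1) ->
  0 < d -> (forall i, `|u i - t i| < d / j.+1%:R) -> `|phi (comb w u) - phi (comb w t)| < d.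
Proof.
move=> hphi h1 d0 ht; rewrite !hphi -sumrB.
apply: (le_lt_trans (ler_norm_sum _ _ _)).
apply: (@le_lt_trans _ _ (\sum_(l < j) d / j.+1%:R)).
  apply: ler_sum => l _; rewrite -mulrBl normrM -[leRHS]mulr1.
  by apply: ler_pM => //; apply: ltW; exact: ht.
rewrite sumr_const card_ord -[ltLHS]mulr_natr -mulrA gtr_pMr //.
by rewrite mulrC ltr_pdivrMr ?ltr0Sn // mul1r ltr_nat.
Qed.

Lemma std_le1 k (t : 'I_k -> R) i : std t -> `|t i| <= 1.
Proof.
case=> t0 t1; rewrite ger0_norm // -t1 (bigD1 i) //= lerDl.
by apply: sumr_ge0.
Qed.

Lemma comb_coord k j (w : seq (coord k)) (v : 'I_j -> R) i :
  comb w v i = \sum_(l < j) v l * (nth 0 w l : coord k) i.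
Proof. by rewrite /comb fct_sumE. Qed.

Lemma carried_affine_simplex (X : carrier) (V : lmodType R) (g : V -> T) j (w : seq V) :
  X.1 -> (forall t : 'I_j -> R, std t -> X.2 (g (comb w t))) ->
  (forall t : 'I_j -> R, std t -> forall e : R, 0 < e -> exists2 d : R, 0 < d &
    forall u : 'I_j -> R, std u -> (forall i, `|u i - t i| < d) ->
      nearby (g (comb w t)) e (g (comb w u))) ->
  carried X (affine_simplex g j w).
Proof.
move=> b hA hc; split=> //; last first.
  by move=> t ht; rewrite /affine_simplex asboolT //; exact: hA.
split=> [t ht|t ht e e0]; first by rewrite /affine_simplex asboolF.
have [d d0 hd] := hc t ht e e0; exists d => // u hu tu.
by rewrite /affine_simplex !asboolT //; exact: hd.
Qed.

Lemma carried_affine_simplex_std X k (s : simplex T k) j (w : seq (coord k)) :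
  carried X s -> hstd j w -> carried X (affine_simplex (s : coord k -> T) j w).
Proof.
move=> [b [s0 sc] sA] hw; apply: carried_affine_simplex => // t ht; first by apply: sA; exact: std_comb.
move=> e e0; have [d d0 hd] := sc (comb w t) (std_comb hw ht) e e0.
exists (d / j.+1%:R); first by rewrite divr_gt0.
move=> u hu tu; apply: hd; first exact: std_comb.
move=> i; apply: (comb_close (phi := fun x : coord k => x i)) => //.
  by move=> v; exact: comb_coord.
by move=> l; apply: std_le1; apply: hw.2; rewrite mem_nth // hw.1.
Qed.

Lemma Ch_push X k (s : simplex T k) j (c : {freeg (seq (coord k)) / int}) :
  carried X s -> supp (@hstd _ j k) c -> Ch X (push (s : coord k -> T) j c).
Proof. by move=> hs; apply: supp_lin => w hw; apply: suppU; exact: carried_affine_simplex_std. Qed.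

(** Every singular simplex is the image of the identity affine simplex, so identities of affine
    chains pass to singular ones. *)
Lemma affine_simplex_ebas k (s : simplex T k) : singular s -> affine_simplex (s : coord k -> T) k (ebas R k) = s.
Proof.
move=> [s0 _]; apply/funext => t; rewrite /affine_simplex comb_ebas.
by case: asboolP => // /s0.
Qed.

Lemma Ch_bdry X k (c : SC k.+1) : Ch X c -> Ch X (bdry c).
Proof.
apply: supp_lin => s hs; apply: supp_sum => i _; apply: suppMz; apply: suppU.
have [_ ss _] := hs.
rewrite -(affine_simplex_ebas ss) sface_affine_simplex ?size_ebas // -ebas_dinj.
apply: carried_affine_simplex_std => //; split; first by rewrite size_map size_ebas.
move=> x; rewrite ebas_dinj => /mem_del /mapP[l _ ->].
have := @std_ebas R k.+1 (ebas R k.+1); rewrite coeffU eqxx mulr1 => h.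
by apply: (h isT).2; apply: map_f; rewrite mem_enum.
Qed.

Lemma cyc_Ch X k (c : SC k) : Ch X c -> cyc X c.
Proof. by case: k c => [|k] c //; exact: Ch_bdry. Qed.

Lemma bdry_bdry X k (c : SC k.+2) : Ch X c -> bdry (bdry c) = 0.
Proof.
apply: (add_ext (F := @bdry R T k \o @bdry R T k.+1) (G := \0)) => s [_ ss _] /=.
rewrite -(affine_simplex_ebas ss) -pushU bdry_push ?bdry_push ?dA_dA ?raddf0 //.
  apply: (@supp_dA _ _ (fun w => size w = k.+2)); last by apply: suppU; exact: size_ebas.
  by move=> w i hw hi; rewrite size_del // hw.
by apply: suppU; exact: size_ebas.
Qed.

Lemma cyc_bdry X Y k (d : SC k.+1) : Ch X d -> cyc Y (bdry d).
Proof. by case: k d => [|k] d h //=; rewrite (bdry_bdry h); exact: Ch_0. Qed.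

Definition Sd m k : SC k -> SC k :=
  lin (fun s => push (s : coord k -> T) k (iter m (@sd _ _ k) << ebas R k >>)).
HB.instance Definition _ m k := GRing.Additive.on (@Sd m k).

Definition Sh m k : SC k -> SC k.+1 :=
  lin (fun s => push (s : coord k -> T) k.+1 (sdhm k m << ebas R k >>)).
HB.instance Definition _ m k := GRing.Additive.on (@Sh m k).

Lemma hstd_sdm m k : supp (@hstd R k k) (iter m (@sd _ _ k) << ebas R k >>).
Proof. by apply: hull_sdm => [s|]; [exact: std_bary|exact: std_ebas]. Qed.

Lemma hstd_sdhm m k : supp (@hstd R k.+1 k) (sdhm k m << ebas R k >>).
Proof. by apply: hull_sdhm => [s|]; [exact: std_bary|exact: std_ebas]. Qed.

Lemma hstd_size j k (c : {freeg (seq (coord k)) / int}) :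
  supp (@hstd R j k) c -> supp (fun w => size w = j) c.
Proof. by apply: supp_sub => s []. Qed.

Lemma Ch_Sd m X k (c : SC k) : Ch X c -> Ch X (Sd m c).
Proof. by apply: supp_lin => s hs; apply: Ch_push => //; exact: hstd_sdm. Qed.

Lemma Ch_Sh m X k (c : SC k) : Ch X c -> Ch X (Sh m c).
Proof. by apply: supp_lin => s hs; apply: Ch_push => //; exact: hstd_sdhm. Qed.

Lemma bdry_Sd m k (c : SC k.+1) : bdry (Sd m c) = Sd m (bdry c).
Proof.
apply: (add_ext (F := @bdry R T k \o Sd m (k := k.+1)) (G := Sd m (k := k) \o @bdry R T k)
  (P := fun=> True)) => // s _ /=.
rewrite /Sd linU bdry_push; last by apply: hstd_size; exact: hstd_sdm.
rewrite dA_sdm dA_ebas raddf_sum raddf_sum bdU raddf_sum; apply: eq_bigr => i _.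
by rewrite !raddfMz /= linU -mapA_sdm push_map.
Qed.

Lemma Sd0 m (c : SC 0) : supp (@singular 0) c -> Sd m c = c.
Proof.
apply: (add_ext (F := Sd m (k := 0)) (G := idfun)) => s hs.
by rewrite /= /Sd linU sdm0 pushU affine_simplex_ebas.
Qed.

Lemma bdry_Sh0 m (c : SC 0) : bdry (Sh m c) = 0.
Proof.
apply: (add_ext (F := @bdry R T 0 \o Sh m (k := 0)) (G := \0) (P := fun=> True)) => // s _ /=.
by rewrite /Sh linU sdhm0 !raddf0.
Qed.

Lemma bdry_Sh m k (c : SC k.+1) : supp (@singular k.+1) c ->
  bdry (Sh m c) = c - Sd m c - Sh m (bdry c).
Proof.
apply: (add_ext (F := @bdry R T k.+1 \o Sh m (k := k.+1))
  (G := idfun \- Sd m (k := k.+1) \- (Sh m (k := k) \o @bdry R T k))) => s hs /=.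
rewrite /Sh /Sd !linU bdry_push; last by apply: hstd_size; exact: hstd_sdhm.
rewrite dA_sdhm !raddfB /= pushU affine_simplex_ebas //; congr (_ - _).
rewrite dA_ebas raddf_sum raddf_sum bdU raddf_sum; apply: eq_bigr => i _.
by rewrite !raddfMz /= linU -mapA_sdhm push_map.
Qed.

Lemma Ch_singular X k (c : SC k) : Ch X c -> supp (@singular k) c.
Proof. by apply: supp_sub => s []. Qed.

(** The homotopy of [c] stays in X and the homotopy of its boundary stays in Y, so subdivision keeps
    the relative class. *)
Lemma subdiv m X Y k (c : SC k) : Ch X c -> cyc Y c -> exists d e,
  [/\ Ch X d, Ch Y e & c - Sd m c = bdry d + e].
Proof.
move=> hX hY; exists (Sh m c); case: k c hX hY => [|k] c hX hY.
  exists 0; split; [exact: Ch_Sh|exact: Ch_0|].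
  by rewrite (Sd0 _ (Ch_singular hX)) subrr bdry_Sh0 addr0.
exists (Sh m (bdry c)); split; [exact: Ch_Sh|exact: Ch_Sh|].
by rewrite (bdry_Sh _ (Ch_singular hX)) subrK.
Qed.

End Carriers.
End SingularChains.

(** * Homotopy invariance *)

Section Homotopy.
Variables (R : realType) (T T' : nspace R).
Notation coord k := ('I_k -> R^o).
Notation SC k := {freeg (simplex T k) / int}.
Notation SC' k := {freeg (simplex T' k) / int}.

Definition image_simplex (f : T -> T') k (s : simplex T k) : simplex T' k :=
  fun t => if `[< std t >] then f (s t) else dflt T'.

Definition image_chain (f : T -> T') k : SC k -> SC' k := lin (fun s => << image_simplex f s >>).
HB.instance Definition _ f k := GRing.Additive.on (@image_chain f k).

Definition fcont (A : set T) (f : T -> T') := forall a, A a -> forall e : R, 0 < e ->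
  exists2 d : R, 0 < d & forall a', A a' -> nearby a d a' -> nearby (f a) e (f a').

Definition hcont (A : set T) (H : R -> T -> T') := forall u a, 0 <= u <= 1 -> A a ->
  forall e : R, 0 < e -> exists2 d : R, 0 < d &
    forall u' a', 0 <= u' <= 1 -> A a' -> `|u' - u| < d -> nearby a d a' ->
      nearby (H u a) e (H u' a').

Definition maps (X : carrier T) (X' : carrier T') (f : T -> T') :=
  (X.1 -> X'.1) /\ (forall a, X.2 a -> X'.2 (f a)).

Lemma carried_image_simplex X X' f k (s : simplex T k) : fcont X.2 f -> maps X X' f ->
  carried X s -> carried X' (image_simplex f s).
Proof.
move=> fc [b1 b2] [b [s0 sc] sA]; split; [exact: b1| |]; last first.
  by move=> t ht; rewrite /image_simplex asboolT //; apply: b2; exact: sA.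
split=> [t ht|t ht e e0]; first by rewrite /image_simplex asboolF.
have [d d0 hd] := fc _ (sA t ht) e e0; have [d' d'0 hd'] := sc t ht d d0.
by exists d' => // u hu tu; rewrite /image_simplex !asboolT //; apply: hd; [exact: sA|exact: hd'].
Qed.

Lemma Ch_image_chain X X' f k (c : SC k) : fcont X.2 f -> maps X X' f -> Ch X c -> Ch X' (image_chain f c).
Proof. by move=> h1 h2; apply: supp_lin => s hs; apply: suppU; exact: carried_image_simplex hs. Qed.

Lemma bdry_image_chain f k (c : SC k.+1) : bdry (image_chain f c) = image_chain f (bdry c).
Proof.
apply: (add_ext (F := @bdry R T' k \o @image_chain f k.+1) (G := @image_chain f k \o @bdry R T k)
  (P := fun=> True)) => // s _ /=.
rewrite /image_chain linU !bdU raddf_sum; apply: eq_bigr => i _.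
rewrite raddfMz /= linU; congr (<< _ >> *~ _); apply/funext => t; rewrite /sface /image_simplex.
by congr (if _ then _ else _); apply/asboolP/asboolP => /(std_dinj i).
Qed.

Lemma cyc_image_chain X X' f k (c : SC k) : fcont X.2 f -> maps X X' f ->
  cyc X c -> cyc X' (image_chain f c).
Proof. by case: k c => [|k] c //= h1 h2 hc; rewrite bdry_image_chain; exact: Ch_image_chain hc. Qed.

Variable H : R -> T -> T'.

Definition prism_chain k : SC k -> SC' k.+1 :=
  lin (fun s => push (fun p : (coord k * R^o)%type => H p.2 (s p.1)) k.+1
     (prism << ebas R k >>)).
HB.instance Definition _ k := GRing.Additive.on (@prism_chain k).

Lemma push_at_end k (s : simplex T k) u :
  push (fun p : (coord k * R^o)%type => H p.2 (s p.1)) k (at_end u << ebas R k >>) =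
  << image_simplex (H u) s >>.
Proof.
rewrite at_endU pushU; congr (<< _ >>); apply/funext => t; rewrite /affine_simplex /image_simplex.
case: asboolP => // ht.
have -> : comb [seq (v, u : R^o) | v <- ebas R k] t = (t : coord k, u : R^o).
  have nthE (l : 'I_k) : nth 0 [seq (v, u : R^o) | v <- ebas R k] l =
      (nth 0 (ebas R k) l, u : R^o) by rewrite (nth_map 0) ?size_ebas.
  rewrite [LHS]surjective_pairing; congr pair.
    rewrite -[RHS]comb_ebas /comb (raddf_sum fst); apply: eq_bigr => l _.
    by rewrite nthE.
  rewrite /comb (raddf_sum snd) -[RHS]mul1r -ht.2 mulr_suml; apply: eq_bigr => l _.
  by rewrite nthE.
by [].
Qed.

Lemma hull_prism (V : lmodType R) n (Q : V -> Prop) c : supp (hull n Q) c ->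
  supp (hull n.+1 (fun p : (V * R^o)%type => Q p.1 /\ (p.2 = 0 \/ p.2 = 1))) (prism c).
Proof.
apply: supp_lin => s; elim: s n => [|v s IH] n [sn hs] /=; first exact: supp0.
apply: suppB.
  apply: suppU; split; first by rewrite /= size_map -sn.
  have Qv : Q v by apply: hs; exact: mem_head.
  move=> x; rewrite !inE => /or3P[/eqP->|/eqP->|/mapP[y ys ->]] /=.
  - by split=> //; left.
  - by split=> //; right.
  - by split; [apply: hs; rewrite inE ys orbT|right].
case: n sn => [//|n] [sn]; apply: hull_cone.
  by split; [apply: hs; exact: mem_head|left].
by apply: IH; split=> // x xs; apply: hs; rewrite inE xs orbT.
Qed.

Lemma bdry_prism_chain_aux k (s : simplex T k) : bdry (prism_chain << s >>) = << image_simplex (H 1) s >> - << image_simplex (H 0) s >>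
  - push (fun p : (coord k * R^o)%type => H p.2 (s p.1)) k (prism (dA << ebas R k >>)).
Proof.
rewrite /prism_chain linU bdry_push.
  by rewrite dA_prism !raddfB /= !push_at_end.
by apply: supp_sub (hull_prism (@std_ebas R k)) => w [].
Qed.

Lemma bdry_PR0 (c : SC 0) : bdry (prism_chain c) = image_chain (H 1) c - image_chain (H 0) c.
Proof.
apply: (add_ext (F := @bdry R T' 0 \o @prism_chain 0) (G := @image_chain (H 1) 0 \- @image_chain (H 0) 0)
  (P := fun=> True)) => // s _ /=.
rewrite bdry_prism_chain_aux /image_chain !linU.
have -> : ebas R 0 = [::] by apply: size0nil; exact: size_ebas.
have -> : dA << [::] >> = 0 :> {freeg (seq (coord 0)) / int} by rewrite dAU.
by rewrite !raddf0 addr0.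
Qed.

Lemma bdry_prism_chain k (c : SC k.+1) : bdry (prism_chain c) = image_chain (H 1) c - image_chain (H 0) c - prism_chain (bdry c).
Proof.
apply: (add_ext (F := @bdry R T' k.+1 \o @prism_chain k.+1)
  (G := @image_chain (H 1) k.+1 \- @image_chain (H 0) k.+1 \- (@prism_chain k \o @bdry R T k))
  (P := fun=> True)) => // s _ /=.
rewrite bdry_prism_chain_aux /image_chain !linU; congr (_ - _).
rewrite dA_ebas bdU !raddf_sum; apply: eq_bigr => i _.
rewrite !raddfMz /= /prism_chain linU; congr (_ *~ _).
(* The face inclusion times the identity of the height: it carries the prism over the smaller
   simplex to the prism over the face. *)
pose L := (fun p => (dinj i p.1, p.2)) : (coord k * R^o)%type -> (coord k.+1 * R^o)%type.
have linL : linear L by move=> a [x1 x2] [y1 y2]; rewrite /L /= linearP.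
pose L' := HB.pack_for {linear (coord k * R^o)%type -> (coord k.+1 * R^o)%type} L
  (GRing.isLinear.Build R _ _ _ L linL).
have h (c' : {freeg (seq (coord k)) / int}) : prism (mapA (dinj i) c') = mapA L' (prism c').
  apply: (add_ext (F := @prism R (coord k.+1) \o mapA (dinj i)) (G := mapA L' \o @prism R (coord k))
    (P := fun=> True)) => // w _ /=.
  rewrite mapAU !prismU; elim: w => [|v w IH] /=; first by rewrite raddf0.
  by rewrite raddfB /= mapA_cone mapAU IH /= -!map_comp.
by rewrite h push_map.
Qed.

Lemma Ch_prism_chain X X' k (c : SC k) : hcont X.2 H ->
  (forall u, 0 <= u <= 1 -> maps X X' (H u)) -> Ch X c -> Ch X' (prism_chain c).
Proof.
move=> hc hm; apply: supp_lin => s [b [s0 sc] sA]; apply: supp_lin (hull_prism (@std_ebas R k)).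
move=> w [sw hw]; apply: suppU.
have c1 (t : 'I_k.+1 -> R) : (comb w t).1 = comb [seq p.1 | p <- w] t.
  rewrite /comb (raddf_sum fst); apply: eq_bigr => l _.
  by rewrite (nth_map 0) // sw.
have c2 (t : 'I_k.+1 -> R) : (comb w t).2 = \sum_(l < k.+1) t l * (nth 0 w l).2.
  by rewrite /comb (raddf_sum snd); apply: eq_bigr.
have hn (l : 'I_k.+1) := hw _ (mem_nth 0 (eq_ind_r (fun n => (l < n)%N) (ltn_ord l) sw)).
have hw1 : hstd k.+1 [seq p.1 | p <- w].
  by split; [rewrite size_map|move=> x /mapP[p /hw[? _] ->]].
have h01 (l : 'I_k.+1) : 0 <= ((nth 0 w l).2 : R) <= 1.
  by have [_ [->|->]] := hn l; rewrite ?lexx ?ler01.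
have std1 (t : 'I_k.+1 -> R) : std t -> std (comb w t).1.
  by rewrite c1; exact: std_comb.
have std2 (t : 'I_k.+1 -> R) : std t -> 0 <= ((comb w t).2 : R) <= 1.
  move=> [t0 t1]; rewrite c2; apply/andP; split.
    by apply: sumr_ge0 => l _; apply: mulr_ge0; [exact: t0|have /andP[] := h01 l].
  rewrite -[leRHS]t1; apply: ler_sum => l _; rewrite -[leRHS]mulr1.
  by apply: ler_wpM2l; [exact: t0|have /andP[] := h01 l].
apply: carried_affine_simplex.
- by have [|h _] := hm 0; [rewrite lexx ler01|exact: h].
- by move=> t ht; apply: (hm _ (std2 t ht)).2; apply: sA; exact: std1.
move=> t ht e e0.
have [d d0 hd] := hc _ _ (std2 t ht) (sA _ (std1 t ht)) e e0.
have [d' d'0 hd'] := sc _ (std1 t ht) d d0.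
(* The height and each base coordinate are linear and at most 1 at the vertices, so [comb_close]
   controls both with one modulus. *)
pose d2 := Num.min d d'; have d20 : 0 < d2 by rewrite lt_min d0.
exists (d2 / k.+2%:R) => [|u hu tu]; first by rewrite divr_gt0.
apply: hd; [exact: std2|by apply: sA; exact: std1| |].
  apply: (@lt_le_trans _ _ d2); last by rewrite ge_min lexx.
  apply: (comb_close (phi := fun p : (coord k * R^o)%type => p.2)) => //.
  by move=> l; have /andP[h0 h1] := h01 l; rewrite ger0_norm.
apply: hd'; first exact: std1.
move=> i; apply: (@lt_le_trans _ _ d2); last by rewrite ge_min lexx orbT.
apply: (comb_close (phi := fun p : (coord k * R^o)%type => p.1 i)) => //.
  move=> v; rewrite c1 comb_coord; apply: eq_bigr => l _; rewrite (nth_map 0) // sw.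
  exact: ltn_ord.
by move=> l; apply: std_le1; have [] := hn l.
Qed.

Lemma homotopy_chain X X' Y Y' k (c : SC k) : hcont X.2 H -> hcont Y.2 H ->
  (forall u, 0 <= u <= 1 -> maps X X' (H u)) ->
  (forall u, 0 <= u <= 1 -> maps Y Y' (H u)) ->
  Ch X c -> cyc Y c -> exists d e,
  [/\ Ch X' d, Ch Y' e & image_chain (H 1) c - image_chain (H 0) c = bdry d + e].
Proof.
move=> cX cY mX mY hX hY; exists (prism_chain c); case: k c hX hY => [|k] c hX hY.
  exists 0; split; [exact: Ch_prism_chain hX|exact: Ch_0|by rewrite bdry_PR0 addr0].
exists (prism_chain (bdry c)); split; [exact: Ch_prism_chain hX|exact: Ch_prism_chain hY|].
by rewrite bdry_prism_chain subrK.
Qed.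

End Homotopy.

Lemma image_chain_comp (R : realType) (T1 T2 T3 : nspace R) (f : T1 -> T2) (g : T2 -> T3) k
  (c : {freeg (simplex T1 k) / int}) : image_chain g (image_chain f c) = image_chain (g \o f) c.
Proof.
apply: (add_ext (F := @image_chain _ _ _ g k \o @image_chain _ _ _ f k) (G := @image_chain _ _ _ (g \o f) k)
  (P := fun=> True)) => // s _ /=.
rewrite /image_chain !linU; congr (<< _ >>); apply/funext => t; rewrite /image_simplex.
by case: asboolP => // ht; rewrite asboolT.
Qed.

Lemma image_chain_id (R : realType) (T : nspace R) (f : T -> T) (X : carrier T) k
  (c : {freeg (simplex T k) / int}) : (forall a, X.2 a -> f a = a) -> Ch X c -> image_chain f c = c.
Proof.
move=> hf; apply: (add_ext (F := @image_chain _ _ _ f k) (G := idfun)) => s [_ [s0 _] sA] /=.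
rewrite /image_chain linU; congr (<< _ >>); apply/funext => t; rewrite /image_simplex.
by case: asboolP => ht; [exact/hf/sA|rewrite s0].
Qed.

Lemma eq_image_chain (R : realType) (T T' : nspace R) (f g : T -> T') (X : carrier T) k
  (c : {freeg (simplex T k) / int}) : (forall a, X.2 a -> f a = g a) -> Ch X c ->
  image_chain f c = image_chain g c.
Proof.
move=> hf; apply: (add_ext (F := @image_chain _ _ _ f k) (G := @image_chain _ _ _ g k)) => s [_ [s0 _] sA].
rewrite /= /image_chain !linU; congr (<< _ >>); apply/funext => t; rewrite /image_simplex.
by case: asboolP => ht //; exact/hf/sA.
Qed.

(** * Relative homology *)

Section RelativeHomology.
Variables (R : realType) (T : nspace R).
Notation SC k := {freeg (simplex T k) / int}.
Implicit Types (W X Y : carrier T).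

Definition rel_cycle X Y k (c : SC k) := Ch X c /\ cyc Y c.
Definition rel_boundary X Y k (c : SC k) := exists d e, [/\ Ch X d, Ch Y e & c = bdry d + e].

(* H(X, Y) in index k is Z if b and 0 otherwise. *)
Definition homology_Z k X Y (b : bool) := exists phi : SC k -> int,
  [/\ forall c d, rel_cycle X Y c -> rel_cycle X Y d -> phi (c + d) = phi c + phi d,
      forall c, rel_cycle X Y c -> (phi c = 0 <-> rel_boundary X Y c),
      b -> exists2 c, rel_cycle X Y c & phi c = 1 &
      ~~ b -> forall c, rel_cycle X Y c -> phi c = 0].

Definition triv X Y := forall k (c : SC k), rel_cycle X Y c -> rel_boundary X Y c.

Lemma rel_cycleD X Y k (c d : SC k) : rel_cycle X Y c -> rel_cycle X Y d -> rel_cycle X Y (c + d).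
Proof. by move=> [? ?] [? ?]; split; [exact: Ch_D|exact: cycD]. Qed.
Lemma rel_cycleN X Y k (c : SC k) : rel_cycle X Y c -> rel_cycle X Y (- c).
Proof. by move=> [? ?]; split; [exact: Ch_N|exact: cycN]. Qed.
Lemma rel_cycleB X Y k (c d : SC k) : rel_cycle X Y c -> rel_cycle X Y d -> rel_cycle X Y (c - d).
Proof. by move=> hc hd; apply: rel_cycleD => //; exact: rel_cycleN. Qed.
Lemma rcyc0 X Y k : rel_cycle X Y (0 : SC k).
Proof. by split; [exact: Ch_0|case: k => [|k] //=; rewrite raddf0; exact: Ch_0]. Qed.

Lemma rel_boundaryD X Y k (c d : SC k) : rel_boundary X Y c -> rel_boundary X Y d -> rel_boundary X Y (c + d).
Proof.
move=> [f [g [hf hg ->]]] [f' [g' [hf' hg' ->]]]; exists (f + f'), (g + g').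
by split; [exact: Ch_D|exact: Ch_D|rewrite raddfD addrACA].
Qed.
Lemma rel_boundaryN X Y k (c : SC k) : rel_boundary X Y c -> rel_boundary X Y (- c).
Proof.
move=> [f [g [hf hg ->]]]; exists (- f), (- g).
by split; [exact: Ch_N|exact: Ch_N|rewrite raddfN opprD].
Qed.
Lemma rel_boundaryB X Y k (c d : SC k) : rel_boundary X Y c -> rel_boundary X Y d -> rel_boundary X Y (c - d).
Proof. by move=> hc hd; apply: rel_boundaryD => //; exact: rel_boundaryN. Qed.
Lemma rel_boundary_bdry X Y k (d : SC k.+1) : Ch X d -> rel_boundary X Y (bdry d).
Proof. by move=> h; exists d, 0; split; [|exact: Ch_0|rewrite addr0]. Qed.
Lemma rel_boundary_Ch X Y k (c : SC k) : Ch Y c -> rel_boundary X Y c.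
Proof. by move=> h; exists 0, c; split; [exact: Ch_0| |rewrite raddf0 add0r]. Qed.

Lemma homology_ZF k X Y : (forall c : SC k, rel_cycle X Y c -> rel_boundary X Y c) <-> homology_Z k X Y false.
Proof.
split=> [h|[phi [_ h _ /(_ isT) h0]] c hc]; last by apply/h => //; exact: h0.
by exists (fun=> 0); split=> // c hc; split=> // _; exact: h.
Qed.

Lemma trivP X Y : triv X Y <-> forall k, homology_Z k X Y false.
Proof. by split=> h k; [apply/homology_ZF; exact: h|apply: (homology_ZF k X Y).2]. Qed.

Lemma homology_Z_eq k X Y (phi : SC k -> int) c d :
  (forall c d, rel_cycle X Y c -> rel_cycle X Y d -> phi (c + d) = phi c + phi d) ->
  (forall c, rel_cycle X Y c -> (phi c = 0 <-> rel_boundary X Y c)) ->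
  rel_cycle X Y c -> rel_cycle X Y d -> rel_boundary X Y (c - d) -> phi c = phi d.
Proof.
move=> hD h0 hc hd hb; have hcd := rel_cycleB hc hd.
by rewrite -[c in LHS](subrK d) hD // (h0 _ hcd).2 // add0r.
Qed.

End RelativeHomology.

(** * Isomorphisms of homology groups *)

Section Isomorphisms.
Variables (R : realType) (T T' : nspace R).
Notation SC k := {freeg (simplex T k) / int}.
Notation SC' k := {freeg (simplex T' k) / int}.

(** An additive map of chains that is well defined, injective and surjective on classes. The two
    indices are separate so that the boundary map of a triple, which lowers the index, qualifies. *)
Definition homology_iso k X Y k' X' Y' := exists theta : SC k -> SC' k',
  [/\ forall c d, theta (c + d) = theta c + theta d,
      forall c, rel_cycle X Y c -> rel_cycle X' Y' (theta c),
      forall c, rel_cycle X Y c -> rel_boundary X Y c -> rel_boundary X' Y' (theta c),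
      forall c, rel_cycle X Y c -> rel_boundary X' Y' (theta c) -> rel_boundary X Y c &
      forall c', rel_cycle X' Y' c' -> exists2 c, rel_cycle X Y c & rel_boundary X' Y' (c' - theta c)].

Lemma homology_iso_back k X Y k' X' Y' b : homology_iso k X Y k' X' Y' -> homology_Z k' X' Y' b -> homology_Z k X Y b.
Proof.
move=> [th [tD tc tb ti ts]] [phi [hD h0 h1 hF]]; exists (phi \o th); split=> /=.
- by move=> c d hc hd; rewrite tD hD //; exact: tc.
- by move=> c hc; rewrite (h0 _ (tc _ hc)); split; [exact: ti|exact: tb].
- move=> /h1[c' hc' pc']; have [c hc hb] := ts _ hc'; exists c => //.
  by rewrite -pc'; apply: esym; apply: (homology_Z_eq hD h0) => //; exact: tc.
- by move=> nb c hc; apply: hF => //; exact: tc.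
Qed.

Lemma homology_iso_forth k X Y k' X' Y' b : homology_iso k X Y k' X' Y' -> homology_Z k X Y b -> homology_Z k' X' Y' b.
Proof.
move=> [th [tD tc tb ti ts]] [phi [hD h0 h1 hF]].
have th0 : th 0 = 0 by apply: (@addrI _ (th 0)); rewrite -tD !addr0.
have tN c : th (- c) = - th c by apply: (@addrI _ (th c)); rewrite -tD !subrr.
(* The implication lets choice run over all chains; the preimage chosen for a chain that is not a
   cycle is arbitrary. *)
have {}ts c' : exists c, rel_cycle X' Y' c' -> rel_cycle X Y c /\ rel_boundary X' Y' (c' - th c).
  by have [/ts[c ? ?]|] := pselect (rel_cycle X' Y' c'); [exists c|exists 0].
have [g hg] := choice ts.
have key c' c : rel_cycle X' Y' c' -> rel_cycle X Y c -> rel_boundary X' Y' (c' - th c) -> phi (g c') = phi c.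
  move=> hc' hc hb; have [gc gb] := hg _ hc'; apply: (homology_Z_eq hD h0) => //.
  apply: ti; first exact: rel_cycleB.
  rewrite tD tN; have -> : th (g c') - th c = (c' - th c) - (c' - th (g c')).
    by rewrite opprB [RHS]addrC addrA subrK.
  exact: rel_boundaryB.
exists (phi \o g); split=> /=.
- move=> c d hc hd; have [gc gcb] := hg _ hc; have [gd gdb] := hg _ hd.
  rewrite -hD //; apply: key; [exact: rel_cycleD|exact: rel_cycleD|].
  by rewrite tD opprD addrACA; exact: rel_boundaryD.
- move=> c' hc'; have [gc gcb] := hg _ hc'; rewrite (h0 _ gc); split=> h.
    by rewrite -(subrK (th (g c')) c'); apply: rel_boundaryD => //; exact: tb.
  by apply: ti => //; rewrite -[th _](subKr c'); exact: rel_boundaryB.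
- move=> /h1[c hc pc]; exists (th c); first exact: tc.
  rewrite -pc; apply: key => //; first exact: tc.
  by rewrite subrr; apply: rel_boundary_Ch; exact: Ch_0.
- by move=> nb c' /hg[gc _]; exact: hF.
Qed.

Lemma homology_Z_iso k X Y k' X' Y' b : homology_iso k X Y k' X' Y' -> homology_Z k X Y b <-> homology_Z k' X' Y' b.
Proof. by move=> h; split; [exact: homology_iso_forth|exact: homology_iso_back]. Qed.

(* A homotopy equivalence of pairs; [H] and [K] are the two homotopies to the identity. *)
Lemma homology_iso_hequiv k (X Y : carrier T) (X' Y' : carrier T') (f : T -> T') (g : T' -> T)
  (H : R -> T -> T) (K : R -> T' -> T') :
  subcar Y X -> subcar Y' X' ->
  fcont X.2 f -> fcont X'.2 g -> maps X X' f -> maps Y Y' f -> maps X' X g -> maps Y' Y g ->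
  hcont X.2 H -> hcont X'.2 K ->
  (forall u, 0 <= u <= 1 -> maps X X (H u)) -> (forall u, 0 <= u <= 1 -> maps Y Y (H u)) ->
  (forall u, 0 <= u <= 1 -> maps X' X' (K u)) -> (forall u, 0 <= u <= 1 -> maps Y' Y' (K u)) ->
  (forall a, X.2 a -> H 0 a = a) -> (forall a, X.2 a -> H 1 a = g (f a)) ->
  (forall a, X'.2 a -> K 0 a = a) -> (forall a, X'.2 a -> K 1 a = f (g a)) ->
  homology_iso k X Y k X' Y'.
Proof.
move=> YX YX' cf cg f1 f2 g1 g2 cH cK H1 H2 K1 K2 H0 H01 K0 K01.
have cfY : fcont Y.2 f.
  move=> a Ya e e0; have [d d0 hd] := cf a (YX.2 _ Ya) e e0.
  by exists d => // a' Ya'; apply: hd; exact: YX.2.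
have cgY : fcont Y'.2 g.
  move=> a Ya e e0; have [d d0 hd] := cg a (YX'.2 _ Ya) e e0.
  by exists d => // a' Ya'; apply: hd; exact: YX'.2.
have cHY : hcont Y.2 H.
  move=> u a u01 Ya e e0; have [d d0 hd] := cH u a u01 (YX.2 _ Ya) e e0.
  by exists d => // u' a' u01' Ya'; apply: hd => //; exact: YX.2.
have cKY : hcont Y'.2 K.
  move=> u a u01 Ya e e0; have [d d0 hd] := cK u a u01 (YX'.2 _ Ya) e e0.
  by exists d => // u' a' u01' Ya'; apply: hd => //; exact: YX'.2.
exists (@image_chain _ _ _ f k); split.
- by move=> c d; rewrite raddfD.
- by move=> c [hX hY]; split; [exact: Ch_image_chain hX|exact: cyc_image_chain hY].
- move=> c _ [d [e [hd he ->]]]; exists (image_chain f d), (image_chain f e).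
  by split; [exact: Ch_image_chain hd|exact: Ch_image_chain he|rewrite raddfD /= bdry_image_chain].
- move=> c [hX hY] [d [e [hd he fc]]].
  have [d' [e' [hd' he' hc]]] := homotopy_chain cH cHY H1 H2 hX hY.
  rewrite (image_chain_id H0 hX) (eq_image_chain H01 hX) in hc.
  have -> : c = image_chain (g \o f) c - (bdry d' + e') by rewrite -hc subKr.
  rewrite -image_chain_comp fc raddfD /= -bdry_image_chain.
  apply: rel_boundaryB.
    by apply: rel_boundaryD; [apply: rel_boundary_bdry|apply: rel_boundary_Ch]; [exact: Ch_image_chain hd|exact: Ch_image_chain he].
  by apply: rel_boundaryD; [exact: rel_boundary_bdry|exact: rel_boundary_Ch].
- move=> c' [hX hY]; exists (image_chain g c').
    by split; [exact: Ch_image_chain hX|exact: cyc_image_chain hY].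
  have [d' [e' [hd' he' hc]]] := homotopy_chain cK cKY K1 K2 hX hY.
  rewrite (image_chain_id K0 hX) (eq_image_chain K01 hX) -image_chain_comp in hc.
  by rewrite -opprB hc; apply: rel_boundaryN; apply: rel_boundaryD; [exact: rel_boundary_bdry|exact: rel_boundary_Ch].
Qed.

End Isomorphisms.

(** * The exact sequence of a triple *)

Section Triples.
Variables (R : realType) (T : nspace R).
Notation SC k := {freeg (simplex T k) / int}.
Implicit Types (W X Y : carrier T).

(** This lemma and the next two read the exact sequence of the triple W, Y, X when one of its terms
    vanishes: here H(Y, W), then H(X, Y), then H(X, W). *)
Lemma triple_sub W Y X k : subcar W Y -> subcar Y X -> triv Y W -> homology_iso k X W k X Y.
Proof.
move=> WY YX tYW; exists id; split=> //.
- by move=> c [hX hW]; split=> //; exact: cyc_sub hW.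
- by move=> c _ [d [e [hd he ->]]]; exists d, e; split=> //; exact: Ch_sub he.
- move=> c [hX hW] [d [e [hd he ce]]].
  have ee : e = c - bdry d by rewrite ce addrC addKr.
  have [|d' [w [hd' hw e2]]] := tYW k e.
    by split=> //; rewrite ee; apply: cycB => //; exact: cyc_bdry hd.
  exists (d + d'), w; split=> //; first by apply: Ch_D => //; exact: Ch_sub hd'.
  by rewrite raddfD /= -addrA -e2.
- move=> c [hX]; case: k c hX => [|k] c hX hY.
    by exists c => //; rewrite subrr; apply: rel_boundary_Ch; exact: Ch_0.
  have [|y [w [hy hw e]]] := tYW k (bdry c); first by split=> //; exact: cyc_bdry hX.
  exists (c - y); last by rewrite subKr; exact: rel_boundary_Ch.
  split; first by apply: Ch_B => //; exact: Ch_sub hy.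
  by rewrite /= raddfB /= e addrC addKr.
Qed.

Lemma triple_incl W Y X k : subcar W Y -> subcar Y X -> triv X Y -> homology_iso k Y W k X W.
Proof.
move=> WY YX tXY; exists id; split=> //.
- by move=> c [hX hW]; split=> //; exact: Ch_sub hX.
- by move=> c _ [d [e [hd he ->]]]; exists d, e; split=> //; exact: Ch_sub hd.
- move=> c [hY hW] [d [w [hd hw cE]]].
  have [|g [y [hg hy e2]]] := tXY k.+1 d.
    split=> //=; have -> : bdry d = c - w by rewrite cE addrK.
    by apply: Ch_B => //; exact: Ch_sub hw.
  exists y, w; split=> //; rewrite cE e2 raddfD /=; congr (_ + _).
  by rewrite (bdry_bdry hg) add0r.
- move=> c [hX hW]; have [|d [y [hd hy e]]] := tXY k c.
    by split=> //; exact: cyc_sub hW.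
  have ye : y = c - bdry d by rewrite e addrC addKr.
  exists y; first by split=> //; rewrite ye; apply: cycB => //; exact: cyc_bdry hd.
  by rewrite ye subKr; exact: rel_boundary_bdry.
Qed.

Lemma triple_bdry W Y X k : subcar W Y -> subcar Y X -> triv X W -> homology_iso k.+1 X Y k Y W.
Proof.
move=> WY YX tXW; exists (@bdry R T k); split=> //.
- by move=> c d; rewrite raddfD.
- by move=> c [hX hY]; split=> //; exact: cyc_bdry hX.
- move=> c _ [d [e [hd he ->]]]; rewrite raddfD /= (bdry_bdry hd) add0r.
  exact: rel_boundary_bdry.
- move=> c [hX hY] [y [w [hy hw e]]].
  have [|g [w' [hg hw' e2]]] := tXW k.+1 (c - y).
    split=> /=; first by apply: Ch_B => //; exact: Ch_sub hy.
    by rewrite raddfB /= e addrC addKr.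
  exists g, (w' + y); split=> //; first by apply: Ch_D => //; exact: Ch_sub hw'.
  by rewrite addrA -e2 subrK.
- move=> c' [hY hW]; have [|d [w [hd hw e]]] := tXW k c'.
    by split=> //; exact: Ch_sub hY.
  exists d; last by rewrite e addrC addKr; exact: rel_boundary_Ch.
  split=> //=; have -> : bdry d = c' - w by rewrite e addrK.
  by apply: Ch_B => //; exact: Ch_sub hw.
Qed.

(** Completes [triple_bdry], which has no target in index 0: there every chain of X is a cycle
    relative to W. *)
Lemma triple_bd0 W Y X : subcar W Y -> triv X W -> homology_Z 0 X Y false.
Proof.
move=> WY tXW; apply/homology_ZF => c [hX _]; have [|d [w [hd hw ->]]] := tXW 0%N c; first by [].
by exists d, w; split=> //; exact: Ch_sub hw.
Qed.

Lemma triv_sub W Y X : subcar W Y -> subcar Y X -> triv Y W -> triv X W -> triv X Y.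
Proof.
move=> WY YX tYW /trivP h; apply/trivP => k.
by apply/(homology_Z_iso _ (triple_sub k WY YX tYW)); exact: h.
Qed.

Lemma triv_trans W Y X : subcar W Y -> subcar Y X -> triv Y W -> triv X Y -> triv X W.
Proof.
move=> WY YX tYW /trivP h; apply/trivP => k.
by apply/(homology_Z_iso _ (triple_sub k WY YX tYW)); exact: h.
Qed.

Lemma triv_refl X : triv X X.
Proof. by move=> k c [h _]; exact: rel_boundary_Ch. Qed.

(** The homotopy need not fix Y pointwise. As it keeps Y inside Y, a relative cycle is homologous to
    its image under [H 1], which is a chain of Y. *)
Lemma deformation (X Y : carrier T) (H : R -> T -> T) :
  subcar Y X -> (X.1 -> Y.1) -> hcont X.2 H ->
  (forall u a, 0 <= u <= 1 -> X.2 a -> X.2 (H u a)) ->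
  (forall u a, 0 <= u <= 1 -> Y.2 a -> Y.2 (H u a)) ->
  (forall a, X.2 a -> H 0 a = a) -> (forall a, X.2 a -> Y.2 (H 1 a)) -> triv X Y.
Proof.
move=> YX XY1 cH mX mY h0 h1 k c [hX hY].
have cHY : hcont Y.2 H.
  move=> u a u01 Ya e e0; have [d d0 hd] := cH u a u01 (YX.2 _ Ya) e e0.
  by exists d => // u' a' u01' Ya'; apply: hd => //; exact: YX.2.
have [||d [e [hd he ce]]] := homotopy_chain (X' := X) (Y' := Y) cH cHY _ _ hX hY.
- by move=> u u01; split=> // a; exact: mX.
- by move=> u u01; split=> // a; exact: mY.
rewrite (image_chain_id h0 hX) in ce.
have -> : c = image_chain (H 1) c - (bdry d + e) by rewrite -ce subKr.
apply: rel_boundaryB; last by apply: rel_boundaryD; [exact: rel_boundary_bdry|exact: rel_boundary_Ch].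
apply: rel_boundary_Ch; apply: Ch_image_chain hX => //.
move=> a Xa e' e0; have [|d' d'0 hd'] := cH 1 a _ Xa e' e0; first by rewrite ler01 lexx.
exists d' => // a' Xa' n; apply: hd' => //; first by rewrite ler01 lexx.
by rewrite subrr normr0.
Qed.

End Triples.

(** * Small simplices and excision *)

Section SmallSimplices.
Import topology normedtype numFieldNormedType.Exports.
Variables (R : realType) (T : nspace R).
Notation coord k := ('I_k -> R^o).
Notation SC k := {freeg (simplex T k) / int}.

Definition openin (U X : set T) := forall a, U a -> exists2 e : R, 0 < e &
  forall a', X a' -> nearby a e a' -> U a'.

(** The argument runs on the compact cube [0, 1]^k, with a condition [P] that is void off the
    simplex. *)
Lemma lebesgue_number (U V : set T) k (s : simplex T k) :
  openin U (U `|` V) -> openin V (U `|` V) -> carried (true, U `|` V) s ->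
  exists2 d : R, 0 < d & forall x, std x ->
    (forall y, std y -> (forall i, `|y i - x i| < d) -> U (s y)) \/
    (forall y, std y -> (forall i, `|y i - x i| < d) -> V (s y)).
Proof.
move=> oU oV [_ [_ sc] sUV].
pose P (d : R) (x : 'rV[R]_k) := std (x ord0) ->
    (forall y, std y -> (forall i, `|y i - x ord0 i| < d) -> U (s y)) \/
    (forall y, std y -> (forall i, `|y i - x ord0 i| < d) -> V (s y)).
pose K := [set v : 'rV[R]_k | forall i, [set` `[0, 1]%R] (v ord0 i)].
have cK : compact K by apply: (@rV_compact R k (fun=> [set` `[0, 1]%R])) => i; exact: segment_compact.
have hP x : K x -> exists2 d : R, 0 < d & forall e x', 0 < e -> e < d -> ball x d x' -> P e x'.
  move=> Kx; have [sx|nsx] := pselect (std (x ord0)).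
    have key (W : set T) : openin W (U `|` V) -> W (s (x ord0)) -> exists2 d : R, 0 < d &
        forall e x', 0 < e -> e < d -> ball x d x' ->
        forall y, std y -> (forall i, `|y i - x' ord0 i| < e) -> W (s y).
      move=> oW Wx; have [e e0 he] := oW _ Wx; have [d d0 hd] := sc _ sx e e0.
      (* Half of d is for moving the centre from x to x', half for the ball around x'. *)
      exists (d / 2) => [|e' x' e'0 e'd [_ bx] y sy yx]; first by rewrite divr_gt0.
      apply: he; first exact: sUV.
      apply: hd => // i; have := bx ord0 i; rewrite /ball /= => bxi.
      have := yx i; rewrite distrC in bxi.
      move=> yi; have -> : y i - x ord0 i = (y i - x' ord0 i) + (x' ord0 i - x ord0 i).
        by rewrite addrA subrK.
      by rewrite (le_lt_trans (ler_normD _ _)) // [ltRHS]splitr ltrD // (lt_trans yi).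
    by case: (sUV _ sx) => /key h; [have [d d0 hd] := h oU|have [d d0 hd] := h oV];
      exists d => // e x' e0 ed bx _; [left|right]; exact: hd e0 ed bx.
  pose g := `|\sum_i x ord0 i - 1|.
  (* A point of the cube is off the simplex only if its coordinate sum misses 1; changing each of
     the k coordinates by less than g/(k+1) cannot repair a gap of g. *)
  have g0 : 0 < g.
    rewrite normr_gt0 subr_eq0; apply/eqP => h; apply: nsx; split=> // i.
    by have := Kx i; rewrite /= in_itv /= => /andP[].
  exists (g / k.+1%:R) => [|e x' e0 ed [_ bx] [_ sx']]; first by rewrite divr_gt0.
  exfalso; suff : `|\sum_i x ord0 i - 1| < g by rewrite ltxx.
  rewrite -sx' -sumrB (le_lt_trans (ler_norm_sum _ _ _)) //.
  apply: (@le_lt_trans _ _ (\sum_(i < k) g / k.+1%:R)).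
    by apply: ler_sum => i _; have := bx ord0 i; rewrite /ball /= => /ltW.
  rewrite sumr_const card_ord -[ltLHS]mulr_natr -mulrA gtr_pMr //.
  by rewrite mulrC ltr_pdivrMr ?ltr0Sn // mul1r ltr_nat.
(* Taken with e tending to 0 from the right, compactness makes the radius uniform over the cube. *)
have := (compact_near_coveringP K).1 cK R (at_right 0) P _.
case=> [|d /= d0 hd].
  move=> x Kx; have [d d0 hd] := hP x Kx.
  exists ([set x' | ball x d x'], [set e | 0 < e < d]) => /=.
    split; first exact: nbhsx_ballx.
    exists d => //= e; rewrite /ball /= sub0r normrN => ed e0.
    by rewrite e0 (le_lt_trans (ler_norm _) ed).
  by move=> [x' e] /= [bx /andP[e0 ed]]; exact: hd.
exists (d / 2) => [|x sx]; first by rewrite divr_gt0.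
have d2 : 0 < d / 2 by rewrite divr_gt0.
have e (i : 'I_k) : (\row_i x i) ord0 i = x i by rewrite mxE.
have h : K `<=` P (d / 2).
  apply: hd => //; rewrite /ball /= sub0r normrN gtr0_norm //.
  by rewrite ltr_pdivrMr // ltr_pMr // ltr1n.
have := h (\row_i x i); rewrite /P (_ : (\row_i x i) ord0 = x); last exact/funext.
apply => // i; rewrite /= e in_itv /=.
by have := std_le1 i sx; rewrite ler_norml (sx.1 i) => /andP[_ ->].
Qed.

Definition diam_le n (k : nat) (D : R) (w : seq (coord k)) := size w = n /\
  {in w &, forall x y : coord k, forall i, `|x i - y i| <= D}.

Lemma bary_coord k (w : seq (coord k)) i : bary w i = (size w)%:R^-1 * \sum_(x <- w) x i.
Proof. by rewrite /bary fctE fct_sumE. Qed.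

(** One of the n + 1 differences being averaged is a - a = 0, which gives the factor n/(n+1) = 1 -
    1/(n+1). *)
Lemma bary_dist n k D (w : seq (coord k)) (a : coord k) i : diam_le n.+1 D w -> a \in w ->
  `|bary w i - a i| <= (1 - n.+1%:R^-1) * D.
Proof.
move=> [sw hw] aw; have n0 : n.+1%:R != 0 :> R by rewrite pnatr_eq0.
have -> : bary w i - a i = n.+1%:R^-1 * \sum_(x <- w) (x i - a i).
  rewrite bary_coord sw sumrB mulrBr; congr (_ - _).
  by rewrite big_const_seq count_predT sw iter_addr addr0 -[a i *+ _]mulr_natl mulKf.
have -> : (1 - n.+1%:R^-1) * D = n.+1%:R^-1 * (n%:R * D).
  by rewrite mulrA; congr (_ * _); rewrite -[n%:R](addrK 1) natr1 mulrBr mulVf // mulr1.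
rewrite normrM ger0_norm ?invr_ge0 // ler_wpM2l ?invr_ge0 //.
rewrite (perm_big _ (perm_to_rem aw)) big_cons /= subrr add0r.
apply: (le_trans (ler_norm_sum _ _ _)).
apply: (@le_trans _ _ (\sum_(x <- rem a w) D)).
  rewrite big_seq [leRHS]big_seq; apply: ler_sum => x /mem_rem xw; exact: hw.
by rewrite big_const_seq count_predT size_rem // sw iter_addr addr0 mulr_natl.
Qed.

(** A box contains the barycentres of its points. In [diam_sd] the box around a barycentre bounds
    the edges that join it to the subdivided faces. *)
Lemma hull_box k n (l h : coord k) (c : {freeg (seq (coord k)) / int}) :
  let Q := fun x : coord k => forall i, l i <= x i <= h i in
  supp (@hull R (coord k) n Q) c -> supp (@hull R (coord k) n Q) (sd n c).
Proof.
move=> Q; apply: hull_sd => w w0 hw i; rewrite bary_coord.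
have w0' : 0 < (size w)%:R :> R by rewrite ltr0n.
rewrite mulrC ler_pdivlMr // ler_pdivrMr //; apply/andP.
have e (y : R) : y * (size w)%:R = \sum_(x <- w) y.
  by rewrite big_const_seq count_predT iter_addr addr0 mulr_natr.
rewrite !e; split; rewrite big_seq [leRHS]big_seq; apply: ler_sum => x xw.
  by have /andP[] := hw x xw i.
by have /andP[] := hw x xw i.
Qed.

(* Subdividing an (n-1)-dimensional simplex shrinks its diameter by the factor (n-1)/n. *)
Lemma diam_sd n k D (c : {freeg (seq (coord k)) / int}) : 0 <= D ->
  supp (diam_le n D) c -> supp (diam_le n ((1 - n%:R^-1) * D)) (sd n c).
Proof.
move=> D0; elim: n c => [|n IH] c.
  by rewrite invr0 subr0 mul1r.
apply: supp_lin => w hw; set r := (_ * D).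
have r0 : 0 <= r by rewrite mulr_ge0 // subr_ge0 invf_le1 // ler1n.
have h1 : supp (diam_le n D) (dA0 w).
  rewrite -dAU; apply: (@supp_dA _ _ (diam_le n.+1 D)); last exact: suppU.
  move=> v i [sv hv] hi; split; first by rewrite size_del // sv.
  by move=> x y /mem_del xv /mem_del yv; exact: hv.
have h2 : supp (@hull R (coord k) n
    (fun x => forall i, bary w i - r <= x i <= bary w i + r)) (sd n (dA0 w)).
  apply: (@hull_box k n (fun i => bary w i - r) (fun i => bary w i + r)).
  rewrite -dAU; apply: hull_dA; apply: suppU; split; first exact: hw.1.
  by move=> x xw i; have := bary_dist i hw xw; rewrite -/r ler_distlC.
apply: supp_lin (suppI (IH _ h1) h2) => v [[sv dv] [_ bv]].
apply: suppU; split; first by rewrite /= sv.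
have hb x : x \in v -> forall i, `|bary w i - x i| <= r.
  by move=> xv i; rewrite ler_distlC; exact: bv.
move=> x y; rewrite !inE => /orP[/eqP->|xv] /orP[/eqP->|yv] i.
- by rewrite subrr normr0.
- exact: hb.
- by rewrite distrC; exact: hb.
have n0 : (0 < n)%N.
  by rewrite lt0n; apply/eqP => n0; move: xv; rewrite (size0nil (etrans sv n0)).
apply: (le_trans (dv x y xv yv i)).
by rewrite /r ler_wpM2r // lerB // lef_pV2 ?posrE ?ltr0n // ler_nat.
Qed.

Lemma diam_sdm m k : supp (diam_le k ((1 - k%:R^-1) ^+ m)) (iter m (@sd _ _ k) << ebas R k >>).
Proof.
have D0 j : 0 <= (1 - k%:R^-1) ^+ j :> R.
  by apply: exprn_ge0; rewrite subr_ge0; case: k => [|k]; rewrite ?invr0 // invf_le1 ?ler1n.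
elim: m => [|m IH].
  apply: suppU; split; first exact: size_ebas.
  move=> x y /mapP[a _ ->] /mapP[b _ ->] i; rewrite expr0.
  by do 2 case: eqP => _; rewrite ?subrr ?subr0 ?sub0r ?normrN ?normr1 ?normr0.
by rewrite exprS iterS; exact: diam_sd.
Qed.

Lemma pow_small (k : nat) (d : R) : 0 < d -> exists m, (1 - k.+1%:R^-1) ^+ m < d.
Proof.
move=> d0; set a := k.+1%:R^-1.
have a0 : 0 < a by rewrite invr_gt0.
have a1 : a <= 1 by rewrite invf_le1 ?ler1n.
(* A form of Bernoulli's inequality: (1 - a)^m is at most 1/(1 + m a). *)
have B m : (1 + m%:R * a) * (1 - a) ^+ m <= 1.
  elim: m => [|m IH]; first by rewrite mul0r addr0 mulr1.
  apply: le_trans IH; rewrite exprS mulrA; apply: ler_wpM2r.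
    by apply: exprn_ge0; rewrite subr_ge0.
  rewrite -natr1; have : 0 <= m%:R :> R by []; move: (m%:R) => M M0; nra.
pose m := Num.bound (a * d)^-1; exists m.
have hm : (a * d)^-1 < m%:R.
  by apply: le_lt_trans (archi_boundP _); [exact: lexx|rewrite invr_ge0 mulr_ge0 // ltW].
have m1 : 1 < d * (1 + m%:R * a).
  have : 1 < m%:R * (a * d) by rewrite -ltr_pdivrMr ?mulr_gt0 // div1r.
  nra.
have c0 : 0 < 1 + m%:R * a by rewrite ltr_wpDr // mulr_ge0 // ltW.
by rewrite -(ltr_pM2l c0) (le_lt_trans (B m)) // mulrC.
Qed.

Lemma small_simplex (U V : set T) k (s : simplex T k) :
  openin U (U `|` V) -> openin V (U `|` V) -> carried (true, U `|` V) s ->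
  exists m0, forall m, (m0 <= m)%N -> exists u v : SC k,
    [/\ Ch (true, U) u, Ch (true, V) v & Sd m << s >> = u + v].
Proof.
move=> oU oV hs; case: k s hs => [|k] s hs.
  (* The empty simplex lies in every set and is its own subdivision. *)
  exists 0%N => m _; exists << s >>, 0; have [_ ss _] := hs; split.
  - by apply: suppU; split=> // t /std0.
  - exact: Ch_0.
  - by rewrite addr0 Sd0 //; exact: suppU.
have [d d0 hd] := lebesgue_number oU oV hs.
have [m0 hm0] := pow_small k d0; exists m0 => m mm0.
have hm : (1 - k.+1%:R^-1) ^+ m < d.
  apply: le_lt_trans hm0; apply: ler_wiXn2l => //.
    by rewrite subr_ge0 invf_le1 ?ler1n.
  by rewrite gerBl invr_ge0.
rewrite /Sd linU.
apply: (@fg_ind _ (fun w => hstd k.+1 w /\ diam_le k.+1 ((1 - k.+1%:R^-1) ^+ m) w)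
  (fun c => exists u v : SC k.+1, [/\ Ch (true, U) u, Ch (true, V) v & push s k.+1 c = u + v])).
- by exists 0, 0; split; [exact: Ch_0|exact: Ch_0|rewrite raddf0 addr0].
- move=> c c' [u [v [hu hv e]]] [u' [v' [hu' hv' e']]].
  exists (u + u'), (v + v'); split; [exact: Ch_D|exact: Ch_D|].
  by rewrite raddfD /= e e' addrACA.
- move=> c [u [v [hu hv e]]]; exists (- u), (- v); split; [exact: Ch_N|exact: Ch_N|].
  by rewrite raddfN /= e opprD.
- move=> w [hw dw]; rewrite pushU.
  (* The first vertex is the centre of the Lebesgue ball: by convexity every point of the piece is
     within the diameter of it. *)
  have x0 : nth 0 w 0 \in w by rewrite mem_nth // hw.1.
  have clo (t : 'I_k.+1 -> R) : std t -> forall i, `|comb w t i - (nth 0 w 0 : coord k.+1) i| < d.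
    move=> [t0 t1] i; apply: le_lt_trans hm; rewrite comb_coord.
    rewrite (_ : nth 0 w 0 i = \sum_(l < k.+1) t l * (nth 0 w 0 : coord k.+1) i); last first.
      by rewrite -mulr_suml t1 mul1r.
    rewrite -sumrB.
    apply: (le_trans (ler_norm_sum _ _ _)).
    apply: (@le_trans _ R (\sum_(l < k.+1) t l * (1 - k.+1%:R^-1) ^+ m)).
      apply: ler_sum => l _; rewrite -mulrBr normrM ger0_norm //.
      by apply: ler_wpM2l => //; apply: dw.2 => //; rewrite mem_nth // hw.1.
    by rewrite -mulr_suml t1 mul1r.
  have sp := carried_affine_simplex_std hs hw.
  have hsub (W : set T) : (forall y, std y ->
      (forall i, `|y i - (nth 0 w 0 : coord k.+1) i| < d) -> W (s y)) ->
      Ch (true, W) (<< affine_simplex (s : coord k.+1 -> T) k.+1 w >> : SC k.+1).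
    move=> hW; apply: suppU; have [_ sg _] := sp; split=> // t ht.
    by rewrite /affine_simplex asboolT //; apply: hW; [exact: std_comb|exact: clo].
  have [hU|hV] := hd _ (hw.2 _ x0).
    by exists << affine_simplex (s : coord k.+1 -> T) k.+1 w >>, 0; rewrite addr0; split=> //;
      [exact: hsub|exact: Ch_0].
  by exists 0, << affine_simplex (s : coord k.+1 -> T) k.+1 w >>; rewrite add0r; split=> //;
    [exact: Ch_0|exact: hsub].
- by apply: suppI; [exact: hstd_sdm|exact: diam_sdm].
Qed.

(** Stated for all large [m], so that the thresholds of two summands, or of a chain and its
    boundary, can be met together. *)
Lemma small_chain (U V : set T) k (c : SC k) :
  openin U (U `|` V) -> openin V (U `|` V) -> Ch (true, U `|` V) c ->
  exists m0, forall m, (m0 <= m)%N -> exists u v : SC k,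
    [/\ Ch (true, U) u, Ch (true, V) v & Sd m c = u + v].
Proof.
move=> oU oV; apply: (@fg_ind _ _ (fun c : SC k => exists m0, forall m, (m0 <= m)%N ->
  exists u v : SC k, [/\ Ch (true, U) u, Ch (true, V) v & Sd m c = u + v])).
- exists 0%N => m _; exists 0, 0.
  by split; [exact: Ch_0|exact: Ch_0|rewrite raddf0 addr0].
- move=> a b [m1 h1] [m2 h2]; exists (maxn m1 m2) => m; rewrite geq_max => /andP[mm1 mm2].
  have [u [v [hu hv e]]] := h1 _ mm1; have [u' [v' [hu' hv' e']]] := h2 _ mm2.
  exists (u + u'), (v + v'); split; [exact: Ch_D|exact: Ch_D|].
  by rewrite raddfD /= e e' addrACA.
- move=> a [m1 h1]; exists m1 => m mm1; have [u [v [hu hv e]]] := h1 _ mm1.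
  exists (- u), (- v); split; [exact: Ch_N|exact: Ch_N|].
  by rewrite raddfN /= e opprD.
- by move=> s hs; exact: small_simplex.
Qed.

End SmallSimplices.

(** * Excision and Mayer-Vietoris *)

Section Excision.
Variables (R : realType) (T : nspace R).
Notation SC k := {freeg (simplex T k) / int}.
Implicit Types (U V : set T).

Definition car U : carrier T := (true, U).

Lemma Ch_I U V k (c : SC k) : Ch (car U) c -> Ch (car V) c -> Ch (car (U `&` V)) c.
Proof.
move=> hU hV; apply: supp_sub (suppI hU hV) => s [[_ ss sU] [_ _ sV]].
by split=> // t ht; split; [exact: sU|exact: sV].
Qed.

Lemma Ch_trS U V k (c : SC k) : U `<=` V -> Ch (car U) c -> Ch (car V) c.
Proof. by move=> h; apply: Ch_sub. Qed.

Lemma cyc_I U V k (c : SC k) : cyc (car U) c -> cyc (car V) c -> cyc (car (U `&` V)) c.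
Proof. by case: k c => [|k] c //=; exact: Ch_I. Qed.

Lemma excision U V k : openin U (U `|` V) -> openin V (U `|` V) ->
  homology_iso k (car V) (car (U `&` V)) k (car (U `|` V)) (car U).
Proof.
move=> oU oV; exists id; split=> //.
- move=> c [hV hc]; split; first exact: Ch_trS hV.
  by apply: cyc_sub hc; split=> // a [].
- move=> c _ [d [e [hd he ->]]]; exists d, e; split=> //; first exact: Ch_trS hd.
  by apply: Ch_trS he => a [].
- move=> c [hV hc] [d [e [hd he ce]]].
  have [m0 /(_ m0 (leqnn _))[u [w [hu hw sE]]]] := small_chain oU oV hd.
  have [d' [e' [hd' he' hs]]] := subdiv m0 hV hc.
  have sc : Sd m0 c = bdry u + bdry w + Sd m0 e by rewrite ce raddfD /= -bdry_Sd sE raddfD.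
  (* The remainder is [bdry u + Sd m0 e], a chain of U, and equally [Sd m0 c - bdry w], a chain of
     V; so it lies in the intersection. *)
  exists (d' + w), (e' + (bdry u + Sd m0 e)); split.
  + exact: Ch_D.
  + apply: Ch_D => //; apply: Ch_I.
      by apply: Ch_D; [exact: Ch_bdry|exact: Ch_Sd].
    have -> : bdry u + Sd m0 e = Sd m0 c - bdry w by rewrite sc addrAC addrK.
    by apply: Ch_B; [exact: Ch_Sd|exact: Ch_bdry].
  + have -> : bdry u + Sd m0 e = Sd m0 c - bdry w by rewrite sc addrAC addrK.
    by rewrite raddfD /= addrACA -hs [bdry w + _]addrC !subrK.
- move=> c [hX hc]; have [m0 /(_ m0 (leqnn _))[u [v [hu hv sE]]]] := small_chain oU oV hX.
  have [d [e [hd he hs]]] := subdiv m0 hX hc.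
  exists v; last first.
    exists d, (e + u); split=> //; first exact: Ch_D.
    by rewrite addrA -hs sE opprD addrA addrAC subrK.
  split=> //; case: k c v u hX hc hu hv sE {d e hd he hs} => [|k] c v u hX hc hu hv sE //=.
  apply: Ch_I; last exact: Ch_bdry.
  have -> : bdry v = Sd m0 (bdry c) - bdry u by rewrite -bdry_Sd sE raddfD /= addrC addKr.
  by apply: Ch_B; [exact: Ch_Sd|exact: Ch_bdry].
Qed.

(* The five lemma for the Mayer-Vietoris sequences of the two covers, in the case where
   three of the inclusions are homology isomorphisms. *)
Lemma mayer_vietoris_triv U V U' V' : U' `<=` U -> V' `<=` V ->
  openin U (U `|` V) -> openin V (U `|` V) ->
  openin U' (U' `|` V') -> openin V' (U' `|` V') ->
  triv (car U) (car U') -> triv (car V) (car V') -> triv (car (U `&` V)) (car (U' `&` V')) ->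
  triv (car (U `|` V)) (car (U' `|` V')).
Proof.
move=> UU VV oU oV oU' oV' tU tV tUV k c [hX hc].
have lift (W W' : set T) (x : SC k) : W `<=` U `|` V -> W' `<=` U' `|` V' ->
    rel_boundary (car W) (car W') x -> rel_boundary (car (U `|` V)) (car (U' `|` V')) x.
  move=> h h' [d [e [hd he ->]]]; exists d, e.
  by split=> //; [exact: Ch_trS hd|exact: Ch_trS he].
have subU : U `<=` U `|` V by move=> a; left.
have subV : V `<=` U `|` V by move=> a; right.
have subU' : U' `<=` U' `|` V' by move=> a; left.
have subV' : V' `<=` U' `|` V' by move=> a; right.
have [m1 sm1] := small_chain oU oV hX.
suff [m m1m [x [y [ux hy hxy]]]] : exists2 m, (m1 <= m)%N &
    exists x y : SC k, [/\ rel_cycle (car U) (car U') x, rel_cycle (car V) (car V') y & Sd m c = x + y].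
  have [d [e [hd he hs]]] := subdiv m hX hc.
  rewrite -(subrK (Sd m c) c) hs hxy; apply: rel_boundaryD; first by exists d, e.
  by apply: rel_boundaryD; [apply: lift (tU _ _ ux)|apply: lift (tV _ _ hy)].
case: k c hX hc sm1 {lift} => [|k] c hX hc sm1.
  have [u [v [hu hv e]]] := sm1 _ (leqnn _).
  by exists m1 => //; exists u, v.
have [m2 sm2] := small_chain oU' oV' hc; pose m := maxn m1 m2.
have [u [v [hu hv e]]] := sm1 m (leq_maxl _ _).
have [u' [v' [hu' hv' e']]] := sm2 m (leq_maxr _ _).
have buv : bdry u + bdry v = u' + v' by rewrite -raddfD /= -e bdry_Sd e'.
(* The two expressions of w place it in both U and V, and its boundary in U' and V'. A filling p of
   w then corrects u and v with opposite signs. *)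
pose w := bdry u - u'; have wE : w = v' - bdry v.
  by apply/eqP; rewrite subr_eq addrAC [v' + u']addrC -buv addrK.
have cw : rel_cycle (car (U `&` V)) (car (U' `&` V')) w.
  split.
    apply: Ch_I; first by apply: Ch_B; [exact: Ch_bdry|exact: Ch_trS hu'].
    by rewrite wE; apply: Ch_B; [exact: Ch_trS hv'|exact: Ch_bdry].
  have h1 : cyc (car U') w.
    by apply: cycB; [exact: cyc_bdry hu|exact: cyc_Ch].
  have h2 : cyc (car V') w.
    by rewrite wE; apply: cycB; [exact: cyc_Ch|exact: cyc_bdry hv].
  exact: cyc_I.
have [p [q [hp hq pq]]] := tUV _ _ cw.
exists m; first exact: leq_maxl.
exists (u - p), (v + p); split; last by rewrite e addrACA [- p + p]addrC subrr addr0.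
- split; first by apply: Ch_B => //; apply: Ch_trS hp => a [].
  rewrite /= raddfB /=; have -> : bdry u - bdry p = q + u'.
    by rewrite -[bdry u](subrK u') -/w pq addrAC [bdry p + q]addrC addrK.
  by apply: Ch_D => //; apply: Ch_trS hq => a [].
- split; first by apply: Ch_D => //; apply: Ch_trS hp => a [].
  rewrite /= raddfD /=; have -> : bdry v + bdry p = v' - q.
    have -> : bdry v = v' - w by rewrite wE subKr.
    by rewrite pq opprD addrA addrAC addrNK.
  by apply: Ch_B => //; apply: Ch_trS hq => a [].
Qed.

End Excision.

(** * Spaces of finite subsets *)

Section Points.
Variables (R : realType) (T : nspace R).

Definition near_refl := forall (a : T) (e : R), 0 < e -> nearby a e a.
Definition near_mono := forall (a b : T) (e e' : R), e <= e' -> nearby a e b -> nearby a e' b.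

Definition zero_car : carrier T := (false, set0).

Lemma subcar_red (X : carrier T) : subcar zero_car X.
Proof. by split. Qed.

Lemma Ch_red k (c : {freeg (simplex T k) / int}) : Ch zero_car c -> c = 0.
Proof.
move=> h; apply/eqP; rewrite -dom_eq0; apply/eqP; case e: (dom c) => [//|s l].
have /h[] // : coeff s c != 0 by rewrite -mem_dom e mem_head.
Qed.

Lemma sum_signs (A : zmodType) (x : A) n :
  \sum_(i < n) x *~ (-1) ^+ i = x *~ (odd n : int).
Proof.
elim: n => [|n IH]; first by rewrite big_ord0 mulr0z.
rewrite big_ord_recr /= IH -mulrzDr -signr_odd /=.
by case: (odd n).
Qed.

(** There is one simplex in each index, the empty one included. The boundary from index j + 1 to
    index j is the identity for even j and 0 for odd j, so the complex is exact. *)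
Lemma acyclic_point (a : T) : near_refl -> triv (car [set a]) zero_car.
Proof.
move=> nr k c [hS hc]; pose q k : simplex T k := fun t => if `[< std t >] then a else dflt T.
have hq j : carried (car [set a]) (q j).
  split=> //; last by move=> t ht; rewrite /q asboolT.
  split=> [t ht|t ht e e0]; first by rewrite /q asboolF.
  by exists 1 => // u hu _; rewrite /q !asboolT //; exact: nr.
have bdq j : bdry << q j.+1 >> = << q j >> *~ (odd j.+1 : int).
  rewrite bdU -sum_signs; apply: eq_bigr => i _; congr (<< _ >> *~ _).
  by apply/funext => t; rewrite /sface /q; congr (if _ then _ else _);
    apply/asboolP/asboolP => /(std_dinj i).
have [m cm] : exists m, c = << q k >> *~ m.
  move: hS; apply: (@fg_ind _ _ (fun c => exists m, c = << q k >> *~ m)).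
  - by exists 0; rewrite mulr0z.
  - by move=> c1 c2 [m1 ->] [m2 ->]; exists (m1 + m2); rewrite mulrzDr.
  - by move=> c1 [m1 ->]; exists (- m1); rewrite mulrNz.
  - move=> s [_ [s0 _] sA]; exists 1; rewrite mulr1z; congr << _ >>.
    by apply/funext => t; rewrite /q; case: asboolP => [/sA|/s0].
have [ok|ek] := boolP (odd k); last first.
  exists (<< q k.+1 >> *~ m), 0; split; [|exact: Ch_0|].
    by apply: suppMz; apply: suppU.
  by rewrite addr0 cm raddfMz /= bdq /= ek mulr1z.
case: k c hS hc cm ok => [//|k] c hS hc cm ok.
have := Ch_red hc; rewrite cm raddfMz /= bdq ok mulr1z => /(congr1 (coeff (q k))).
rewrite coeff0 freegU_mulz coeffU eqxx mulr1 intz => ->.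
by rewrite mulr0z; apply: rel_boundary_Ch; exact: Ch_0.
Qed.

Lemma acyclic_contract (X : set T) (a : T) : near_refl -> X a ->
  triv (car X) (car [set a]) -> triv (car X) zero_car.
Proof.
move=> nr Xa h; apply: (@triv_trans _ _ zero_car (car [set a])) => //.
- exact: subcar_red.
- by split=> // b ->.
- exact: acyclic_point.
Qed.

Lemma fcont_hcont (T' : nspace R) (A : set T) (f : T -> T') :
  hcont A (fun _ : R => f) -> fcont A f.
Proof.
move=> h a Aa e e0; have [|d d0 hd] := h 0 a _ Aa e e0; first by rewrite lexx ler01.
exists d => // a' Aa' aa'; apply: (hd 0) => //; first by rewrite lexx ler01.
by rewrite subrr normr0.
Qed.

Definition cardle m (A : set T) := exists x : 'I_m -> T, A = range x.
Definition fin (A : set T) := exists m, cardle m A.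

Lemma cardle_fin m A : cardle m A -> fin A. Proof. by exists m. Qed.

Lemma cardle_sub m A B : B `<=` A -> B !=set0 -> cardle m A -> cardle m B.
Proof.
move=> BA [b Bb] [x Ax]; exists (fun i => if `[< B (x i) >] then x i else b).
apply/seteqP; split=> [c Bc|_ [i _ <-]]; last by case: asboolP.
have [i _ xi] : range x c by rewrite -Ax; exact: BA.
by exists i => //; rewrite asboolT ?xi.
Qed.

(** This common modulus replaces uniform continuity when points of a finite set are moved. *)
Lemma fin_min (A : set T) (P : T -> R -> Prop) : fin A ->
  (forall a d d', 0 < d -> d <= d' -> P a d' -> P a d) ->
  (forall a, A a -> exists2 d : R, 0 < d & P a d) ->
  exists2 d : R, 0 < d & forall a, A a -> P a d.
Proof.
move=> [m [x ->]] Pm; elim: m x => [|m IH] x h; first by exists 1 => // a [[]].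
have [|d d0 hd] := IH (fun i => x (lift ord0 i)).
  by move=> a [i _ <-]; apply: h; exists (lift ord0 i).
have [|d' d'0 hd'] := h (x ord0); first by exists ord0.
exists (Num.min d d') => [|a [i _ <-]]; first by rewrite lt_min d0.
have [j ->|->] := unliftP ord0 i.
  by apply: (Pm _ _ d); rewrite ?ge_min ?lexx ?lt_min ?d0 //; apply: hd; exists j.
by apply: (Pm _ _ d'); rewrite ?ge_min ?lexx ?lt_min ?d0 ?orbT.
Qed.

(* The Hausdorff metric, given by its closeness relation. *)
Definition hball (A : set T) (e : R) (B : set T) :=
  (forall a, A a -> exists2 b, B b & nearby a e b) /\
  (forall b, B b -> exists2 a, A a & nearby a e b).

Definition hyper : nspace R := NSpace hball set0.

Lemma hyper_refl : near_refl -> forall (A : hyper) (e : R), 0 < e -> nearby A e A.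
Proof. by move=> nr A e e0; split=> a Aa; exists a => //; exact: nr. Qed.

End Points.

(** * Maps of finite subsets induced by maps of points *)

Section HyperMaps.
Variables (R : realType) (T T' : nspace R).

Lemma cardle_setU m n (A B : set T) : cardle m A -> cardle n B -> cardle (m + n) (A `|` B).
Proof.
move=> [x ->] [y ->].
exists (fun i => match fintype.split i with inl j => x j | inr j => y j end).
apply/seteqP; split=> [a [] [j _ <-]|_ [i _ <-]].
- by exists (unsplit (inl j)) => //; rewrite unsplitK.
- by exists (unsplit (inr j)) => //; rewrite unsplitK.
- by case: fintype.split => j; [left|right]; exists j.
Qed.

Lemma fin_setU (A B : set T) : fin A -> fin B -> fin (A `|` B).
Proof. by move=> [m hA] [n hB]; exists (m + n)%N; exact: cardle_setU. Qed.

Lemma fin_set1 (a : T) : fin [set a].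
Proof.
exists 1%N, (fun=> a); apply/seteqP; split=> [b ->|_ [i _ <-]] //.
by exists ord0.
Qed.

Lemma cardle_image (f : T -> T') m (A : set T) : cardle m A -> cardle m (f @` A).
Proof.
move=> [x ->]; exists (f \o x); apply/seteqP; split=> [_ [_ [i _ <-] <-]|_ [i _ <-]].
  by exists i.
by exists (x i) => //; exists i.
Qed.

Lemma fin_image (f : T -> T') (A : set T) : fin A -> fin (f @` A).
Proof. by move=> [m h]; exists m; exact: cardle_image. Qed.

(** Continuity at A takes the least modulus over its finitely many points, since every point of a
    nearby A' is near one of them. So [F] has to be continuous on [D] only and may jump
    elsewhere. *)
Lemma hcont_image (Y : set (set T)) (D : set T) (F : R -> T -> T') (C : set T') :
  near_mono T -> near_refl T' -> hcont D F ->
  (forall A, Y A -> fin A /\ A `<=` D) ->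
  hcont (T := hyper T) (T' := hyper T') Y (fun u A => F u @` A `|` C).
Proof.
move=> nm nr hF hY u A u01 YA e e0; have [fA AD] := hY A YA.
have [||d d0 hd] := @fin_min _ _ A (fun a d => forall u' a', 0 <= u' <= 1 -> D a' ->
  `|u' - u| < d -> nearby a d a' -> nearby (F u a) e (F u' a')) fA.
- move=> a d d' d0 dd' h u' a' u01' Da' uu' aa'; apply: h => //.
    exact: lt_le_trans uu' dd'.
  exact: nm dd' aa'.
- by move=> a Aa; have [d d0 h] := hF u a u01 (AD _ Aa) e e0; exists d.
exists d => // u' A' u01' YA' uu' [h1 h2]; have [_ AD'] := hY A' YA'.
split=> [c [[a Aa <-]|Cc]|c [[a' Aa' <-]|Cc]].
- have [a' Aa' aa'] := h1 _ Aa; exists (F u' a'); first by left; exists a'.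
  by apply: hd => //; exact: AD'.
- by exists c; [right|exact: nr].
- have [a Aa aa'] := h2 _ Aa'; exists (F u a); first by left; exists a.
  by apply: hd => //; exact: AD'.
- by exists c; [right|exact: nr].
Qed.

End HyperMaps.

Section HyperOpen.
Variables (R : realType) (T : nspace R).
Hypothesis nm : near_mono T.

(** Openness is asked at finite sets only: to avoid a closed K with room to spare takes a least
    distance over the set. *)
Definition hopen (O : set (set T)) := forall A, O A -> fin A -> exists2 e : R, 0 < e &
  forall B, hball A e B -> O B.

Lemma hopen_openin (O B X U : set (set T)) : hopen O -> X `<=` B -> (forall A, B A -> fin A) ->
  U = B `&` O -> @openin R (hyper T) U X.
Proof.
move=> oO XB Bf -> A [BA OA]; have [e e0 h] := oO A OA (Bf _ BA).
by exists e => // A' XA' /h; split=> //; exact: XB.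
Qed.

Definition avoid (K : set T) : set (set T) := [set A | forall a, A a -> ~ K a].
Definition hit (O : set T) : set (set T) := [set A | exists2 a, A a & O a].

Definition popen (O : set T) := forall a, O a -> exists2 e : R, 0 < e &
  forall b, nearby a e b -> O b.

Lemma hopen_avoid (K : set T) : popen (~` K) -> hopen (avoid K).
Proof.
move=> oK A AK fA.
have [||e e0 he] := @fin_min _ _ A (fun a d => forall b, nearby a d b -> ~ K b) fA.
- by move=> a d d' _ dd' h b ab; apply: h; exact: nm dd' ab.
- by move=> a Aa; exact: oK (AK _ Aa).
exists e => // B [_ hB] b /hB[a Aa ab]; exact: he ab.
Qed.

Lemma hopen_hit (O : set T) : popen O -> hopen (hit O).
Proof.
move=> oO A [a Aa Oa] _; have [e e0 he] := oO a Oa; exists e => // B [hB _].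
by have [b Bb ab] := hB _ Aa; exists b => //; exact: he.
Qed.

Lemma hopenU (O O' : set (set T)) : hopen O -> hopen O' -> hopen (O `|` O').
Proof.
move=> h h' A [OA|OA] fA.
  by have [e e0 he] := h A OA fA; exists e => // B /he; left.
by have [e e0 he] := h' A OA fA; exists e => // B /he; right.
Qed.

Lemma hball_mono A e e' B : e <= e' -> hball (T := T) A e B -> hball A e' B.
Proof.
move=> ee [h1 h2]; split=> [a /h1[b Bb ab]|b /h2[a Aa ab]]; first by exists b => //; exact: nm ab.
by exists a => //; exact: nm ab.
Qed.

Lemma hopenI (O O' : set (set T)) : hopen O -> hopen O' -> hopen (O `&` O').
Proof.
move=> h h' A [OA OA'] fA; have [e e0 he] := h A OA fA; have [e' e'0 he'] := h' A OA' fA.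
exists (Num.min e e') => [|B hB]; first by rewrite lt_min e0.
by split; [apply: he|apply: he']; apply: hball_mono hB; rewrite ge_min lexx ?orbT.
Qed.

Lemma hopen_bigcup (I : Type) (D : set I) (O : I -> set (set T)) :
  (forall i, hopen (O i)) -> hopen (\bigcup_(i in D) O i).
Proof.
move=> h A [i Di OA] fA; have [e e0 he] := h i A OA fA.
by exists e => // B /he ?; exists i.
Qed.

End HyperOpen.

(** * The empty space, and inclusions that vanish in homology *)

Section MoreAlgebra.
Variables (R : realType) (T : nspace R).
Notation SC k := {freeg (simplex T k) / int}.

(** The empty simplex is the only simplex here; it gives the class in index 0, dimension -1, from
    which all later classes descend. *)
Lemma homology_Z_empty k : homology_Z k (car (set0 : set T)) (zero_car T) (k == 0).
Proof.
case: k => [|k] /=; last first.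
  apply/homology_ZF => c [hS _]; have -> : c = 0; last by apply: rel_boundary_Ch; exact: Ch_0.
  apply: Ch_red; apply: supp_sub hS => s [_ _ h].
  have := @std_ebas R k.+1 (ebas R k.+1); rewrite coeffU eqxx mulr1 => /(_ isT)[_ hs].
  by case: (h _ (hs _ (map_f _ (mem_enum _ (ord0 : 'I_k.+1))))).
pose q : simplex T 0 := fun=> dflt T; exists (coeff q); split=> //.
- by move=> c d _ _; rewrite coeffD.
- move=> c [hS _]; split=> [c0|[d [e [hd /Ch_red -> ->]]]]; last first.
    rewrite addr0 (_ : d = 0) ?raddf0 ?coeff0 //.
    apply: Ch_red; apply: supp_sub hd => s [_ _ h].
    case: (h (fun=> 1)); split=> [i|]; first exact: ler01.
    by rewrite sumr_const card_ord mulr1n.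
  have -> : c = 0; last by apply: rel_boundary_Ch; exact: Ch_0.
  apply/eqP/freeg_eqP => s; rewrite coeff0; have [//|/hS[_ [s0 _] _]] := eqVneq (coeff s c) 0.
  suff -> : s = q by [].
  by apply/funext => t; rewrite s0 //; exact: std0.
- exists << q >>; last by rewrite coeffU eqxx mulr1.
  split=> //; apply: suppU; split=> // [|t /std0 //].
  by split=> // t /std0.
Qed.

Lemma phiMz (X Y : carrier T) k (phi : SC k -> int) c m :
  (forall c d, rel_cycle X Y c -> rel_cycle X Y d -> phi (c + d) = phi c + phi d) ->
  rel_cycle X Y c -> rel_cycle X Y (c *~ m) /\ phi (c *~ m) = phi c * m.
Proof.
move=> hD hc; have p0 : phi 0 = 0.
  by apply: (@addrI _ (phi 0)); rewrite -hD ?addr0 //; exact: rcyc0.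
have hn n : rel_cycle X Y (c *+ n) /\ phi (c *+ n) = phi c *+ n.
  elim: n => [|n [IH1 IH2]]; first by split; [exact: rcyc0|rewrite mulr0n].
  by rewrite mulrS; split; [exact: rel_cycleD|rewrite hD // IH2 -mulrS].
have pN d : rel_cycle X Y d -> phi (- d) = - phi d.
  move=> hd; apply: (@addrI _ (phi d)); rewrite -hD //; last exact: rel_cycleN.
  by rewrite !subrr.
case: m => n; first by have [h1 h2] := hn n; split=> //; rewrite h2 -mulr_natr natz.
have [h1 h2] := hn n.+1; rewrite NegzE mulrNz; split; first exact: rel_cycleN.
by rewrite pN // h2 mulrN -mulr_natr natz.
Qed.

(* If [A -> B] vanishes in homology, the long exact sequence of the triple splits into short
   ones; with [Z] in the two outer places of the only nonzero one, [H(B, W)] must vanish. *)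
Lemma null_triple (W A B : carrier T) n : subcar W A -> subcar A B ->
  (forall k, homology_Z k A W (k == n)) -> (forall k, homology_Z k B A (k == n.+1)) ->
  (forall k (c : SC k), rel_cycle A W c -> rel_boundary B W c) -> triv B W.
Proof.
move=> WA AB hAW hBA null k c hc.
have hcA : rel_cycle B A c by split; [exact: hc.1|exact: cyc_sub hc.2].
suff [d [e [hd he ce]]] : rel_boundary B A c.
  rewrite ce; apply: rel_boundaryD; first exact: rel_boundary_bdry.
  apply: null; split=> //; have -> : e = c - bdry d by rewrite ce addrC addKr.
  by apply: cycB; [exact: hc.2|exact: cyc_bdry hd].
have [kn|kn] := eqVneq k n.+1; last first.
  by have := hBA k; rewrite (negbTE kn) => /homology_ZF; exact.
subst k; have [phi [pD p0 _ _]] := hBA n.+1.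
have [psi [sD s0 + _]] := hAW n; rewrite eqxx => /(_ isT)[e he se].
have [f [g [hf hg ef]]] := null _ _ he.
have hfA : rel_cycle B A f.
  split=> //=; have -> : bdry f = e - g by rewrite ef addrK.
  by apply: Ch_B; [exact: he.1|exact: Ch_sub hg].
(* In H(B, A), which is infinite cyclic, the combination a c - m f vanishes. Taking boundaries shows
   that m e, with e the generator of H(A, W), bounds in A up to W; hence m = 0. *)
apply/(p0 _ hcA); set m := phi c; set a := phi f.
have [ca pca] := phiMz a pD hcA; have [fm pfm] := phiMz m pD hfA.
have [nfm pnfm] : rel_cycle B A (- (f *~ m)) /\ phi (- (f *~ m)) = - (a * m).
  have [h1 h2] := phiMz (- m) pD hfA.
  by move: h1 h2; rewrite mulrNz mulrN.
have : phi (c *~ a - f *~ m) = 0 by rewrite pD // pca pnfm -/m mulrC subrr.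
move=> /(p0 _ (rel_cycleB ca fm))[d [e' [hd he' x]]].
have bM (y : SC n.+1) l : bdry (y *~ l) = bdry y *~ l by exact: raddfMz.
have bx : bdry c *~ a - bdry f *~ m = bdry e'.
  by rewrite -!bM -[LHS]raddfB x raddfD /= (bdry_bdry hd) add0r.
have [em pem] := phiMz m sD he.
have hm : psi (e *~ m) = 0.
  apply/(s0 _ em); have -> : e *~ m = (bdry c *~ a + g *~ m) - bdry e'.
    by rewrite -bx opprB [bdry c *~ a + _]addrC addrACA subrr addr0 addrC -mulrzDl -ef.
  apply: rel_boundaryB; last by apply: rel_boundary_bdry.
  by apply: rel_boundary_Ch; apply: Ch_D; apply: suppMz => //; exact: hc.2.
by move: pem; rewrite hm se mul1r.
Qed.

End MoreAlgebra.

(** * Motions of points on the line *)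

Section Line.
Variable R : realType.

Definition rline : nspace R := @NSpace R R (fun a e b => `|b - a| < e) 0.

Lemma rline_refl : near_refl rline.
Proof. by move=> a e e0; rewrite /nearby /= subrr normr0. Qed.

Lemma rline_mono : near_mono rline.
Proof. by move=> a b e e' ee; rewrite /nearby /= => h; exact: lt_le_trans ee. Qed.

Notation HR := (hyper rline).
Notation htr Y := (@car R HR Y).
Implicit Types (D : set rline) (c f g : rline -> rline).

Lemma fcont_const D (a : R) : fcont D (fun=> a : rline).
Proof. by move=> b _ e e0; exists 1 => // b' _ _; exact: rline_refl. Qed.

Lemma fcont_affine D (a b : R) : fcont D (fun x => a * x + b : rline).
Proof.
move=> x _ e e0; exists (e / (`|a| + 1)) => [|y _].
  by rewrite divr_gt0 // ltr_wpDl.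
rewrite /nearby /= ltr_pdivlMr ?ltr_wpDl // => h.
have -> : a * y + b - (a * x + b) = a * (y - x) by rewrite opprD addrACA subrr addr0 mulrBr.
rewrite normrM; apply: le_lt_trans h; rewrite mulrC.
by apply: ler_wpM2l => //; rewrite lerDl.
Qed.

Lemma fcont_id D : fcont D (fun x : rline => x).
Proof. by move=> x _ e e0; exists e. Qed.

Lemma fcont_min D f g : fcont D f -> fcont D g -> fcont D (fun x => (Num.min (f x : R) (g x : R) : R) : rline).
Proof.
move=> hf hg x Dx e e0; have [d d0 hd] := hf x Dx e e0; have [d' d'0 hd'] := hg x Dx e e0.
exists (Num.min d d') => [|y Dy]; first by rewrite lt_min d0.
rewrite /nearby /= lt_min => /andP[/(hd y Dy) + /(hd' y Dy)]; rewrite /nearby /=.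
rewrite !ltr_distl => /andP[h1 h2] /andP[h3 h4].
by apply/andP; split; rewrite /Num.min; case: ifP => h; case: ifP => h'; lra.
Qed.

(** The jump at z is harmless as no point of D is z. This is how an interval gets torn at a missed
    point. *)
Lemma fcont_if D z f g : fcont D f -> fcont D g -> (forall x, D x -> x != z) ->
  fcont D (fun x : rline => if (x : R) < z then f x else g x).
Proof.
move=> hf hg hz x Dx e e0; have [xz|zx] := ltP (x : R) z.
  have [d d0 hd] := hf x Dx e e0.
  exists (Num.min d (z - x)) => [|y Dy]; first by rewrite lt_min d0 subr_gt0.
  rewrite /nearby /= lt_min => /andP[yx1 yx2]; rewrite ifT; last first.
    by move: yx2; rewrite ltr_distl => /andP[_]; rewrite addrC subrK.
  exact: hd.
have {}zx : z < x by rewrite lt_neqAle zx eq_sym hz.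
have [d d0 hd] := hg x Dx e e0.
exists (Num.min d (x - z)) => [|y Dy]; first by rewrite lt_min d0 subr_gt0.
rewrite /nearby /= lt_min => /andP[yx1 yx2]; rewrite ifF; last first.
  apply/negbTE; rewrite -leNgt ltW //.
  by move: yx2; rewrite ltr_distl => /andP[+ _]; rewrite opprB addrCA subrr addr0.
exact: hd.
Qed.

(** The straight-line homotopy from the identity to c. *)
Definition lh c (u : R) (x : rline) : rline := (1 - u) * x + u * c x.

Lemma hcont_lh D c : fcont D c -> hcont D (lh c).
Proof.
move=> hc u x /andP[u0 u1] Dx e e0.
have e3 : 0 < e / 3 by rewrite divr_gt0.
have [d d0 hd] := hc x Dx (e / 3) e3.
pose q := e / 3 / (`|x - c x| + 1); have q0 : 0 < q by rewrite divr_gt0 // ltr_wpDl.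
exists (Num.min (Num.min d (e / 3)) q) => [|u' y /andP[u'0 u'1] Dy].
  by rewrite !lt_min d0 e3.
rewrite /nearby /= !lt_min => /andP[_ uu] /andP[/andP[/(hd y Dy) cy yx] _].
move: cy; rewrite /nearby /= => cy.
(* One third of e for the moved point, one for its image and one for the change of time. The +1 in q
   allows for fixed points of c. *)
have -> : lh c u' y - lh c u x = (1 - u') * (y - x) + u' * (c y - c x) + (u' - u) * (c x - x).
  rewrite /lh; move: (c x) (c y) => a b; ring.
have h1 : `|(1 - u') * (y - x)| <= `|y - x|.
  rewrite normrM ger0_norm ?subr_ge0 // ler_piMl // gerBl //.
have h2 : `|u' * (c y - c x)| <= `|c y - c x|.
  by rewrite normrM ger0_norm // ler_piMl.
have h3 : `|(u' - u) * (c x - x)| < e / 3.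
  rewrite normrM (distrC (c x)); move: uu; rewrite /q ltr_pdivlMr ?ltr_wpDl //.
  apply: le_lt_trans; apply: ler_wpM2l => //; by rewrite lerDl.
apply: (le_lt_trans (ler_normD _ _)); apply: (le_lt_trans (lerD (ler_normD _ _) (lexx _))).
apply: (le_lt_trans (lerD (lerD h1 h2) (lexx _))).
by move: (`|_|) (`|_|) (`|_|) yx cy h3 => a1 a2 a3; lra.
Qed.

Lemma seg_lt (a x y u : R) : 0 <= u <= 1 -> x < a -> y < a -> (1 - u) * x + u * y < a.
Proof.
move=> /andP[u0 u1] xa ya; have [->|un] := eqVneq u 0.
  by rewrite subr0 mul1r mul0r addr0.
have h1 : 0 <= (1 - u) * (a - x) by rewrite mulr_ge0 // subr_ge0 // ltW.
have h2 : 0 < u * (a - y) by rewrite mulr_gt0 ?subr_gt0 // lt_neqAle eq_sym un.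
lra.
Qed.

Lemma seg_gt (a x y u : R) : 0 <= u <= 1 -> a < x -> a < y -> a < (1 - u) * x + u * y.
Proof.
move=> u01 xa ya; rewrite -ltrN2 opprD -!mulrN.
by apply: seg_lt => //; rewrite ltrN2.
Qed.

Lemma seg_le (a x y u : R) : 0 <= u <= 1 -> x <= a -> y <= a -> (1 - u) * x + u * y <= a.
Proof.
move=> /andP[u0 u1] xa ya.
have h1 : 0 <= (1 - u) * (a - x) by rewrite mulr_ge0 // subr_ge0.
have h2 : 0 <= u * (a - y) by rewrite mulr_ge0 ?subr_ge0.
lra.
Qed.

Lemma seg_ge (a x y u : R) : 0 <= u <= 1 -> a <= x -> a <= y -> a <= (1 - u) * x + u * y.
Proof.
move=> u01 xa ya; rewrite -lerN2 opprD -!mulrN.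
by apply: seg_le => //; rewrite lerN2.
Qed.

Lemma lh0 c (A : set rline) : lh c 0 @` A = A.
Proof.
rewrite (_ : lh c 0 = id) ?image_id //; apply/funext => x.
by rewrite /lh subr0 mul1r mul0r addr0.
Qed.

Lemma lh1 c : lh c 1 = c.
Proof. by apply/funext => x; rewrite /lh subrr mul0r mul1r add0r. Qed.

Lemma deformR (Y Y0 : set (set rline)) D c : Y0 `<=` Y ->
  (forall A, Y A -> fin A /\ A `<=` D) -> fcont D c ->
  (forall u A, 0 <= u <= 1 -> Y A -> Y (lh c u @` A)) ->
  (forall u A, 0 <= u <= 1 -> Y0 A -> Y0 (lh c u @` A)) ->
  (forall A, Y A -> Y0 (c @` A)) ->
  triv (htr Y) (htr Y0).
Proof.
move=> YY hY hc h h0 h1.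
pose H (u : R) (A : HR) : HR := lh c u @` A.
apply: (@deformation R HR (htr Y) (htr Y0) H) => //.
- have := hcont_image set0 rline_mono rline_refl (hcont_lh hc) hY.
  by under eq_fun do under eq_fun do rewrite setU0.
- by move=> A _; rewrite /H lh0.
- by move=> A YA; rewrite /H lh1; exact: h1.
Qed.

Lemma contractR (Y : set (set rline)) D c A0 : Y A0 ->
  (forall A, Y A -> fin A /\ A `<=` D) -> fcont D c ->
  (forall u A, 0 <= u <= 1 -> Y A -> Y (lh c u @` A)) ->
  (forall A, Y A -> c @` A = A0) -> (forall u, 0 <= u <= 1 -> lh c u @` A0 = A0) ->
  triv (htr Y) (zero_car HR).
Proof.
move=> YA0 hY hc h h1 h0.
apply: (acyclic_contract (hyper_refl rline_refl) YA0).
by apply: (deformR (c := c) _ hY) => // [A ->//|u A u01 ->]; exact: h0.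
Qed.

End Line.

(** * Finite subsets of an interval *)

Section HyperTools.
Variables (R : realType) (T T' : nspace R).

Lemma hcont_const (D : set T) (f : T -> T') : fcont D f -> hcont D (fun _ : R => f).
Proof.
by move=> h u a _ Da e e0; have [d d0 hd] := h a Da e e0; exists d => // u' a' _ Da' _; exact: hd.
Qed.

Lemma fcont_image (Y : set (set T)) (D : set T) (f : T -> T') (C : set T') :
  near_mono T -> near_refl T' -> fcont D f ->
  (forall A, Y A -> fin A /\ A `<=` D) ->
  fcont (T := hyper T) (T' := hyper T') Y (fun A => f @` A `|` C).
Proof.
move=> nm nr hf hY; apply: fcont_hcont.
exact: (hcont_image C nm nr (hcont_const hf) hY).
Qed.

Lemma fcont_image0 (Y : set (set T)) (D : set T) (f : T -> T') :
  near_mono T -> near_refl T' -> fcont D f ->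
  (forall A, Y A -> fin A /\ A `<=` D) ->
  fcont (T := hyper T) (T' := hyper T') Y (fun A => f @` A).
Proof.
move=> nm nr hf hY; have := fcont_image set0 nm nr hf hY.
by under eq_fun do rewrite setU0.
Qed.

End HyperTools.

Lemma hcont_lh_image (R : realType) (Y : set (set (rline R))) D c : fcont D c ->
  (forall A, Y A -> fin A /\ A `<=` D) ->
  hcont (T := hyper (rline R)) (T' := hyper (rline R)) Y (fun u A => lh c u @` A).
Proof.
move=> hc hY.
have := hcont_image set0 (@rline_mono R) (@rline_refl R) (hcont_lh hc) hY.
by under eq_fun do under eq_fun do rewrite setU0.
Qed.

Section BaseExcision.
Variables (R : realType) (T : nspace R).
Notation HT := (hyper T).
Notation htr Y := (@car R HT Y).
Variable B : set (set T).
Hypothesis Bf : forall A, B A -> fin A.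

Lemma base_excision k (U V O O' : set (set T)) : hopen O -> hopen O' ->
  U = B `&` O -> V = B `&` O' ->
  homology_iso k (htr V) (htr (U `&` V)) k (htr (U `|` V)) (htr U).
Proof.
move=> oO oO' eU eV; have UB : U `|` V `<=` B by rewrite eU eV => A [] [].
by apply: excision; [apply: hopen_openin oO _ _ eU|apply: hopen_openin oO' _ _ eV].
Qed.

Lemma base_excision_triv (U V O O' : set (set T)) : hopen O -> hopen O' ->
  U = B `&` O -> V = B `&` O' ->
  triv (htr V) (htr (U `&` V)) -> triv (htr (U `|` V)) (htr U).
Proof.
move=> oO oO' eU eV /trivP h; apply/trivP => k.
by apply/(homology_Z_iso _ (base_excision k oO oO' eU eV)); exact: h.
Qed.

End BaseExcision.

Section Interval.
Variables (R : realType) (N : nat).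
Notation HR := (hyper (rline R)).
Notation htr Y := (@car R HR Y).
Local Notation rl := (rline R).
Implicit Type (A : set rl).

Definition base : set (set rl) :=
  [set A : set rl | [/\ fin A, forall x : R, A x -> 0 <= x <= N%:R, A (0 : R) & A (N%:R : R)]].

Lemma base_fin A : base A -> fin A. Proof. by case. Qed.

Lemma base_lh (c : R -> R) u A : 0 <= u <= 1 ->
  (forall x : R, 0 <= x <= N%:R -> 0 <= c x <= N%:R) -> c 0 = 0 -> c N%:R = N%:R ->
  base A -> base ((lh c u : rl -> rl) @` A).
Proof.
move=> u01 hc c0 cN [fA A01 A0 AN]; split.
- exact: fin_image.
- move=> _ [x Ax <-]; have /andP[x0 xN] := A01 x Ax.
  have /andP[cx0 cxN] := hc x (A01 x Ax).
  by rewrite (seg_ge u01) // (seg_le u01).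
- by exists (0 : R) => //; rewrite /lh c0; lra.
- by exists (N%:R : R) => //; rewrite /lh cN; lra.
Qed.

Definition pt_avoid (i : nat) : set (set rl) := @avoid R rl [set (i%:R : R)].
Definition some_avoid (k : nat) : set (set rl) :=
  \bigcup_(i in [set i | (1 <= i <= k)%N]) pt_avoid i.

(* X_k for z_i = i, and the sets that miss the point i. *)
Definition Xs k := base `&` some_avoid k.
Definition Vs i := base `&` pt_avoid i.

Lemma popen_neq (a : R) : @popen R rl (~` [set a]).
Proof.
move=> x xa; exists `|x - a|; first by rewrite normr_gt0 subr_eq0; apply/eqP.
by move=> y; rewrite /nearby /= => h ya; move: h; rewrite ya distrC ltxx.
Qed.

Lemma popen_out (a b : R) : @popen R rl (~` [set x : R | a <= x <= b]).
Proof.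
move=> x /= /negP; rewrite negb_and -!ltNge => /orP[xa|bx].
  exists (a - x); first by rewrite subr_gt0.
  by move=> y; rewrite /nearby /= ltr_distl => /andP[_ h] /= /andP[h1 _]; lra.
exists (x - b); first by rewrite subr_gt0.
by move=> y; rewrite /nearby /= ltr_distl => /andP[h _] /= /andP[_ h1]; lra.
Qed.

Lemma popen_in (a b : R) : @popen R rl [set x : R | a < x < b].
Proof.
move=> x /= /andP[ax xb]; exists (Num.min (x - a) (b - x)).
  by rewrite lt_min !subr_gt0 ax.
move=> y; rewrite /nearby /= lt_min !ltr_distl => /andP[/andP[h1 h2] /andP[h3 h4]].
by apply/andP; split; lra.
Qed.

Lemma hopen_pt_avoid i : hopen (pt_avoid i).
Proof. by apply: hopen_avoid; [exact: rline_mono|exact: popen_neq]. Qed.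

Lemma hopen_some_avoid k : hopen (some_avoid k).
Proof. by apply: hopen_bigcup => i; exact: hopen_pt_avoid. Qed.

Lemma pt_avoid_image (c : R -> R) i (A : set rl) :
  (forall x : R, A x -> c x <> i%:R) -> pt_avoid i ((c : rl -> rl) @` A).
Proof. by move=> h _ [x Ax <-]; exact: h. Qed.

Definition cut (z : R) (x : R) : R := if x < z then 0 else N%:R.

Lemma cut_cont z (D : set rl) : (forall x : R, D x -> x != z) -> fcont D (cut z : rl -> rl).
Proof.
move=> h; apply: (@fcont_if R D z (fun=> 0 : R) (fun=> N%:R : R)) => //;
  exact: fcont_const.
Qed.

Lemma cut_range z x : 0 <= cut z x <= N%:R.
Proof. by rewrite /cut; case: ifP; rewrite lexx ?ler0n. Qed.

Lemma cut0 z : 0 < z -> cut z 0 = 0. Proof. by rewrite /cut => ->. Qed.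
Lemma cutN z : z < N%:R -> cut z N%:R = N%:R.
Proof. by move=> h; rewrite /cut ltNge ltW. Qed.

Lemma cut_ne (z x u : R) : 0 < z < N%:R -> 0 <= u <= 1 -> x <> z -> @lh R (cut z) u x <> z.
Proof.
move=> /andP[z0 zN] u01 /eqP; rewrite neq_lt => /orP[xz|zx]; apply/eqP.
  by rewrite /lh {1}/cut xz lt_eqF // seg_lt.
have e : cut z x = N%:R by rewrite /cut ltNge ltW.
by rewrite /lh e gt_eqF // seg_gt.
Qed.

(** Sets that miss i are torn there: points to the left slide to 0, the others to N, and what
    remains are the two end points that every set has. *)
Lemma Vs_acyclic i : (0 < i < N)%N -> triv (htr (Vs i)) (zero_car HR).
Proof.
move=> /andP[i0 iN].
have i0' : 0 < i%:R :> R by rewrite ltr0n.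
have iN' : i%:R < N%:R :> R by rewrite ltr_nat.
pose A0 : set rl := [set (0 : R); (N%:R : R)].
have h0 u : 0 <= u <= 1 -> (lh (cut i%:R) u : rl -> rl) @` A0 = A0.
  move=> u01; have e0 : @lh R (cut i%:R) u (0 : R) = 0 by rewrite /lh cut0 //; lra.
  have eN : @lh R (cut i%:R) u (N%:R : R) = N%:R by rewrite /lh cutN //; lra.
  apply/seteqP; split=> [_ [x [->|->] <-]|x [->|->]].
  - by left.
  - by right.
  - by exists (0 : R) => //; left.
  - by exists (N%:R : R) => //; right.
apply: (@contractR R (Vs i) [set x : R | x != i%:R] (cut i%:R) A0).
- split.
    split; [|by move=> x [->|->]; rewrite ?lexx ?ler0n|by left|by right].
    by apply: fin_setU; exact: fin_set1.
  by move=> x [->|->] /= /eqP; rewrite ?(lt_eqF i0') ?(gt_eqF iN').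
- by move=> A [[fA _ _ _] hA]; split=> // x Ax /=; apply/eqP; exact: hA.
- exact: cut_cont.
- move=> u A u01 [bA hA]; split.
    by apply: base_lh => //; [move=> x _; exact: cut_range|exact: cut0|exact: cutN].
  by apply: pt_avoid_image => x /hA; apply: cut_ne; rewrite ?i0' ?iN'.
- move=> A [[_ _ A0' AN] _]; apply/seteqP; split=> [_ [x _ <-]|x [->|->]].
  + by rewrite /cut; case: ifP => _; [left|right].
  + by exists (0 : R); rewrite ?cut0.
  + by exists (N%:R : R); rewrite ?cutN.
- exact: h0.
Qed.

(** * From the pair of V_{k+1} to the pair of V_{k+2} *)

Section Step.
Variable k : nat.
Hypothesis kN : (k.+2 < N)%N.
Let a : R := k.+1%:R.
Let b : R := k.+2%:R.
Let ab : b = a + 1. Proof. by rewrite /b /a -[k.+2%:R]natr1. Qed.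
Let ka : a = k%:R + 1. Proof. by rewrite /a -natr1. Qed.
Let bN : b < N%:R. Proof. by rewrite ltr_nat. Qed.

(** [F0], [Gs] and [F1] make up the intersection of X_{k+1} and V_{k+2}. The first two together
    carry the homology of V_{k+2}, so only [F1] relative to its part in them is left, and that
    reproduces the previous stage. *)
Definition F0 := base `&` @avoid R rl [set x : rl | a <= (x : R) <= b].
Definition F1 := base `&` (pt_avoid k.+1 `&` pt_avoid k.+2 `&` @hit R rl [set x : rl | a < (x : R) < b]).
Definition Gs := base `&` (some_avoid k `&` pt_avoid k.+2).

(** Cutting at b clears [a, b]: points below b end at 0, the others at N, and none enters the
    interval from outside on the way. *)
Lemma Vs_F0 : triv (htr (Vs k.+2)) (htr F0).
Proof.
have b0 : 0 < b by rewrite ltr0n.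
apply: (@deformR R _ _ [set x : R | x != b] (cut b)).
- move=> A [bA hA]; split=> // x /hA h e; apply: h; rewrite /= e /b; apply/andP; split=> //.
  by rewrite -/b ab; lra.
- by move=> A [[fA _ _ _] hA]; split=> // x Ax /=; apply/eqP; exact: hA.
- exact: cut_cont.
- move=> u A u01 [bA hA]; split.
    by apply: base_lh => //; [move=> x _; exact: cut_range|exact: cut0|exact: cutN].
  by apply: pt_avoid_image => x /hA; apply: cut_ne; rewrite ?b0 ?bN.
- move=> u A u01 [bA hA]; split.
    by apply: base_lh => //; [move=> x _; exact: cut_range|exact: cut0|exact: cutN].
  move=> _ [x Ax <-] /= h; apply: (hA x Ax) => /=; move: h; rewrite /lh /cut.
  have [xb|bx] := ltP x b => h; last first.
    have [xb'|bx'] := leP x b; first by rewrite andbT; move: ab bx; lra.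
    have := @seg_gt R b x N%:R u u01 bx' bN.
    by move: h => /andP[_ h]; rewrite ltNge h.
  rewrite (ltW xb) andbT leNgt; apply/negP => xa.
  have := @seg_lt R a x 0 u u01 xa _; rewrite ltr0n => /(_ isT).
  by move: h => /andP[h _]; rewrite ltNge h.
- move=> A [bA hA]; split.
    have := @base_lh (cut b) 1 A; rewrite lh1; apply=> //.
    + by rewrite ler01 lexx.
    + by move=> x _; exact: cut_range.
    + exact: cut0.
    + exact: cutN.
  move=> _ [x Ax <-] /=; rewrite /cut; case: ifP => _ /andP[].
    by rewrite leNgt ltr0n.
  by move=> _; rewrite leNgt bN.
Qed.

(** Halving the distance to k would take b = k + 2 to a = k + 1, so [a, b) is emptied. The minimum
    fixes the points up to k, and so preserves which of the marks 1, ..., k are missed. *)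
Definition squeeze (x : R) : R := if x < b then Num.min x ((x + k%:R) / 2) else x.

Lemma squeeze_cont (D : set rl) : (forall x : R, D x -> x != b) ->
  fcont D (squeeze : rl -> rl).
Proof.
move=> h; apply: (@fcont_if R D b (fun x => Num.min (x : R) (((x : R) + k%:R) / 2)) (fun x => x)) => //.
  apply: (@fcont_min R D (fun x => x) (fun x => ((x : R) + k%:R) / 2)); first exact: fcont_id.
  have := @fcont_affine R D 2^-1 (k%:R / 2).
  by under eq_fun do rewrite [2^-1 * _]mulrC -mulrDl.
exact: fcont_id.
Qed.

Lemma squeeze_le x : squeeze x <= x.
Proof. by rewrite /squeeze; case: ifP => // _; rewrite ge_min lexx. Qed.

Lemma squeeze_id x : x <= k%:R -> squeeze x = x.
Proof.
move=> xk; rewrite /squeeze ifT; last by move: ab ka; lra.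
by apply/min_idPl; lra.
Qed.

Lemma squeeze_gt x : k%:R < x -> k%:R < squeeze x.
Proof. by move=> kx; rewrite /squeeze; case: ifP => // _; rewrite lt_min kx; lra. Qed.

Lemma squeeze_lt x : x < b -> squeeze x < a.
Proof.
move=> xb; rewrite /squeeze xb; apply: (@le_lt_trans _ _ ((x + k%:R) / 2)).
  by rewrite ge_min lexx orbT.
by move: ab ka; lra.
Qed.

Lemma squeeze_big x : b <= x -> squeeze x = x.
Proof. by rewrite /squeeze ltNge => ->. Qed.

Lemma squeeze_base u A : 0 <= u <= 1 -> base A -> base ((lh squeeze u : rl -> rl) @` A).
Proof.
move=> u01; apply: base_lh => //; last by rewrite squeeze_big // ltW.
  move=> x /andP[x0 xN]; rewrite (le_trans (squeeze_le _)) // andbT.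
  have [xk|kx] := leP x k%:R; first by rewrite squeeze_id.
  by apply: ltW; apply: le_lt_trans (squeeze_gt kx).
by rewrite squeeze_id.
Qed.

Lemma keep_some_avoid (c : R -> R) u A : 0 <= u <= 1 ->
  (forall x, x <= k%:R -> c x = x) -> (forall x, k%:R < x -> k%:R < c x) ->
  some_avoid k A -> some_avoid k ((lh c u : rl -> rl) @` A).
Proof.
move=> u01 c1 c2 [i hi hA]; exists i => //; apply: pt_avoid_image => x Ax.
have [xk|kx] := leP x k%:R.
  by rewrite /lh c1 // -mulrDl subrK mul1r; exact: hA.
have ik : i%:R <= k%:R :> R by rewrite ler_nat; case/andP: hi.
by apply/eqP; rewrite gt_eqF // (le_lt_trans ik) // seg_gt // c2.
Qed.

Lemma Gs_F0 : triv (htr Gs) (htr (F0 `&` Gs)).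
Proof.
have keepG u A : 0 <= u <= 1 -> Gs A -> Gs ((lh squeeze u : rl -> rl) @` A).
  move=> u01 [bA [sA pA]]; split; first exact: squeeze_base.
  split; first by apply: keep_some_avoid => //; [exact: squeeze_id|exact: squeeze_gt].
  apply: pt_avoid_image => x /pA /eqP; rewrite neq_lt => /orP[xb|bx]; apply/eqP.
    rewrite lt_eqF // seg_lt //; apply: lt_trans (squeeze_lt xb) _.
    by move: ab; lra.
  by rewrite gt_eqF // seg_gt // squeeze_big // ltW.
apply: (@deformR R _ _ [set x : R | x != b] squeeze).
- by move=> A [].
- by move=> A [[fA _ _ _] [_ hA]]; split=> // x Ax /=; apply/eqP; exact: hA.
- exact: squeeze_cont.
- exact: keepG.
- move=> u A u01 [[bA hA] GA]; split; last exact: keepG.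
  split; first exact: squeeze_base.
  move=> _ [x Ax <-] /= /andP[h1 h2]; apply: (hA x Ax) => /=.
  have [xa|ax] := ltP x a.
    have : (1 - u) * x + u * squeeze x < a.
      by apply: seg_lt => //; exact: le_lt_trans (squeeze_le x) xa.
    by rewrite ltNge h1.
  have [//|bx] := leP x b.
  have : b < (1 - u) * x + u * squeeze x by apply: seg_gt => //; rewrite squeeze_big // ltW.
  by rewrite ltNge h2.
- move=> A GA; have := keepG 1 A; rewrite lh1 ler01 lexx => /(_ isT GA) GA'.
  split=> //; split; first by case: GA'.
  move=> _ [x Ax <-] /= /andP[h1 h2].
  have [_ [_ pA]] := GA; move: (pA x Ax) => /eqP; rewrite neq_lt => /orP[xb|bx].
    by move: (squeeze_lt xb); rewrite ltNge h1.
  have {}bx : b < x := bx; move: h2; rewrite squeeze_big; last exact: ltW.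
  by rewrite leNgt bx.
Qed.

Lemma hopen_F0 : hopen (@avoid R rl [set x : rl | a <= (x : R) <= b]).
Proof. by apply: hopen_avoid; [exact: rline_mono|exact: popen_out]. Qed.

Lemma GF_F0 : triv (htr (F0 `|` Gs)) (htr F0).
Proof.
apply: (base_excision_triv base_fin hopen_F0 (O' := some_avoid k `&` pt_avoid k.+2)) => //.
  by apply: hopenI; [exact: rline_mono|exact: hopen_some_avoid|exact: hopen_pt_avoid].
exact: Gs_F0.
Qed.

Lemma hopen_F1 : hopen (pt_avoid k.+1 `&` pt_avoid k.+2 `&` @hit R rl [set x : rl | a < (x : R) < b]).
Proof.
apply: hopenI; [exact: rline_mono| |by apply: hopen_hit; exact: popen_in].
by apply: hopenI; [exact: rline_mono|exact: hopen_pt_avoid|exact: hopen_pt_avoid].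
Qed.

Lemma hopen_GF : hopen (@avoid R rl [set x : rl | a <= (x : R) <= b] `|`
  (some_avoid k `&` pt_avoid k.+2)).
Proof.
apply: hopenU; first exact: hopen_F0.
by apply: hopenI; [exact: rline_mono|exact: hopen_some_avoid|exact: hopen_pt_avoid].
Qed.

Lemma GF_E : F0 `|` Gs = base `&` (@avoid R rl [set x : rl | a <= (x : R) <= b] `|`
  (some_avoid k `&` pt_avoid k.+2)).
Proof. by rewrite setIUr. Qed.

Lemma notin_avoid i A : ~ A (i%:R : R) -> pt_avoid i A.
Proof. by move=> h x Ax xi; apply: h; rewrite -[(i%:R : R)]xi. Qed.

(** If a set misses k + 1 and k + 2, then either it has a point strictly between them, or it avoids
    the whole closed interval. *)
Lemma XV_E : Xs k.+1 `&` Vs k.+2 = (F0 `|` Gs) `|` F1.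
Proof.
apply/seteqP; split=> [A [[bA [i /= /andP[i1 ik] hi]] [_ h2]]|A].
  have [e|ni] := eqVneq i k.+1; last first.
    left; right; split=> //; split=> //; exists i => //=.
    by rewrite i1 -ltnS ltn_neqAle ni.
  subst i; have [hA|hA] := pselect (@hit R rl [set x : rl | a < (x : R) < b] A).
    by right.
  left; left; split=> // x Ax /= /andP[h3 h4]; apply: hA; exists x => //=.
  rewrite !lt_neqAle h3 h4 !andbT; apply/andP; split; apply/eqP => e.
    by apply: (hi x Ax); rewrite /= -e.
  exact: (h2 x Ax).
have leab : a <= b by rewrite ab lerDl.
have h1 B : F0 B -> pt_avoid k.+1 B.
  by case=> _ h x Bx e; apply: (h x Bx); rewrite /= e; apply/andP; split; [exact: lexx|].
have h2 B : F0 B -> pt_avoid k.+2 B.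
  by case=> _ h x Bx e; apply: (h x Bx); rewrite /= e; apply/andP; split; [|exact: lexx].
move=> [[FA|[bA [[i /= /andP[i1 ik] hi] h3]]]|[bA [[h3 h4] _]]].
- have [bA _] := FA; split; split=> //; [|exact: h2].
  by exists k.+1 => //=; exact: h1.
- split; split=> //; exists i => //=.
  by rewrite i1 ltnW.
- by split; split=> //; exists k.+1 => /=.
Qed.

Definition mid : R := a + 2^-1.
(** [rho] sends all points beyond a to N and so lands in V_{k+1}. [rho'] gathers those between a and
    b at [mid] instead, which keeps a set of [F1] in [F1]. *)
Definition rho (x : R) : R := if x < a then x else N%:R.
Definition rho' (x : R) : R := if x < a then x else if x < b then mid else N%:R.

Lemma rho_cont (D : set rl) : (forall x : R, D x -> x != a) -> fcont D (rho : rl -> rl).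
Proof.
move=> h; apply: (@fcont_if R D a (fun x => x) (fun=> N%:R : R)) => //.
  exact: fcont_id.
exact: fcont_const.
Qed.

Lemma rho'_cont (D : set rl) : (forall x : R, D x -> x != a) -> (forall x : R, D x -> x != b) ->
  fcont D (rho' : rl -> rl).
Proof.
move=> ha hb; apply: (@fcont_if R D a (fun x => x) (fun x => if (x : R) < b then mid else N%:R)) => //.
  exact: fcont_id.
by apply: (@fcont_if R D b (fun=> mid) (fun=> N%:R : R)) => //; exact: fcont_const.
Qed.

Lemma rho_lt x : x < a -> rho x = x. Proof. by rewrite /rho => ->. Qed.
Lemma rho_ge x : a <= x -> rho x = N%:R. Proof. by rewrite /rho ltNge => ->. Qed.

Let aN : a < N%:R. Proof. by move: bN ab; lra. Qed.
Let a0 : 0 < a. Proof. by rewrite ltr0n. Qed.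

Lemma rho_range x : 0 <= x <= N%:R -> 0 <= rho x <= N%:R.
Proof. by rewrite /rho; case: ifP; rewrite ?lexx ?ler0n. Qed.

Lemma rho'_range x : 0 <= x <= N%:R -> 0 <= rho' x <= N%:R.
Proof.
rewrite /rho'; case: ifP => // _ _; case: ifP; rewrite ?lexx ?ler0n // => _.
by move: aN bN ab a0; rewrite /mid; lra.
Qed.

Lemma rho_image_V A : base A -> Vs k.+1 ((rho : rl -> rl) @` A).
Proof.
move=> bA; split.
  have := @base_lh rho 1 A; rewrite lh1; apply=> //; first by rewrite ler01 lexx.
  + exact: rho_range.
  + exact: rho_lt.
  + by apply: rho_ge; exact: ltW.
apply: pt_avoid_image => x _; rewrite /rho; case: ifP => [xa|_]; apply/eqP.
  by rewrite lt_eqF.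
by rewrite gt_eqF.
Qed.

Lemma rho_some_avoid A : base A -> some_avoid k A -> some_avoid k ((rho : rl -> rl) @` A).
Proof.
move=> bA [i hi hA]; exists i => //; apply: pt_avoid_image => x Ax.
have ik : i%:R <= k%:R :> R by rewrite ler_nat; case/andP: hi.
rewrite /rho; case: ifP => [xa|_]; first exact: hA.
by apply/eqP; rewrite gt_eqF // (le_lt_trans ik) //; move: aN ka; lra.
Qed.

Lemma rho_rho A : (rho : rl -> rl) @` ((rho : rl -> rl) @` A) = (rho : rl -> rl) @` A.
Proof.
have e (x : R) : rho (rho x) = rho x.
  by rewrite {2 3}/rho; case: ifP => [/rho_lt //|_]; apply: rho_ge; exact: ltW.
apply/seteqP; split=> [_ [_ [x Ax <-] <-]|_ [x Ax <-]].
  by exists x.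
by exists (rho x) => //; exists x.
Qed.

Lemma mid_a : a < mid. Proof. by rewrite /mid; lra. Qed.
Lemma mid_b : mid < b. Proof. by rewrite /mid ab; lra. Qed.

Lemma add_mid_F1 A : base A ->
  F1 ((rho : rl -> rl) @` A `|` [set (mid : rl)]).
Proof.
move=> bA; have [[fA A01 A0 AN] hA] := rho_image_V bA.
split; first split.
- by apply: fin_setU => //; exact: fin_set1.
- by move=> x [/A01 //|->]; move: mid_a mid_b a0 bN; lra.
- by left.
- by left.
split; first split.
- by move=> x [/hA //|->] e; move: mid_a; rewrite [mid]e ltxx.
- move=> x [[y Ay <-]|->] e; last by move: mid_b; rewrite [mid]e ltxx.
  have {e} : rho y = b := e; rewrite /rho; case: ifP => [ya|_] e.
    by move: ya; rewrite e ltNge ab lerDl ler01.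
  by move: bN; rewrite e ltxx.
- by exists (mid : rl); [right|rewrite /= mid_a mid_b].
Qed.

(* Forgetting the points between k + 1 and k + 2 is inverse, up to homotopy, to adding the
   point [mid]. *)
Lemma F1_equiv j : homology_iso j (htr F1) (htr ((F0 `|` Gs) `&` F1)) j
  (htr (Vs k.+1)) (htr (Xs k `&` Vs k.+1)).
Proof.
have finF1 A : F1 A -> fin A /\ A `<=` [set x : R | x != a].
  move=> [[fA _ _ _] [[hA _] _]]; split=> // x Ax /=; apply/eqP; exact: hA.
have finF1' A : F1 A -> fin A /\ A `<=` [set x : R | x != a /\ x != b].
  move=> [[fA _ _ _] [[hA hA'] _]]; split=> // x Ax /=.
  by split; apply/eqP; [exact: hA|exact: hA'].
have finV A : Vs k.+1 A -> fin A /\ A `<=` [set x : R | x != a].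
  move=> [[fA _ _ _] hA]; split=> // x Ax /=; apply/eqP; exact: hA.
(* A set of [F1] has a point in (a, b) and so is not in [F0]; the relative part comes from [Gs]
   alone. *)
have GF1 A : ((F0 `|` Gs) `&` F1) A -> some_avoid k A.
  move=> [[[_ hA]|[_ [hA _]]] [_ [_ [x Ax /andP[ax xb]]]]] //.
  by case: (hA x Ax); rewrite /= !ltW.
have keep1 u A : 0 <= u <= 1 -> F1 A -> F1 ((lh rho' u : rl -> rl) @` A).
  move=> u01 [bA [[h1 h2] [y Ay /andP[ay yb]]]]; split.
    apply: base_lh => //; first exact: rho'_range.
      by rewrite /rho' a0.
    by rewrite /rho' !ltNge !ltW.
  have lo x : x < a -> (1 - u) * x + u * rho' x < a.
    by move=> xa; apply: seg_lt => //; rewrite /rho' xa.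
  have mi x : a < x < b -> a < (1 - u) * x + u * rho' x < b.
    move=> /andP[ax xb]; have -> : rho' x = mid by rewrite /rho' xb ltNge (ltW ax).
    by rewrite seg_gt ?seg_lt ?mid_a ?mid_b.
  have hi x : b < x -> b < (1 - u) * x + u * rho' x.
    move=> bx; have ax : a <= x by move: ab bx; lra.
    have -> : rho' x = N%:R by rewrite /rho' !ltNge ax (ltW bx).
    exact: seg_gt.
  have tri x : A x -> [\/ x < a, a < x < b | b < x].
    move=> Ax; have /eqP := h1 x Ax; have /eqP := h2 x Ax.
    rewrite !neq_lt -/a -/b => /orP[xb|bx] /orP[xa|ax].
    - by constructor 1.
    - by constructor 2; rewrite ax.
    - by constructor 1.
    - by constructor 3.
  have ab' : a < b by rewrite ab; lra.
  split; first split.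
  - apply: pt_avoid_image => x /tri[/lo h|/mi/andP[h _]|/hi h]; apply/eqP.
    + by rewrite lt_eqF.
    + by rewrite gt_eqF.
    + by rewrite gt_eqF // (lt_trans ab').
  - apply: pt_avoid_image => x /tri[/lo h|/mi/andP[_ h]|/hi h]; apply/eqP.
    + by rewrite lt_eqF // (lt_trans h).
    + by rewrite lt_eqF.
    + by rewrite gt_eqF.
  - by exists (lh rho' u y); [exists y|apply: mi; rewrite ay].
have keep2 u A : 0 <= u <= 1 -> Vs k.+1 A -> Vs k.+1 ((lh rho u : rl -> rl) @` A).
  move=> u01 [bA hA]; split.
    apply: base_lh => //; [exact: rho_range|exact: rho_lt|].
    by apply: rho_ge; exact: ltW.
  apply: pt_avoid_image => x /hA /eqP; rewrite neq_lt => /orP[xa|ax]; apply/eqP.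
    by rewrite lt_eqF // seg_lt // rho_lt.
  by rewrite gt_eqF // seg_gt // rho_ge // ltW.
pose f (A : HR) : HR := (rho : rl -> rl) @` A.
pose g (A : HR) : HR := (rho : rl -> rl) @` A `|` [set (mid : rl)].
pose H (u : R) (A : HR) : HR := (lh rho' u : rl -> rl) @` A.
pose K (u : R) (A : HR) : HR := (lh rho u : rl -> rl) @` A.
apply: (@homology_iso_hequiv R HR HR j _ _ _ _ f g H K).
- by split=> // A [].
- by split=> // A [].
- exact: (fcont_image0 (@rline_mono R) (@rline_refl R) (rho_cont (fun x h => h)) finF1).
- exact: (fcont_image _ (@rline_mono R) (@rline_refl R) (rho_cont (fun x h => h)) finV).
- by split=> // A [bA _]; exact: rho_image_V.
- split=> // A GA; have [_ [bA _]] := GA; split; last exact: rho_image_V.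
  split; first by have [] := rho_image_V bA.
  by apply: rho_some_avoid => //; exact: GF1.
- by split=> // A [bA _]; exact: add_mid_F1.
- split=> // A [[_ [i hi hA]] [bA _]].
  have FA := add_mid_F1 bA; split=> //; right.
  have [bA' [[_ h2] _]] := FA; split=> //; split=> //.
  have [i' hi' hA'] := rho_some_avoid bA (ex_intro2 _ _ i hi hA).
  exists i' => // x [/hA' //|->] e; move: mid_a; rewrite [mid]e ltNge ka.
  have ik : i'%:R <= k%:R :> R by rewrite ler_nat; case/andP: hi'.
  by rewrite (le_trans ik) // lerDl.
- apply: hcont_lh_image finF1'; apply: rho'_cont => x [] //.
- apply: hcont_lh_image finV; exact: rho_cont.
- by move=> u u01; split=> // A; exact: keep1.
- move=> u u01; split=> // A GA; have [_ FA] := GA; have FA' := keep1 u A u01 FA.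
  split=> //; right; have [bA' [[_ h2] _]] := FA'; split=> //; split=> //.
  apply: keep_some_avoid (GF1 _ GA) => // x kx.
    by rewrite /rho' ifT //; move: ka; lra.
  rewrite /rho'; case: ifP => // _; case: ifP => _; move: mid_a aN ka; lra.
- by move=> u u01; split=> // A; exact: keep2.
- move=> u u01; split=> // A [[_ sA] VA]; have VA' := keep2 u A u01 VA.
  split=> //; split; first by case: VA'.
  apply: keep_some_avoid sA => // x kx.
    by rewrite rho_lt //; move: ka; lra.
  by rewrite /rho; case: ifP => // _; move: aN ka; lra.
- by move=> A _; rewrite /H lh0.
- move=> A [bA [[h1 h2] [y Ay /andP[ay yb]]]]; have [_ _ _ AN] := bA.
  rewrite /H lh1 /g /f rho_rho; apply/seteqP; split=> [_ [x Ax <-]|x [[z Az <-]|->]].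
  + rewrite /rho'; case: ifP => xa; first by left; exists x => //; exact: rho_lt.
    case: ifP => _; first by right.
    by left; exists (N%:R : R) => //; apply: rho_ge; exact: ltW.
  + rewrite /rho; case: ifP => za; first by exists z => //; rewrite /rho' za.
    by exists (N%:R : R) => //; rewrite /rho' !ltNge !ltW.
  + by exists y => //; rewrite /rho' yb ltNge (ltW ay).
- by move=> A _; rewrite /K lh0.
- move=> A [bA hA]; have [_ _ _ AN] := bA; rewrite /K lh1 /g /f.
  rewrite image_setU rho_rho; apply/seteqP; split=> [x h|x [//|[_ -> <-]]]; first by left.
  by exists (N%:R : R) => //; rewrite !rho_ge // ltW // mid_a.
Qed.

(** As H(V_{k+2}, F0 ∪ Gs) vanishes, the boundary map lowers the index by one and leads to the pair
    of X_{k+1} ∩ V_{k+2} and F0 ∪ Gs. Excision reduces it to [F1], and [F1_equiv] to the previous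
    pair. *)
Lemma Vs_XV_step : (forall j, homology_Z j (htr (Vs k.+1)) (htr (Xs k `&` Vs k.+1)) (j == k.+1)) ->
  forall j, homology_Z j (htr (Vs k.+2)) (htr (Xs k.+1 `&` Vs k.+2)) (j == k.+2).
Proof.
move=> IH j.
have GFX : F0 `|` Gs `<=` Xs k.+1 `&` Vs k.+2 by rewrite XV_E; left.
have tGF : triv (htr (Vs k.+2)) (htr (F0 `|` Gs)).
  apply: (@triv_sub R HR (htr F0)); [by split; [|left]| |exact: GF_F0|exact: Vs_F0].
  by split=> // A /GFX[].
case: j => [|j].
  by apply: triple_bd0 tGF; split.
have h1 := @triple_bdry R HR (htr (F0 `|` Gs)) (htr (Xs k.+1 `&` Vs k.+2)) (htr (Vs k.+2)) j.
apply/(homology_Z_iso _ (h1 _ _ tGF)); [by split|by split=> // A []|].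
rewrite XV_E; apply/(homology_Z_iso _ (base_excision base_fin j hopen_GF hopen_F1 GF_E erefl)).
by apply/(homology_Z_iso _ (F1_equiv j)); rewrite eqSS; exact: IH.
Qed.

End Step.
End Interval.

Section IntervalHomology.
Variables (R : realType) (N : nat).
Notation HR := (hyper (rline R)).
Notation htr Y := (@car R HR Y).
Local Notation rl := (rline R).
Implicit Type (A : set rl).
Notation base := (base (R := R) N).
Notation Xs := (Xs (R := R) N).
Notation Vs := (Vs (R := R) N).

Lemma Xs0 : Xs 0 = set0.
Proof.
by apply/seteqP; split=> // A [_ [i /= /andP[h1 h2] _]]; move: (leq_trans h1 h2).
Qed.

(** For k = 0 the space X_0 is empty and V_1 acyclic, so the class of the empty simplex in index 0
    is the boundary of one in index 1. *)
Lemma Vs_XV k : (k.+1 < N)%N ->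
  forall j, homology_Z j (htr (Vs k.+1)) (htr (Xs k `&` Vs k.+1)) (j == k.+1).
Proof.
elim: k => [|k IH] kN; last by apply: Vs_XV_step => //; apply: IH; exact: ltnW.
have tV : triv (htr (Vs 1)) (zero_car HR) by apply: Vs_acyclic; rewrite kN.
rewrite Xs0 set0I => -[|j].
  by apply: (triple_bd0 _ tV); exact: subcar_red.
have h := @triple_bdry R HR (zero_car HR) (htr set0) (htr (Vs 1)) j.
apply/(homology_Z_iso _ (h _ _ tV)); [exact: subcar_red|by split|].
by rewrite eqSS; exact: homology_Z_empty.
Qed.

Lemma Xs_sub k : Xs k `<=` Xs k.+1.
Proof.
move=> A [bA [i /= /andP[h1 h2] hA]]; split=> //; exists i => //=.
by rewrite h1 ltnW.
Qed.

Lemma XsU k : Xs k.+1 = Xs k `|` Vs k.+1.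
Proof.
apply/seteqP; split=> [A [bA [i /= /andP[h1 h2] hA]]|A [/Xs_sub //|[bA hA]]].
  have [e|ni] := eqVneq i k.+1; first by right; split=> //; rewrite -e.
  by left; split=> //; exists i => //=; rewrite h1 -ltnS ltn_neqAle ni.
by split=> //; exists k.+1 => /=.
Qed.

Lemma Xs_excision k j : homology_iso j (htr (Vs k.+1)) (htr (Xs k `&` Vs k.+1)) j
  (htr (Xs k.+1)) (htr (Xs k)).
Proof.
rewrite XsU; exact: (base_excision (@base_fin R N) j (@hopen_some_avoid R k)
  (@hopen_pt_avoid R k.+1) erefl erefl).
Qed.

(** The slope 1/(2N) brings all of [k, N] below the mark k + 1; the minimum with x fixes the points
    up to k. *)
Definition press (k : nat) (x : R) : R := Num.min x (k%:R + (x - k%:R) / (2 * N%:R)).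

(* Up to homotopy inside [Xs k.+1], the inclusion of [Xs k] factors through the acyclic
   [Vs k.+1]: compress [k, N] into [k, k + 1/2] and add the end point [N]. *)
Lemma Xs_null k : (k.+1 < N)%N -> forall j (c : {freeg (simplex HR j) / int}),
  rel_cycle (htr (Xs k)) (zero_car HR) c -> rel_boundary (htr (Xs k.+1)) (zero_car HR) c.
Proof.
move=> kN j c [hX hc].
have kN' : k.+1%:R < N%:R :> R by rewrite ltr_nat.
have N0 : 0 < N%:R :> R by apply: le_lt_trans kN'.
have pid x : x <= k%:R -> press k x = x.
  move=> xk; apply/min_idPl; rewrite -subr_ge0.
  have -> : k%:R + (x - k%:R) / (2 * N%:R) - x = (k%:R - x) * (1 - (2 * N%:R)^-1) by ring.
  rewrite mulr_ge0 ?subr_ge0 // invf_le1 ?mulr_gt0 //.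
  by move: kN'; rewrite -[k.+1%:R]natr1; have : 0 <= k%:R :> R by []; lra.
have pgt x : k%:R < x -> k%:R < press k x.
  by move=> kx; rewrite lt_min kx ltrDl divr_gt0 ?subr_gt0 ?mulr_gt0.
have ple x : press k x <= x by rewrite ge_min lexx.
have plt x : x <= N%:R -> press k x < k.+1%:R.
  move=> xN; apply: (@le_lt_trans _ _ (k%:R + (x - k%:R) / (2 * N%:R))).
    by rewrite ge_min lexx orbT.
  rewrite -[k.+1%:R]natr1 ltrD2l ltr_pdivrMr ?mulr_gt0 // mul1r.
  by have : 0 <= k%:R :> R by []; lra.
have pc (D : set rl) : fcont D (press k : rl -> rl).
  apply: (@fcont_min R D (fun x => x) (fun x => k%:R + ((x : R) - k%:R) / (2 * N%:R))).
    exact: fcont_id.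
  have := @fcont_affine R D (2 * N%:R)^-1 (k%:R - k%:R / (2 * N%:R)).
  rewrite (_ : (fun x : rl => _) = (fun x : rl => k%:R + ((x : R) - k%:R) / (2 * N%:R) : R)) //.
  by apply/funext => x; ring.
pose H (u : R) (A : HR) : HR := (lh (press k) u : rl -> rl) @` A `|` [set (N%:R : R)].
have Hb u A : 0 <= u <= 1 -> base A -> base (H u A).
  move=> u01 [fA A01 A0 AN]; split.
  - by apply: fin_setU; [exact: fin_image|exact: fin_set1].
  - move=> x [[y Ay <-]|->]; last by rewrite lexx ler0n.
    have /andP[y0 yN] := A01 y Ay; rewrite /lh.
    have py0 : 0 <= press k y.
      have [yk|ky] := leP y k%:R; first by rewrite pid.
      by apply: ltW; apply: le_lt_trans (pgt _ ky).
    by rewrite seg_ge // seg_le // (le_trans (ple _)).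
  - by left; exists (0 : R) => //; rewrite /lh pid //; lra.
  - by right.
have H1 A : Xs k A -> Vs k.+1 (H 1 A).
  move=> [bA _]; split; first by apply: Hb => //; rewrite ler01 lexx.
  rewrite /H lh1; move=> x [[y Ay <-]|->] /= e.
    have [_ A01 _ _] := bA; have /andP[_ /plt] := A01 y Ay.
    by rewrite e ltxx.
  by move: kN'; rewrite e ltxx.
have HX u A : 0 <= u <= 1 -> Xs k A -> Xs k.+1 (H u A).
  move=> u01 [bA [i /= /andP[i1 ik] hA]]; split; first exact: Hb.
  exists i => /=; first by rewrite i1 ltnW.
  have ik' : i%:R <= k%:R :> R by rewrite ler_nat.
  move=> x [[y Ay <-]|->] /= e; last first.
    by move: ik' kN'; rewrite -[k.+1%:R]natr1 -e; lra.
  have [yk|ky] := leP (y : R) k%:R.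
    by apply: (hA y Ay); rewrite /= -e /lh pid // -mulrDl subrK mul1r.
  have : k%:R < lh (press k) u y by apply: seg_gt => //; exact: pgt.
  by rewrite e ltNge ik'.
have hcH : hcont (T := HR) (T' := HR) (Xs k) H.
  apply: (hcont_image _ (@rline_mono R) (@rline_refl R) (hcont_lh (pc setT))).
  by move=> A [[fA _ _ _] _]; split.
have hcr : hcont (T := HR) (T' := HR) set0 H by [].
have m1 u : 0 <= u <= 1 -> maps (htr (Xs k)) (htr (Xs k.+1)) (H u).
  by move=> u01; split=> // A; exact: HX.
have m2 u : 0 <= u <= 1 -> maps (zero_car HR) (zero_car HR) (H u) by [].
have [d [e [hd he cE]]] :=
  @homotopy_chain R HR HR H (htr (Xs k)) (htr (Xs k.+1)) (zero_car HR) (zero_car HR) j c hcH hcr m1 m2 hX hc.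
(* At time 0 the homotopy only adds the end point N, which every set already contains. *)
have c0 : image_chain (H 0) c = image_chain (fun A : HR => A `|` [set (N%:R : R)] : HR) c.
  by apply: (eq_image_chain (X := htr (Xs k))) hX => A _; rewrite /H lh0.
have cid : image_chain (H 0) c = c.
  rewrite c0; apply: (image_chain_id (X := htr (Xs k))) hX => A [[_ _ _ AN] _].
  by apply/seteqP; split=> [x [//|->//]|x]; left.
have c1 : c = image_chain (H 1) c - (bdry d + e) by rewrite -cE cid subKr.
rewrite c1; apply: rel_boundaryB; last by apply: rel_boundaryD; [exact: rel_boundary_bdry|exact: rel_boundary_Ch].
have fc1 : fcont (T := HR) (T' := HR) (Xs k) (H 1).
  apply: fcont_hcont => u A _ XA e' e'0.
  have [|d' d'0 hd'] := hcH 1 A _ XA e' e'0; first by rewrite ler01 lexx.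
  exists d' => // u' A' _ XA' _; apply: hd' => //; first by rewrite ler01 lexx.
  by rewrite subrr normr0.
have [||d' [e' [hd' he' ->]]] := @Vs_acyclic R N k.+1 _ j (image_chain (H 1) c).
- by rewrite kN.
- split; first by apply: Ch_image_chain hX => //; split=> // A; exact: H1.
  by apply: cyc_image_chain hc.
exists d', e'; split=> //; apply: Ch_sub hd'; split=> // A.
by rewrite /= XsU; right.
Qed.

Lemma Xs_homology k : (k < N)%N -> forall j, homology_Z j (htr (Xs k)) (zero_car HR) (~~ odd k && (j == k)).
Proof.
elim: k => [|k IH] kN j; first by rewrite Xs0; exact: homology_Z_empty.
have {}IH := IH (ltnW kN).
have hrel i : homology_Z i (htr (Xs k.+1)) (htr (Xs k)) (i == k.+1).
  by apply/(homology_Z_iso _ (Xs_excision k i)); exact: Vs_XV.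
have s1 : subcar (zero_car HR) (htr (Xs k)) by exact: subcar_red.
have s2 : subcar (htr (Xs k)) (htr (Xs k.+1)) by split=> //; exact: Xs_sub.
rewrite /= negbK; have [ok|ek] := boolP (odd k).
  have tX : triv (htr (Xs k)) (zero_car HR) by apply/trivP => i; have := IH i; rewrite ok.
  by apply/(homology_Z_iso _ (triple_sub j s1 s2 tX)); exact: hrel.
apply/homology_ZF; apply: (null_triple s1 s2 (n := k)) => //.
  by move=> i; have := IH i; rewrite (negbTE ek).
exact: Xs_null.
Qed.

End IntervalHomology.

(** * Bounding the cardinality *)

Section Comparison.
Variables (R : realType) (K : nat).
Hypothesis K0 : (0 < K)%N.
Notation HR := (hyper (rline R)).
Notation htr Y := (@car R HR Y).
Local Notation rl := (rline R).
Implicit Type (A : set rl).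
Notation base := (base (R := R) K.+1).
Notation Xs := (Xs (R := R) K.+1).

Definition pts_of (S : set nat) : set rl := [set x | exists2 i, S i & (x : R) = i%:R].

Definition inK (S : set nat) := forall i, S i -> (0 < i <= K)%N.

Lemma fin_pts_of S : inK S -> fin (pts_of S).
Proof.
move=> hS; have [h|/set0P/negP/negPn/eqP ->] := pselect (pts_of S !=set0); last first.
  exists 0%N, (fun=> 0 : R); apply/seteqP; split=> // x [[]] //.
exists K.+1; apply: (cardle_sub (A := range (fun i : 'I_K.+1 => i%:R : rl))) h _; last first.
  by exists (fun i : 'I_K.+1 => i%:R : rl).
move=> x [i /hS /andP[_ iK] ->]; exists (Ordinal (iK : (i < K.+1)%N)) => //.
Qed.

Lemma popen_fin (F : set rl) : fin F -> popen (~` F).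
Proof.
move=> fF x xF; have [||d d0 hd] := @fin_min _ _ F (fun f d => forall b : rl, nearby x d b -> b <> f) fF.
- move=> a d d' _ dd' h b xb; apply: h; exact: (rline_mono dd' xb).
- move=> a Fa; have /popen_neq : (~` [set (a : R)]) x by move=> xa; apply: xF; rewrite xa.
  by move=> [e e0 he]; exists e.
by exists d => // b /hd h Fb; exact: (h b Fb).
Qed.

Lemma hopen_pts S : inK S -> hopen (avoid (pts_of S)).
Proof.
by move=> hS; apply: hopen_avoid; [exact: rline_mono|apply: popen_fin; exact: fin_pts_of].
Qed.

Section Centers.
Variable S : set nat.
Hypothesis SK : inK S.
Hypothesis S0 : S !=set0.

(** The value 0 encodes that no mark of S lies below x; since marks are positive, there is no
    clash. *)
Definition last_below (x : R) : nat := \max_(i < K.+1 | `[< S i >] && (i%:R < x)) i.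

Lemma last_belowP x : last_below x = 0%N \/ (S (last_below x) /\ (last_below x)%:R < x).
Proof.
rewrite /last_below; elim/big_ind: _ => [|m n hm hn|i /andP[/asboolP Si ix]].
- by left.
- by rewrite /maxn; case: ifP.
- by right.
Qed.

Lemma last_below_ge x i : S i -> i%:R < x -> (i <= last_below x)%N.
Proof.
move=> Si ix; have /andP[_ iK] := SK Si.
apply: (leq_bigmax_cond (Ordinal (iK : (i < K.+1)%N))).
by rewrite /= ix andbT; exact/asboolP.
Qed.

(* The arcs of [0, K+1] cut at S are contracted to 0, to K+1, or to an inner point. *)
Definition center (x : R) : R :=
  if `[< exists2 i, S i & x <= i%:R >] then
    (if last_below x == 0%N then 0 else (last_below x)%:R + 2^-1)
  else K.+1%:R.

Lemma center_gt x i : S i -> i%:R < x -> i%:R < center x.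
Proof.
move=> Si ix; have /andP[i0 iK] := SK Si; rewrite /center; case: asboolP => _; last first.
  by rewrite ltr_nat.
have h := last_below_ge Si ix.
rewrite ifF; last by apply/negbTE; rewrite -lt0n (leq_trans i0).
have : i%:R <= (last_below x)%:R :> R by rewrite ler_nat.
lra.
Qed.

Lemma center_lt x i : S i -> x < i%:R -> center x < i%:R.
Proof.
move=> Si xi; have /andP[i0 iK] := SK Si; rewrite /center ifT; last first.
  by apply/asboolP; exists i => //; exact: ltW.
have [->|[Sl lx]] := last_belowP x; first by rewrite eqxx ltr0n.
case: ifP => _; first by rewrite ltr0n.
have : (last_below x)%:R + 1 <= i%:R :> R.
  by rewrite natr1 ler_nat -(ltr_nat R) (lt_trans lx).
lra.
Qed.

Lemma center0 : center 0 = 0.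
Proof.
have [i Si] := S0; rewrite /center ifT; last by apply/asboolP; exists i.
have [->|[_]] := last_belowP 0; first by rewrite eqxx.
by rewrite ltNge ler0n.
Qed.

Lemma centerN : center K.+1%:R = K.+1%:R.
Proof.
rewrite /center ifF //; apply/asboolP => -[i /SK/andP[_ iK]].
by rewrite ler_nat leqNgt ltnS iK.
Qed.

(** At most K + 1 values contain all centres. A mark followed by another one is less than K, so the
    index K is free to encode the last arc, which goes to K + 1. *)
Definition center_values (j : 'I_K.+1) : rl :=
  if j == 0%N :> nat then 0 : R else if j == K :> nat then K.+1%:R : R else (j%:R + 2^-1 : R).

Lemma center_in x : exists j, center x = center_values j.
Proof.
rewrite /center; case: asboolP => [[i Si xi]|_]; last first.
  by exists ord_max; rewrite /center_values /= -(prednK K0) /= eqxx.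
have [->|[Sl lx]] := last_belowP x; first by exists ord0; rewrite eqxx.
have /andP[i0 iK] := SK Si; have /andP[l0 lK] := SK Sl.
have li : (last_below x < i)%N by rewrite -(ltr_nat R) (lt_le_trans lx).
exists (Ordinal (lK : (last_below x < K.+1)%N)); rewrite /center_values /=.
by rewrite (gtn_eqF l0) (ltn_eqF (leq_trans li iK)).
Qed.

Lemma center_range x : 0 <= center x <= K.+1%:R.
Proof.
have [j ->] := center_in x; rewrite /center_values.
have jK : j%:R <= K%:R :> R by rewrite ler_nat -ltnS.
have j0 : 0 <= j%:R :> R by [].
have k1 : 0 <= K.+1%:R :> R by [].
case: ifP => _; first by rewrite lexx.
case: ifP => _; first by rewrite lexx k1.
by rewrite -[K.+1%:R]natr1; apply/andP; split; lra.
Qed.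

(** Off S the position of a point relative to each mark is locally constant, hence so is its
    centre. *)
Lemma center_cont : fcont (~` pts_of S) (center : rl -> rl).
Proof.
move=> x xS e e0.
have [||d d0 hd] := @fin_min _ _ (pts_of S) (fun f d => forall b : rl, nearby x d b ->
    ((f : R) < b) = ((f : R) < x)) (fin_pts_of SK).
- move=> a d d' _ dd' h b xb; apply: h; exact: (rline_mono dd' xb).
- move=> f Sf; have /eqP : (f : R) <> x by move=> fx; apply: xS; rewrite -fx.
  rewrite neq_lt => /orP[fx|xf].
    exists (x - f); first by rewrite subr_gt0.
    move=> b; rewrite /nearby /= ltr_distl => /andP[h _]; rewrite fx.
    by move: h; rewrite opprB addrCA subrr addr0 => ->.
  exists (f - x); first by rewrite subr_gt0.
  move=> b; rewrite /nearby /= ltr_distl => /andP[_ h]; rewrite (ltNge f x) (ltW xf) /=.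
  by apply/negbTE; rewrite -leNgt ltW //; move: h; rewrite addrC subrK.
exists d => // y _ xy; rewrite (_ : center y = center x); first exact: rline_refl.
have same i : S i -> (i%:R < (y : R)) = (i%:R < (x : R)).
  by move=> Si; apply: hd => //; exists i.
have lb : last_below y = last_below x.
  apply: eq_bigl => i; case: asboolP => //= Si; exact: same.
rewrite /center lb (_ : `[< _ >] = `[< exists2 i, S i & x <= i%:R >]) //.
apply/asboolP/asboolP => -[i Si]; rewrite leNgt => h; exists i => //; rewrite leNgt.
  by rewrite -same.
by rewrite same.
Qed.

Lemma center_avoid u A : 0 <= u <= 1 -> avoid (pts_of S) A ->
  avoid (pts_of S) ((lh center u : rl -> rl) @` A).
Proof.
move=> u01 hA _ [x Ax <-] [i Si] /eqP; apply/negP.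
have /eqP : (x : R) <> i%:R by move=> e; apply: (hA x Ax); exists i.
rewrite neq_lt => /orP[xi|ix].
  by rewrite lt_eqF // seg_lt // center_lt.
by rewrite gt_eqF // seg_gt // center_gt.
Qed.

Lemma center_cardle A : A !=set0 -> cardle K.+1 ((center : rl -> rl) @` A).
Proof.
move=> [x0 Ax0]; apply: (@cardle_sub R rl K.+1 (range center_values)).
- by move=> _ [x _ <-]; have [j ->] := center_in x; exists j.
- by exists (center x0), x0.
- by exists center_values.
Qed.

(** After the contraction only centres remain, at most K + 1 of them, and on the way no set gains
    points. S is nonempty so that 0 lies on an arc contracted to 0. *)
Lemma avoid_cardle_triv :
  triv (htr (base `&` avoid (pts_of S))) (htr ((base `&` cardle K.+1) `&` avoid (pts_of S))).
Proof.
have keep u A : 0 <= u <= 1 -> base A -> base ((lh center u : rl -> rl) @` A).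
  move=> u01; apply: base_lh => //; [by move=> x _; exact: center_range|exact: center0|].
  exact: centerN.
apply: (@deformR R _ _ (~` pts_of S) center).
- by move=> A [[]].
- by move=> A [[fA _ _ _] hA].
- exact: center_cont.
- by move=> u A u01 [bA hA]; split; [exact: keep|exact: center_avoid].
- move=> u A u01 [[bA cA] hA]; split; last exact: center_avoid.
  by split; [exact: keep|exact: cardle_image].
- move=> A [bA hA]; rewrite -(lh1 (center : rl -> rl)).
  have h01 : 0 <= (1 : R) <= 1 by rewrite ler01 lexx.
  split; last exact: center_avoid.
  split; first exact: keep.
  by rewrite lh1; apply: center_cardle; have [_ _ A0 _] := bA; exists (0 : R).
Qed.

End Centers.

(** The additional missed marks S make the induction close: X_{k+1} is covered by X_k and the sets
    that miss k + 1, and in their intersection k + 1 has joined S. *)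
Lemma Xs_avoid_triv k S : (k <= K)%N -> (forall i, S i -> (k < i <= K)%N) ->
  triv (htr (Xs k `&` avoid (pts_of S)))
    (htr ((base `&` cardle K.+1) `&` (some_avoid (R := R) k `&` avoid (pts_of S)))).
Proof.
elim: k S => [|k IH] S kK hS.
  have e : some_avoid (R := R) 0 = set0.
    by apply/seteqP; split=> // A [i /= /andP[h1 h2] _]; move: (leq_trans h1 h2).
  rewrite Xs0 e !set0I setI0; exact: triv_refl.
pose S' := S `|` [set k.+1].
have hS' i : S' i -> (k < i <= K)%N.
  by move=> [/hS/andP[h1 h2]|->]; rewrite ?ltnSn ?kK // h2 andbT ltnW.
have SK : inK S by move=> i /hS/andP[h1 h2]; rewrite h2 andbT (leq_trans _ h1).
have SK' : inK S' by move=> i /hS'/andP[h1 h2]; rewrite h2 andbT (leq_trans _ h1).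
have S'E A : avoid (pts_of S') A <-> avoid (pts_of S) A /\ pt_avoid (R := R) k.+1 A.
  split=> [h|[h1 h2] x Ax [i [Si|->] xi]].
  - split=> x Ax; last by move=> xk; apply: (h x Ax); exists k.+1 => //; right.
    by move=> [i Si xi]; apply: (h x Ax); exists i => //; left.
  - by apply: (h1 x Ax); exists i.
  - exact: (h2 x Ax).
have saE : some_avoid (R := R) k.+1 `&` avoid (pts_of S) =
    (some_avoid (R := R) k `&` avoid (pts_of S)) `|` avoid (pts_of S').
  apply/seteqP; split=> [A [[i /= /andP[i1 ik] hi] hA]|A [[[i /= /andP[i1 ik] hi] hA]|/S'E[hA hk]]].
  - have [e|ni] := eqVneq i k.+1; first by right; apply/S'E; rewrite -e.
    by left; split=> //; exists i => //=; rewrite i1 -ltnS ltn_neqAle ni.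
  - by split=> //; exists i => //=; rewrite i1 ltnW.
  - by split=> //; exists k.+1 => /=.
have saI : (some_avoid (R := R) k `&` avoid (pts_of S)) `&` avoid (pts_of S') =
    some_avoid (R := R) k `&` avoid (pts_of S').
  apply/seteqP; split=> [A [[h1 _] h2] //|A [h1 h2]]; split=> //; split=> //.
  by have /S'E[] := h2.
have e1 : Xs k.+1 `&` avoid (pts_of S) =
    (base `&` (some_avoid k `&` avoid (pts_of S))) `|` (base `&` avoid (pts_of S')).
  by rewrite /Xs -setIA saE setIUr.
rewrite e1 saE (setIUr (base `&` cardle K.+1)).
have o1 : hopen (some_avoid (R := R) k `&` avoid (pts_of S)).
  by apply: hopenI; [exact: rline_mono|exact: hopen_some_avoid|exact: hopen_pts].
have o2 : hopen (avoid (pts_of S')) by exact: hopen_pts.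
have bcf A : (base `&` cardle K.+1) A -> fin A by case=> _; exact: cardle_fin.
apply: mayer_vietoris_triv.
- by move=> A [[]].
- by move=> A [[]].
- by apply: hopen_openin o1 _ (@base_fin R K.+1) erefl => A [] [].
- by apply: hopen_openin o2 _ (@base_fin R K.+1) erefl => A [] [].
- by apply: hopen_openin o1 _ bcf erefl => A [] [].
- by apply: hopen_openin o2 _ bcf erefl => A [] [].
- have := IH S (ltnW kK); rewrite /Xs -setIA; apply.
  by move=> i /hS/andP[h1 h2]; rewrite h2 andbT ltnW.
- by apply: avoid_cardle_triv => //; exists k.+1; right.
- rewrite -!setIIr saI; have := IH S' (ltnW kK) hS'; rewrite /Xs -setIA; exact.
Qed.

(** Pigeonhole: a set containing all of 0, ..., K + 1 has at least K + 2 points. *)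
Lemma cardle_some_avoid A : cardle K.+1 A -> A (0 : R) -> A (K.+1%:R : R) ->
  some_avoid K A.
Proof.
move=> [x ->] h0 hK; apply: contrapT => hn.
have hA i : (i < K.+2)%N -> range x (i%:R : R).
  move=> iK; have [->|i0] := posnP i; first by [].
  have [->|iK'] := eqVneq i K.+1; first by [].
  apply: contrapT => hi; apply: hn; exists i; last exact: notin_avoid.
  by rewrite /= i0 -ltnS ltn_neqAle iK'.
have /choice[f hf] : forall i : 'I_K.+2, exists j : 'I_K.+1, x j = (i%:R : R).
  by move=> i; have [j _ ej] := hA i (ltn_ord i); exists j.
have inj : injective f.
  move=> i j fij; apply/val_inj/eqP; rewrite -(eqr_nat R); apply/eqP.
  have := hf i; rewrite fij hf; exact: esym.
by have := leq_card f inj; rewrite !card_ord ltnn.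
Qed.

Definition Ends m : set (set rl) := base `&` cardle m.

Lemma Ends_homology j : homology_Z j (htr (Ends K.+1)) (zero_car HR) (~~ odd K && (j == K)).
Proof.
have eX : Xs K `&` avoid (pts_of set0) = Xs K.
  by apply/seteqP; split=> [A []//|A XA]; split=> // x _ [].
have eE : (base `&` cardle K.+1) `&` (some_avoid (R := R) K `&` avoid (pts_of set0)) = Ends K.+1.
  apply/seteqP; split=> [A []//|A EA]; split=> //; split; last by move=> x _ [].
  by have [[_ _ A0 AK] cA] := EA; exact: cardle_some_avoid.
have := @Xs_avoid_triv K set0 (leqnn _); rewrite eX eE => /(_ _) t.
have EX : subcar (htr (Ends K.+1)) (htr (Xs K)).
  split=> // A [bA cA]; split=> //.
  by have [_ _ A0 AK] := bA; exact: cardle_some_avoid.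
have tX : triv (htr (Xs K)) (htr (Ends K.+1)) by exact: t.
apply/(homology_Z_iso _ (triple_incl j (subcar_red _) EX tX)).
exact: Xs_homology.
Qed.

End Comparison.

Lemma homology_iso_homeo (R : realType) (T T' : nspace R) k (X Y : carrier T) (X' Y' : carrier T')
  (f : T -> T') (g : T' -> T) :
  subcar Y X -> subcar Y' X' ->
  fcont X.2 f -> fcont X'.2 g -> maps X X' f -> maps Y Y' f -> maps X' X g -> maps Y' Y g ->
  (forall a, X.2 a -> g (f a) = a) -> (forall a, X'.2 a -> f (g a) = a) ->
  homology_iso k X Y k X' Y'.
Proof.
move=> YX YX' cf cg f1 f2 g1 g2 gf fg.
apply: (@homology_iso_hequiv R T T' k X Y X' Y' f g (fun _ a => a) (fun _ a => a)) => //.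
- by move=> u a _ _ e e0; exists e.
- by move=> u a _ _ e e0; exists e.
- by move=> a /gf ->.
- by move=> a /fg ->.
Qed.

(** * Finite subsets of an open interval *)

Section Segment.
Variable R : realType.
Notation HR := (hyper (rline R)).
Notation htr Y := (@car R HR Y).
Local Notation rl := (rline R).
Implicit Type (A : set rl).

Definition segE (a b : R) m : set (set rl) :=
  [set A : set rl | [/\ cardle m A, forall x : R, A x -> a <= x <= b, A a & A b]].

(** Affine rescaling from [0, K+1], whose inner integers are the K marks. *)
Lemma segE_homology (a b : R) K j : a < b -> (0 < K)%N ->
  homology_Z j (htr (segE a b K.+1)) (zero_car HR) (~~ odd K && (j == K)).
Proof.
move=> ab K0.
have K1 : 0 < K.+1%:R :> R by rewrite ltr0n.
pose s := (b - a) / K.+1%:R; have s0 : 0 < s by rewrite divr_gt0 ?subr_gt0.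
pose f (x : R) : R := s * x + a; pose g (x : R) : R := s^-1 * x + - (s^-1 * a).
have gf x : g (f x) = x by rewrite /g /f mulrDr mulKf ?gt_eqF // addrK.
have fg x : f (g x) = x.
  by rewrite /g /f mulrDr mulrN !mulrA divff ?gt_eqF // !mul1r subrK.
have fN : f K.+1%:R = b by rewrite /f /s divfK ?gt_eqF // subrK.
have f0 : f 0 = a by rewrite /f mulr0 add0r.
have fi x : (a <= f x <= b) = (0 <= x <= K.+1%:R).
  by rewrite -f0 -fN /f !lerD2r !ler_pM2l.
pose F (A : HR) : HR := (f : rl -> rl) @` A; pose G (A : HR) : HR := (g : rl -> rl) @` A.
have h := @homology_iso_homeo R HR HR j (htr (Ends K K.+1)) (zero_car HR) (htr (segE a b K.+1)) (zero_car HR) F G.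
apply/(homology_Z_iso _ (h _ _ _ _ _ _ _ _ _ _)); last exact: Ends_homology.
- exact: subcar_red.
- exact: subcar_red.
- apply: (fcont_image0 (@rline_mono R) (@rline_refl R) (@fcont_affine R setT s a)).
  by move=> A [[fA _ _ _] _].
- apply: (fcont_image0 (@rline_mono R) (@rline_refl R) (@fcont_affine R setT s^-1 (- (s^-1 * a)))).
  by move=> A [/cardle_fin].
- split=> // A [[fA A01 A0 AN] cA]; split.
  + exact: cardle_image.
  + by move=> _ [x Ax <-]; rewrite fi; exact: A01.
  + by exists (0 : R).
  + by exists (K.+1%:R : R).
- by [].
- split=> // A [cA Aab Aa Ab]; split; last exact: cardle_image.
  split.
  + by apply: fin_image; exact: cardle_fin cA.
  + by move=> _ [x Ax <-]; rewrite -fi fg; exact: Aab.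
  + by exists (a : R) => //; rewrite -f0 gf.
  + by exists (b : R) => //; rewrite -fN gf.
- by [].
- move=> A _; apply/seteqP; split=> [_ [_ [x Ax <-] <-]|x Ax]; first by rewrite gf.
  by exists (f x); rewrite ?gf //; exists x.
- move=> A _; apply/seteqP; split=> [_ [_ [x Ax <-] <-]|x Ax]; first by rewrite fg.
  by exists (g x); rewrite ?fg //; exists x.
Qed.

Lemma fcont_max D (f g : rl -> rl) : fcont D f -> fcont D g ->
  fcont D (fun x => (Num.max (f x : R) (g x : R) : R) : rl).
Proof.
move=> hf hg x Dx e e0; have [d d0 hd] := hf x Dx e e0; have [d' d'0 hd'] := hg x Dx e e0.
exists (Num.min d d') => [|y Dy]; first by rewrite lt_min d0.
rewrite /nearby /= lt_min => /andP[/(hd y Dy) + /(hd' y Dy)]; rewrite /nearby /=.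
rewrite !ltr_distl => /andP[h1 h2] /andP[h3 h4].
by apply/andP; split; rewrite /Num.max; case: ifP => h; case: ifP => h'; lra.
Qed.

Variable n : nat.
Hypothesis n1 : (1 < n)%N.

Definition inside : set (set rl) :=
  [set A : set rl | cardle n A /\ forall x : R, A x -> -1 < x < 1].
(** The thresholds fit [UN]: the first coordinate 2x^2 - 1 of [wrap x] exceeds -1/2 exactly when |x|
    > 1/2. *)
Definition lefts := inside `&` @hit R rl [set x : R | x < - 2^-1].
Definition rights := inside `&` @hit R rl [set x : R | 2^-1 < x].

Lemma popen_gt (z : R) : @popen R rl [set x : R | z < x].
Proof.
move=> x /= zx; exists (x - z); first by rewrite subr_gt0.
by move=> y; rewrite /nearby /= ltr_distl => /andP[h _]; lra.
Qed.

Lemma popen_lt (z : R) : @popen R rl [set x : R | x < z].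
Proof.
move=> x /= zx; exists (z - x); first by rewrite subr_gt0.
by move=> y; rewrite /nearby /= ltr_distl => /andP[_ h]; lra.
Qed.

Lemma inside_fin A : inside A -> fin A. Proof. by move=> [/cardle_fin]. Qed.

Lemma inside_neq0 A : inside A -> A !=set0.
Proof.
move=> [[x ->] _]; exists (x (Ordinal (ltnW n1))).
by exists (Ordinal (ltnW n1)).
Qed.

Lemma inside_lh c u A : 0 <= u <= 1 -> (forall x : R, A x -> -1 < c x < 1) ->
  inside A -> inside ((lh c u : rl -> rl) @` A).
Proof.
move=> u01 hc [cA A11]; split; first exact: cardle_image.
move=> _ [x Ax <-]; have /andP[c1 c2] := hc x Ax; have /andP[x1 x2] := A11 x Ax.
by rewrite seg_gt // seg_lt.
Qed.

(** The straight-line contraction to the one point -3/4 keeps [lefts], because its target lies below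
    -1/2 as well. *)
Lemma inside_lefts : triv (htr inside) (htr lefts).
Proof.
pose z : R := - 2^-1 - 4^-1.
have z1 : -1 < z < 1 by rewrite /z; apply/andP; split; lra.
have z2 : z < - 2^-1 by rewrite /z; lra.
apply: (@deformR R _ _ setT (fun=> z)).
- by move=> A [].
- by move=> A /inside_fin.
- exact: fcont_const.
- by move=> u A u01; apply: inside_lh.
- move=> u A u01 [iA [x Ax /= x2]]; split; first exact: inside_lh.
  by exists (lh (R := R) (fun=> z) u x); [exists x|exact: seg_lt].
- move=> A iA; split.
    by rewrite -(lh1 (R := R) (fun=> z)); apply: inside_lh => //; rewrite ler01 lexx.
  by have [x Ax] := inside_neq0 iA; exists z => //; exists x.
Qed.

Lemma rights_acyclic : triv (htr rights) (zero_car HR).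
Proof.
pose z : R := 2^-1 + 4^-1.
have z1 : -1 < z < 1 by rewrite /z; apply/andP; split; lra.
have z2 : 2^-1 < z by rewrite /z; lra.
apply: (@contractR R rights setT (fun=> z) [set (z : rl)]).
- split; last by exists z.
  split; last by move=> x ->.
  by exists (fun=> z); apply/seteqP; split=> [x ->|_ [i _ <-]] //; exists (Ordinal (ltnW n1)).
- by move=> A [/inside_fin].
- exact: fcont_const.
- move=> u A u01 [iA [x Ax /= x2]]; split; first exact: inside_lh.
  by exists (lh (R := R) (fun=> z) u x); [exists x|exact: seg_gt].
- move=> A [/inside_neq0[x Ax] _]; apply/seteqP; split=> [_ [y _ <-]|y ->] //.
  by exists x.
- move=> u _; have e : lh (R := R) (fun=> z) u z = z by rewrite /lh; ring.
  apply/seteqP; split=> [_ [y -> <-]|y ->]; first by rewrite e.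
  by exists z.
Qed.

(** Slope 3/2 takes ±1/2 to ±3/4, so after clamping every point beyond ±1/2 sits exactly on an end
    point of [-3/4, 3/4]. *)
Definition stretch (x : R) : R := Num.max (- (3 / 4)) (Num.min (3 / 2 * x) (3 / 4)).

Lemma both_ends : triv (htr (lefts `&` rights)) (htr (segE (- (3 / 4)) (3 / 4) n)).
Proof.
have r x : - (3 / 4) <= stretch x <= 3 / 4.
  by rewrite /stretch le_max lexx ge_max ge_min lexx orbT /=; lra.
have r1 x : -1 < stretch x < 1 by have /andP[h1 h2] := r x; apply/andP; split; lra.
have lo x : x < - 2^-1 -> stretch x = - (3 / 4).
  by move=> h; apply/max_idPl; rewrite ge_min; apply/orP; left; lra.
have hi x : 2^-1 < x -> stretch x = 3 / 4.
  move=> h; have e : Num.min (3 / 2 * x) (3 / 4) = 3 / 4 by apply/min_idPr; lra.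
  by rewrite /stretch e; apply/max_idPr; lra.
have Esub A : segE (- (3 / 4)) (3 / 4) n A -> (lefts `&` rights) A.
  move=> [cA A34 A1 A2].
  have iA : inside A by split=> // x /A34 /andP[h1 h2]; apply/andP; split; lra.
  split; split=> //; first by exists (- (3 / 4)) => //=; lra.
  by exists (3 / 4) => //=; lra.
apply: (@deformR R _ _ setT stretch) => //.
- by move=> A [[/inside_fin]].
- apply: (@fcont_max setT (fun=> - (3 / 4)) (fun x => Num.min (3 / 2 * (x : R)) (3 / 4))).
    exact: fcont_const.
  apply: (@fcont_min R setT (fun x => 3 / 2 * (x : R)) (fun=> 3 / 4 : R)); last exact: fcont_const.
  have := @fcont_affine R setT (3 / 2) 0.
  rewrite (_ : (fun x : rl => _) = (fun x : rl => 3 / 2 * (x : R) : R)) //.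
  by apply/funext => x; rewrite addr0.
- move=> u A u01 [[iA [x Ax /= x1]] [_ [y Ay /= y1]]].
  have iB := inside_lh u01 (fun x _ => r1 x) iA.
  split; split=> //.
    by exists (lh stretch u x); [exists x|apply: seg_lt => //; rewrite lo //; lra].
  by exists (lh stretch u y); [exists y|apply: seg_gt => //; rewrite hi //; lra].
- move=> u A u01 [cA A34 A1 A2]; split.
  + exact: cardle_image.
  + move=> _ [x Ax <-]; have /andP[h1 h2] := A34 x Ax; have /andP[h3 h4] := r x.
    by rewrite seg_ge // seg_le.
  + by exists (- (3 / 4) : R) => //; rewrite /lh lo; [ring|lra].
  + by exists (3 / 4 : R) => //; rewrite /lh hi; [ring|lra].
- move=> A [[iA [x Ax /= x1]] [_ [y Ay /= y1]]]; split.
  + by apply: (@cardle_image R rl rl stretch); case: iA.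
  + by move=> _ [z Az <-].
  + by exists x => //; exact: lo.
  + by exists y => //; exact: hi.
Qed.

(** With L and R for [lefts] and [rights], the path is H(inside, L ∪ R), H(L ∪ R, L), H(R, L ∩ R),
    H(L ∩ R): two boundary maps around an excision, lowering the index by two. *)
Lemma inside_homology j : homology_Z j (htr inside) (htr (lefts `|` rights)) (odd n && (j == n.+1)).
Proof.
have ol := hopen_hit (@popen_lt (- 2^-1)); have oR := hopen_hit (@popen_gt 2^-1).
have sub1 : lefts `|` rights `<=` inside by move=> A [] [].
have tl := inside_lefts.
have s1 : subcar (htr lefts) (htr (lefts `|` rights)) by split=> // A; left.
case: j => [|j]; first by rewrite andbF; exact: (triple_bd0 s1 tl).
apply/(homology_Z_iso _ (triple_bdry j s1 _ tl)); first by split.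
apply/(homology_Z_iso _ (base_excision inside_fin j ol oR erefl erefl)).
have s2 : subcar (zero_car HR) (htr (lefts `&` rights)) by exact: subcar_red.
have n0 : (0 < n)%N by exact: ltnW.
rewrite eqSS; case: j => [|j].
  by rewrite [0%N == n]eq_sym (gtn_eqF n0) andbF; exact: (triple_bd0 s2 rights_acyclic).
apply/(homology_Z_iso _ (triple_bdry j s2 _ rights_acyclic)); first by split=> // A [].
apply/(homology_Z_iso _ (triple_incl j (subcar_red _) _ both_ends)).
  split=> // A [cA A34 A1 A2].
  have iA : inside A by split=> // x /A34 /andP[h1 h2]; apply/andP; split; lra.
  split; split=> //; first by exists (- (3 / 4)) => //=; lra.
  by exists (3 / 4) => //=; lra.
(* At most n points correspond to K = n - 1 inner marks, whence the change of parity. *)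
have := @segE_homology (- (3 / 4)) (3 / 4) n.-1 j _ _; rewrite prednK //.
have -> : ~~ odd n.-1 = odd n by rewrite -[in RHS](prednK n0).
have -> : (j == n.-1) = (j.+1 == n) by rewrite -[in RHS](prednK n0) eqSS.
apply; first lra.
by rewrite -ltnS prednK.
Qed.

End Segment.

(** * Finite subsets of the circle *)

Section CardleMore.
Variables (R : realType) (T : nspace R).

Lemma cardle_glue (T' : nspace R) (f : T -> T') m (A : set T) a b :
  A a -> A b -> a <> b -> f a = f b -> cardle m.+1 A -> cardle m (f @` A).
Proof.
move=> Aa Ab ab fab [x Ax]; move: Aa Ab; rewrite Ax => -[i _ xi] [j _ xj].
exists (fun l => f (x (lift i l))); apply/seteqP; split=> [_ [_ [l _ <-] <-]|_ [l _ <-]].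
  have [l' ->|->] := unliftP i l; first by exists l'.
  have [j' ej|ej] := unliftP i j; last by case: ab; rewrite -xi -xj ej.
  by exists j' => //; rewrite -ej xj xi.
by exists (x (lift i l)) => //; exists (lift i l).
Qed.

End CardleMore.

Section Circle.
Variable R : realType.

Definition plane : nspace R := @NSpace R (R * R)%type
  (fun p e q => `|q.1 - p.1| < e /\ `|q.2 - p.2| < e) (0, 0).
Local Notation rl := (rline R).
Notation HP := (hyper plane).
Notation HR := (hyper rl).
Notation ptr Y := (@car R HP Y).
Notation htr Y := (@car R HR Y).
Implicit Types (A : set plane) (x y u e : R) (p : R * R).

Lemma plane_refl : near_refl plane.
Proof. by move=> a e e0; rewrite /nearby /= !subrr normr0. Qed.

Lemma plane_mono : near_mono plane.
Proof.
by move=> a b e e' ee; rewrite /nearby /= => -[h1 h2]; split; exact: lt_le_trans ee.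
Qed.

Definition oncirc : set plane := [set p : R * R | p.1 ^+ 2 + p.2 ^+ 2 = 1].
Definition star : plane := (1 : R, 0 : R).

(* In polar coordinates [wrap (cos t) = (cos 2t, sin 2t)]. *)
Definition wrap (x : R) : plane := (2 * x ^+ 2 - 1, 2 * x * Num.sqrt (1 - x ^+ 2)).
(** The half-angle formula, with the sign of the second coordinate choosing the half. The circle is
    torn at [star], which goes to 1 rather than -1. *)
Definition unwrap (p : R * R) : R :=
  if 0 <= p.2 then Num.sqrt ((1 + p.1) / 2) else - Num.sqrt ((1 + p.1) / 2).

(** The square of the difference of the roots is at most |x - y|. Unlike a Lipschitz bound, this
    holds up to 0. *)
Lemma sqrt_close x y e : 0 < e -> 0 <= x -> 0 <= y -> `|x - y| < e ^+ 2 ->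
  `|Num.sqrt x - Num.sqrt y| < e.
Proof.
move=> e0; wlog xy : x y / y <= x => [h x0 y0 d|x0 y0].
  have [yx|xy] := leP y x; first exact: h.
  by rewrite distrC; apply: h => //; [exact: ltW|rewrite distrC].
rewrite !ger0_norm ?subr_ge0 ?ler_wsqrtr // => d.
rewrite -(ltr_pXn2r (n := 2)) ?nnegrE ?subr_ge0 ?ler_wsqrtr ?(ltW e0) //.
apply: le_lt_trans d; rewrite -{2}(sqr_sqrtr x0) -{2}(sqr_sqrtr y0).
have := ler_wsqrtr xy; have := sqrtr_ge0 y; move: (Num.sqrt x) (Num.sqrt y) => a b b0 ba.
by nra.
Qed.

Lemma seg1_sqr x : -1 <= x <= 1 -> 0 <= 1 - x ^+ 2.
Proof. by move=> /andP[h1 h2]; rewrite subr_ge0; nra. Qed.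

Lemma wrap_oncirc x : -1 <= x <= 1 -> oncirc (wrap x).
Proof.
move=> /seg1_sqr h; rewrite /oncirc /= exprMn sqr_sqrtr //; ring.
Qed.

Lemma wrap1 : wrap 1 = star.
Proof. by rewrite /wrap expr1n subrr sqrtr0 !mulr0 mulr1 /star; congr pair; ring. Qed.

Lemma wrapN1 : wrap (- 1) = star.
Proof. by rewrite /wrap sqrrN expr1n subrr sqrtr0 !mulr0 mulr1 /star; congr pair; ring. Qed.

Lemma oncirc_fst p : oncirc p -> -1 <= p.1 <= 1.
Proof. by rewrite /oncirc /= => h; apply/andP; split; nra. Qed.

Lemma unwrap_sqr p : oncirc p -> unwrap p ^+ 2 = (1 + p.1) / 2.
Proof.
move=> /oncirc_fst /andP[h1 h2]; rewrite /unwrap; case: ifP => _; rewrite ?sqrrN sqr_sqrtr //.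
  by rewrite divr_ge0 //; lra.
by rewrite divr_ge0 //; lra.
Qed.

Lemma unwrap_range p : oncirc p -> -1 <= unwrap p <= 1.
Proof.
move=> h; have /andP[h1 h2] := oncirc_fst h; rewrite -ler_norml.
rewrite -(ler_pXn2r (n := 2)) ?nnegrE // real_normK ?num_real // unwrap_sqr // expr1n.
by lra.
Qed.

Lemma wrapK p : oncirc p -> wrap (unwrap p) = p.
Proof.
case: p => a b h; have /andP[/= h1 h2] := oncirc_fst h.
rewrite /wrap unwrap_sqr //=; congr pair; first by field.
have -> : 1 - (1 + a) / 2 = (1 - a) / 2 by field.
have s : Num.sqrt ((1 + a) / 2) * Num.sqrt ((1 - a) / 2) = `|b| / 2.
  rewrite -sqrtrM; last by rewrite divr_ge0 //; lra.
  have -> : (1 + a) / 2 * ((1 - a) / 2) = (b / 2) ^+ 2.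
    have hb : b ^+ 2 = 1 - a ^+ 2 by move: h; rewrite /oncirc /= => <-; ring.
    by rewrite exprMn hb; field.
  by rewrite sqrtr_sqr normrM [X in _ * X]ger0_norm // invr_ge0.
rewrite /unwrap /=; case: leP => b0.
  by rewrite -mulrA s ger0_norm //; field.
by rewrite mulrN mulNr -mulrA s ltr0_norm //; field.
Qed.

Lemma unwrapK x : -1 < x <= 1 -> unwrap (wrap x) = x.
Proof.
move=> /andP[h1 h2]; rewrite /unwrap /wrap /=.
have -> : (1 + (2 * x ^+ 2 - 1)) / 2 = x ^+ 2 by field.
rewrite sqrtr_sqr; have [x0|x0] := leP 0 x.
  by rewrite ifT ?ger0_norm // mulr_ge0 ?sqrtr_ge0 // mulr_ge0.
rewrite ifF ?ltr0_norm ?opprK //; apply/negbTE; rewrite -ltNge.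
have s : 0 < Num.sqrt (1 - x ^+ 2) by rewrite sqrtr_gt0; nra.
by nra.
Qed.

Lemma unwrap_star : unwrap star = 1.
Proof. by rewrite -wrap1 unwrapK // lexx andbT; lra. Qed.

Lemma unwrap_inside p : oncirc p -> p <> star -> -1 < unwrap p < 1.
Proof.
move=> h ps; have /andP[h1 h2] := unwrap_range h; rewrite !lt_neqAle h1 h2 !andbT.
apply/andP; split; apply/eqP => e; apply: ps.
  by rewrite -(wrapK h) -e wrapN1.
by rewrite -(wrapK h) e wrap1.
Qed.

Lemma wrap_close e : 0 < e -> exists2 d : R, 0 < d & forall x y : R,
  -1 <= x <= 1 -> -1 <= y <= 1 -> `|y - x| < d -> @nearby R plane (wrap x) e (wrap y).
Proof.
move=> e0; pose e4 := e / 4; have e40 : 0 < e4 by rewrite divr_gt0.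
(* The first bound serves the linear terms. The second serves the square root, as x^2 has Lipschitz
   constant 2 on [-1, 1]. *)
exists (Num.min e4 (e4 ^+ 2 / 2)) => [|x y x1 y1].
  by rewrite lt_min e40 divr_gt0 // exprn_gt0.
rewrite lt_min => /andP[d1 d2].
have lip : `|y ^+ 2 - x ^+ 2| <= 2 * `|y - x|.
  rewrite subr_sqr normrM mulrC; apply: ler_wpM2r => //.
  move: x1 y1 => /andP[a1 a2] /andP[b1 b2].
  by rewrite ler_norml; apply/andP; split; lra.
have s : `|Num.sqrt (1 - y ^+ 2) - Num.sqrt (1 - x ^+ 2)| < e4.
  apply: sqrt_close => //; try exact: seg1_sqr.
  have -> : 1 - y ^+ 2 - (1 - x ^+ 2) = - (y ^+ 2 - x ^+ 2) by ring.
  by rewrite normrN; move: d2 lip; lra.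
have s1 : `|Num.sqrt (1 - x ^+ 2)| <= 1.
  rewrite ger0_norm ?sqrtr_ge0 // -[leRHS]sqrtr1 ler_wsqrtr //.
  by rewrite gerBl sqr_ge0.
rewrite /nearby /=; split.
  have -> : 2 * y ^+ 2 - 1 - (2 * x ^+ 2 - 1) = 2 * (y ^+ 2 - x ^+ 2) by ring.
  rewrite normrM ger0_norm //; move: d1 lip; rewrite /e4; lra.
set sy := Num.sqrt (1 - y ^+ 2) in s *; set sx := Num.sqrt (1 - x ^+ 2) in s s1 *.
have -> : 2 * y * sy - 2 * x * sx = 2 * (y * (sy - sx)) + 2 * ((y - x) * sx) by ring.
apply: (le_lt_trans (ler_normD _ _)); rewrite !normrM !(@ger0_norm _ 2) //.
have a1 : `|y| * `|sy - sx| <= `|sy - sx|.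
  by apply: ler_piMl => //; rewrite ler_norml.
have a2 : `|y - x| * `|sx| <= `|y - x| by apply: ler_piMr.
by move: s d1; rewrite /e4; lra.
Qed.

Lemma unwrap_cont : fcont (T := plane) (T' := rl) [set p | oncirc p /\ p <> star] unwrap.
Proof.
move=> [a b] [h ps] e e0; have /andP[/= h1 h2] := oncirc_fst h.
have sq0 (p : R * R) : oncirc p -> 0 <= (1 + p.1) / 2.
  by move=> /oncirc_fst/andP[g1 g2]; rewrite divr_ge0 //; lra.
(* Away from [star] the second coordinate vanishes only at (-1, 0), where the two branches of
   [unwrap] meet at 0. *)
have [b0|b0] := eqVneq b 0.
  have a1 : a = - 1.
    move: h; rewrite /oncirc /= b0 expr0n addr0 => /eqP; rewrite sqrf_eq1 => /orP[/eqP a1|/eqP//].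
    by case: ps; rewrite a1 b0.
  exists (e ^+ 2) => [|[a' b'] [h' _] [/= d1 _]]; first by rewrite exprn_gt0.
  have u0 : unwrap (a, b) = 0.
    by rewrite /unwrap /= a1 subrr mul0r sqrtr0 oppr0; case: ifP.
  rewrite /nearby /= u0 subr0.
  rewrite -(ltr_pXn2r (n := 2)) ?nnegrE ?(ltW e0) // real_normK ?num_real // unwrap_sqr //=.
  move: d1; rewrite a1 ltr_norml => /andP[_ d1].
  have : 0 < e ^+ 2 by rewrite exprn_gt0.
  lra.
(* Within |b| the second coordinate keeps its sign, so a single branch is used. *)
exists (Num.min (e ^+ 2) `|b|) => [|[a' b'] [h' _]].
  by rewrite lt_min normr_gt0 b0 exprn_gt0.
rewrite /nearby /= !lt_min => -[/andP[d1 _] /andP[_ d2]].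
have c : `|Num.sqrt ((1 + a') / 2) - Num.sqrt ((1 + a) / 2)| < e.
  apply: sqrt_close => //; [exact: (sq0 (a', b'))|exact: (sq0 (a, b))|].
  have -> : (1 + a') / 2 - (1 + a) / 2 = (a' - a) / 2 by field.
  rewrite normrM [X in _ * X]ger0_norm ?invr_ge0 //.
  by move: d1; have := normr_ge0 (a' - a); lra.
rewrite /unwrap /=; have [bp|bn] := leP 0 b.
  rewrite ifT //; move: d2; rewrite (ger0_norm bp) ltr_distl => /andP[d2 _].
  by rewrite ltW // (le_lt_trans _ d2) // subrr.
rewrite ifF; first by rewrite -opprD normrN.
apply/negbTE; rewrite -ltNge; move: d2; rewrite (ltr0_norm bn) ltr_distl => /andP[_ d2].
by rewrite (lt_le_trans d2) // subrr.
Qed.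

(** Near [star] only |unwrap p| is controlled: it is at least its square (1 + p.1)/2, which is close
    to 1. *)
Lemma unwrap_near_star e : 0 < e -> exists2 d : R, 0 < d & forall p : plane,
  oncirc p -> nearby star d p -> `|unwrap p - 1| < e \/ `|unwrap p + 1| < e.
Proof.
move=> e0; exists e => // p h [/= d1 _].
have /andP[r1 r2] := unwrap_range h; have sq := unwrap_sqr h.
have r : 1 - e < `|unwrap p|.
  have : `|unwrap p| ^+ 2 <= `|unwrap p|.
    by rewrite expr2; apply: ler_piMl => //; rewrite ler_norml r1.
  rewrite real_normK ?num_real // sq.
  by move: d1; rewrite ltr_norml => /andP[d1 d2]; lra.
have [u0|u0] := leP 0 (unwrap p).
  by left; move: r; rewrite (ger0_norm u0) => r; rewrite ltr_norml; apply/andP; split; lra.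
by right; move: r; rewrite (ltr0_norm u0) => r; rewrite ltr_norml; apply/andP; split; lra.
Qed.

End Circle.

(** * Homology of the spaces of finite subsets of the circle *)

Section CircleHomology.
Variable R : realType.
Local Notation rl := (rline R).
Local Notation pl := (plane R).
Notation HP := (hyper pl).
Notation HR := (hyper rl).
Notation ptr Y := (@car R HP Y).
Notation htr Y := (@car R HR Y).
Notation oncirc := (@oncirc R).
Notation star := (star R).
Implicit Types (A : set pl) (x y u e : R) (p : R * R).

(** At u = 1 the slope is 2, so all x with |x| at least 1/2 reach ±1, that is, the base point after
    wrapping. *)
Definition spread u x : R := Num.max (-1) (Num.min 1 ((1 + u) * x)).

Lemma spread_range u x : -1 <= spread u x <= 1.
Proof. by rewrite /spread le_max lexx ge_max ge_min lexx /= andbT; lra. Qed.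

Lemma clamp_close x y : `|Num.max (-1) (Num.min 1 y) - Num.max (-1) (Num.min 1 x)| <= `|y - x|.
Proof.
wlog xy : x y / x <= y => [h|].
  have [xy|yx] := leP x y; first exact: h.
  by rewrite distrC [leRHS]distrC; apply: h; exact: ltW.
rewrite [leRHS]ger0_norm ?subr_ge0 // ler_norml.
rewrite /Num.max /Num.min; have [h1|h1] := ltP 1 y; have [h2|h2] := ltP 1 x;
  do ! case: ltP => ?; apply/andP; split; lra.
Qed.

Lemma spread_close u u' x y : 0 <= u <= 1 -> -1 <= y <= 1 -> 0 <= u' <= 1 ->
  `|spread u' y - spread u x| <= 2 * `|y - x| + `|u' - u|.
Proof.
move=> /andP[u0 u1] y1 _; apply: (le_trans (clamp_close _ _)).
have -> : (1 + u') * y - (1 + u) * x = (1 + u) * (y - x) + (u' - u) * y by ring.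
apply: (le_trans (ler_normD _ _)); apply: lerD; rewrite normrM.
  by apply: ler_wpM2r => //; rewrite ger0_norm; lra.
by apply: ler_piMr => //; rewrite ler_norml.
Qed.

Lemma spread0 x : -1 <= x <= 1 -> spread 0 x = x.
Proof.
move=> /andP[h1 h2]; rewrite /spread addr0 mul1r.
by rewrite (min_idPr h2); apply/max_idPr.
Qed.

Lemma spread_far x : -1 <= x <= 1 -> 2^-1 < `|x| -> spread 1 x = 1 \/ spread 1 x = -1.
Proof.
move=> _; have [x0|x0] := leP 0 x; rewrite ?(ger0_norm x0) ?(ltr0_norm x0) => h.
  by left; rewrite /spread (min_idPl _) ?(max_idPr _) //; lra.
by right; rewrite /spread; apply/max_idPl; rewrite ge_min; apply/orP; right; lra.
Qed.

Lemma spread_sqr u x : 0 <= u -> -1 <= x <= 1 -> x ^+ 2 <= spread u x ^+ 2.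
Proof.
move=> u0 /andP[h1 h2]; rewrite /spread.
have [x0|x0] := leP 0 x.
  have : x <= Num.max (-1) (Num.min 1 ((1 + u) * x)).
    by rewrite le_max le_min h2 /=; apply/orP; right; nra.
  by move: (Num.max _ _) => m xm; nra.
have : Num.max (-1) (Num.min 1 ((1 + u) * x)) <= x.
  by rewrite ge_max ge_min h1 /=; apply/orP; right; nra.
by move: (Num.max _ _) => m xm; nra.
Qed.

Definition push_star u p : pl := wrap (spread u (unwrap p)).

Lemma spread1 u : 0 <= u -> spread u 1 = 1.
Proof. by move=> u0; rewrite /spread mulr1 (min_idPl _) ?(max_idPr _) //; lra. Qed.

Lemma spreadN1 u : 0 <= u -> spread u (-1) = -1.
Proof. by move=> u0; rewrite /spread; apply/max_idPl; rewrite ge_min; apply/orP; right; lra. Qed.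

Lemma push_star_fix u : 0 <= u -> push_star u star = star.
Proof. by move=> u0; rewrite /push_star unwrap_star spread1 // wrap1. Qed.

Lemma popen_star : popen (T := pl) (~` [set star]).
Proof.
move=> p ps; have [n1'|n2] : p.1 - 1 != 0 \/ p.2 != 0.
  apply/orP; rewrite -negb_and; apply/negP => /andP[/eqP h1 /eqP h2]; apply: ps.
  by case: (p) h1 h2 => a b /= /eqP; rewrite subr_eq0 => /eqP -> ->.
- exists `|p.1 - 1|; first by rewrite normr_gt0.
  by move=> p' [h _] ep; move: h; rewrite ep /= distrC ltxx.
- exists `|p.2|; first by rewrite normr_gt0.
  by move=> p' [_ h] ep; move: h; rewrite ep /= sub0r normrN ltxx.
Qed.

(** Continuity holds even at [star], where [unwrap] jumps: the two limits 1 and -1 are fixed by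
    [spread] and wrapped to the same point. *)
Lemma push_star_hcont : hcont (T := pl) (T' := pl) oncirc push_star.
Proof.
move=> u p u01 hp e e0; have [d d0 hd] := wrap_close e0.
(* With d/4 for both space and time, the bound of [spread_close] is below 3d/4. *)
have d4 : 0 < d / 4 by rewrite divr_gt0.
have u0 : 0 <= u by case/andP: u01.
have [ps|ps] := pselect (p = star); last first.
  have [d' d'0 hd'] := unwrap_cont (conj hp ps) d4.
  have [e1 e10 he1] := popen_star ps.
  exists (Num.min (Num.min d' e1) (d / 4)) => [|u' p' u'01 hp']; first by rewrite !lt_min d'0 e10.
  rewrite lt_min => /andP[_ uu] pp.
  have pp1 : nearby p d' p' by apply: plane_mono pp; rewrite !ge_min lexx.
  have pp2 : nearby p e1 p' by apply: plane_mono pp; rewrite !ge_min lexx orbT.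
  have := hd' p' (conj hp' (he1 _ pp2)) pp1; rewrite /nearby /= => h.
  apply: hd; [exact: spread_range|exact: spread_range|].
  apply: (le_lt_trans (spread_close _ u01 (unwrap_range hp') u'01)); lra.
rewrite ps push_star_fix // => {p hp ps}.
have [d' d'0 hd'] := unwrap_near_star d4.
exists (Num.min d' (d / 4)) => [|u' p' u'01 hp' _ pp]; first by rewrite lt_min d'0.
have u'0 : 0 <= u' by case/andP: u'01.
have pp1 : nearby star d' p' by apply: plane_mono pp; rewrite ge_min lexx.
have key z : -1 <= z <= 1 -> spread u' z = z -> wrap z = star -> `|unwrap p' - z| < d / 4 ->
    nearby star e (push_star u' p').
  move=> z1 sz wz h; rewrite -wz; apply: hd => //; first exact: spread_range.
  rewrite -[X in _ - X]sz.
  apply: (le_lt_trans (spread_close _ u'01 (unwrap_range hp') u'01)).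
  by rewrite subrr normr0; lra.
have [h|h] := hd' p' hp' pp1.
  by apply: (key 1) => //; [apply/andP; split; lra|exact: spread1|exact: wrap1].
apply: (key (-1)) => //; [apply/andP; split; lra|exact: spreadN1|exact: wrapN1|].
by rewrite opprK.
Qed.

Variable n : nat.
Hypothesis n1 : (1 < n)%N.

Definition CN : set (set pl) := [set A : set pl | cardle n A /\ A `<=` oncirc].
Definition PN : set (set pl) := [set A : set pl | CN A /\ A star].
Definition UN := CN `&` @hit R pl [set p : R * R | - 2^-1 < p.1].
Definition VN := CN `&` @avoid R pl [set star].

Lemma CN_fin A : CN A -> fin A. Proof. by move=> [/cardle_fin]. Qed.

Lemma push_star_oncirc u p : oncirc (push_star u p).
Proof. by apply: wrap_oncirc; exact: spread_range. Qed.

(** Pushing points to the base point never lowers their first coordinate, and it takes those with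
    first coordinate above -1/2 all the way. *)
Lemma UN_PN : triv (ptr UN) (ptr PN).
Proof.
pose H (u : R) (A : HP) : HP := push_star u @` A.
have keep u A : CN A -> CN (H u A).
  move=> [cA oA]; split; first exact: cardle_image.
  by move=> _ [p Ap <-]; exact: push_star_oncirc.
apply: (@deformation R HP (ptr UN) (ptr PN) H) => //.
- split=> // A [CA As]; split=> //; exists star => //=.
  by rewrite (@lt_trans _ _ 0) // oppr_lt0 invr_gt0.
- have := hcont_image set0 (@plane_mono R) (@plane_refl R) push_star_hcont.
  move=> /(_ UN) h; have {}h := h _.
  have -> : H = fun u (A : HP) => push_star u @` A `|` set0.
    by apply/funext => u; apply/funext => A; rewrite setU0.
  by apply: h => A [CA _]; split; [exact: CN_fin|case: CA].
- move=> u A /andP[u0 _] [CA [p Ap /= p1]]; split; first exact: keep.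
  exists (push_star u p); first by exists p.
  have op : oncirc p by case: CA => _; apply.
  have := spread_sqr u0 (unwrap_range op); rewrite unwrap_sqr // /push_star /=; lra.
- move=> u A /andP[u0 _] [CA As]; split; first exact: keep.
  by exists star => //; exact: push_star_fix.
- move=> A [[_ oA] _]; rewrite /H; apply/seteqP; split=> [_ [p Ap <-]|p Ap].
    by rewrite /push_star spread0 ?wrapK //; [exact: oA|apply: unwrap_range; exact: oA].
  by exists p => //; rewrite /push_star spread0 ?wrapK //; [exact: oA|apply: unwrap_range; exact: oA].
- move=> A [CA [p Ap /= p1]]; split; first exact: keep.
  exists p => //; have op : oncirc p by case: CA => _; apply.
  have far : 2^-1 < `|unwrap p|.
    rewrite -(ltr_pXn2r (n := 2)) ?nnegrE ?invr_ge0 // real_normK ?num_real // unwrap_sqr //.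
    by rewrite exprVn expr2; lra.
  rewrite /push_star; have [->|->] := spread_far (unwrap_range op) far.
    exact: wrap1.
  exact: wrapN1.
Qed.

Lemma hopen_U : hopen (@hit R pl [set p : R * R | - 2^-1 < p.1]).
Proof.
apply: hopen_hit => p /= h; exists (p.1 + 2^-1); first by lra.
by move=> p' [] /=; rewrite ltr_norml => /andP[h1 _] _; lra.
Qed.

Lemma hopen_V : hopen (@avoid R pl [set star]).
Proof.
by apply: hopen_avoid; [exact: plane_mono|exact: popen_star].
Qed.

Lemma CN_UV : CN = UN `|` VN.
Proof.
apply/seteqP; split=> [A CA|A [] []//].
have [As|As] := pselect (A star); last by right; split=> // p Ap ps; apply: As; rewrite -ps.
left; split=> //; exists star => //=.
by rewrite (@lt_trans _ _ 0) // oppr_lt0 invr_gt0.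
Qed.

Notation unw := (@unwrap R : pl -> rl).
Notation wr := (@wrap R : rl -> pl).

Lemma wrap_fcont (D : set rl) : (forall x : R, D x -> -1 <= x <= 1) -> fcont D wr.
Proof.
move=> hD x Dx e e0; have [d d0 hd] := wrap_close e0.
by exists d => // y Dy; apply: hd; exact: hD.
Qed.

Lemma wrap_neq_star x : -1 < x < 1 -> wrap x <> star.
Proof.
move=> /andP[h1 h2] /(congr1 (@unwrap R)); rewrite unwrap_star unwrapK ?h1 ?ltW //.
by move=> e; move: h2; rewrite e ltxx.
Qed.

Lemma VN_inside j : homology_iso j (ptr VN) (ptr (UN `&` VN)) j
  (htr (inside (R := R) n)) (htr (lefts (R := R) n `|` rights (R := R) n)).
Proof.
pose f (A : HP) : HR := unw @` A; pose g (A : HR) : HP := wr @` A.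
have fV A : VN A -> inside (R := R) n (f A).
  move=> [[cA oA] hA]; split; first exact: cardle_image.
  by move=> _ [p Ap <-]; apply: unwrap_inside; [exact: oA|exact: hA].
have gV (A : set rl) : inside (R := R) n A -> VN (g A).
  move=> [cA hA]; split; first split.
  - exact: cardle_image.
  - by move=> _ [x Ax <-]; apply: wrap_oncirc; have /andP[h1 h2] := hA x Ax; rewrite !ltW.
  - by move=> _ [x Ax <-]; apply: wrap_neq_star; exact: hA.
apply: (@homology_iso_homeo R HP HR j _ _ _ _ f g).
- by split=> // A [].
- by split=> // A [] [].
- apply: (fcont_image0 (@plane_mono R) (@rline_refl R) (@unwrap_cont R)) => A [CA hA].
  split; first exact: CN_fin.
  by move=> p Ap; split; [case: CA => _; exact|exact: hA].
- apply: (fcont_image0 (@rline_mono R) (@plane_refl R) (@wrap_fcont [set x : R | -1 < x < 1] _)).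
    by move=> x /= /andP[h1 h2]; rewrite !ltW.
  by move=> A [/cardle_fin].
- by split.
- split=> // A [[[_ oA] [p Ap /= p1]] VA]; have iA := fV _ VA.
  have sq := unwrap_sqr (oA _ Ap).
  have [h|h] := leP 0 (unwrap p).
    right; split=> //; exists (unwrap p) => /=; first by exists p.
    by nra.
  left; split=> //; exists (unwrap p) => /=; first by exists p.
  by nra.
- by split.
- split=> // A [[iA [x Ax /= x1]]|[iA [x Ax /= x1]]]; have VA := gV _ iA.
    split=> //; split; first by case: VA.
    by exists (wrap x) => /=; [exists x|nra].
  split=> //; split; first by case: VA.
  by exists (wrap x) => /=; [exists x|nra].
- move=> A [[_ oA] _]; apply/seteqP; split=> [_ [_ [p Ap <-] <-]|p Ap].
    by rewrite wrapK //; exact: oA.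
  by exists (unwrap p); [exists p|rewrite wrapK //; exact: oA].
- move=> A [_ hA].
  have k x : A x -> unwrap (wrap x) = x.
    by move=> /hA/andP[h1 h2]; rewrite unwrapK // h1 ltW.
  apply/seteqP; split=> [_ [_ [x Ax <-] <-]|x Ax]; first by rewrite k.
  by exists (wrap x); [exists x|exact: k].
Qed.

(* [unwrap] is not continuous at [star], but nearby points are sent close to 1 or -1, and the
   image of a set containing [star] contains both after -1 is added. *)
Lemma PN_segE j : homology_iso j (ptr PN) (zero_car HP) j (htr (segE (-1 : R) 1 n.+1)) (zero_car HR).
Proof.
pose f (A : HP) : HR := unw @` A `|` [set (-1 : R)]; pose g (A : HR) : HP := wr @` A.
have m11 : -1 < (1 : R) by lra.
apply: (@homology_iso_homeo R HP HR j _ _ _ _ f g).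
- exact: subcar_red.
- exact: subcar_red.
- move=> A [CA As] e e0; have oA : A `<=` oncirc by case: CA.
  have [||d d0 hd] := @fin_min _ _ A (fun (p : pl) d => forall p' : pl, oncirc p' -> nearby p d p' ->
      (p <> star -> `|unwrap p' - unwrap p| < e) /\
      (p = star -> `|unwrap p' - 1| < e \/ `|unwrap p' + 1| < e)) (CN_fin CA).
  - move=> p d d' _ dd' h p' op' pp'; apply: h => //; exact: plane_mono pp'.
  - move=> p Ap; have [ps|ps] := pselect (p = star).
      have [d d0 hd] := unwrap_near_star e0; exists d => // p' op'.
      by rewrite ps => pp'; split=> // _; exact: hd.
    have [d d0 hd] := unwrap_cont (conj (oA _ Ap) ps) e0.
    have [e1 e10 he1] := popen_star ps.
    exists (Num.min d e1) => [|p' op' pp']; first by rewrite lt_min d0.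
    have pp1 : nearby p d p' by apply: plane_mono pp'; rewrite ge_min lexx.
    have pp2 : nearby p e1 p' by apply: plane_mono pp'; rewrite ge_min lexx orbT.
    by split=> // _; apply: hd => //; split=> //; exact: he1.
  exists d => // A' [CA' A's] [h1 h2]; have oA' : A' `<=` oncirc by case: CA'.
  have mem1 (B : set pl) : B star -> f B (1 : R).
    by move=> Bs; left; exists star => //; exact: unwrap_star.
  have memN1 (B : set pl) : f B (-1 : R) by right.
  split=> [_ [[p Ap <-]|->]|_ [[p' Ap' <-]|->]].
  + have [ps|ps] := pselect (p = star).
      by exists (1 : R); [exact: mem1|rewrite ps /nearby /= unwrap_star subrr normr0].
    have [p' Ap' pp'] := h1 _ Ap; exists (unwrap p'); first by left; exists p'.
    by have [+ _] := hd p Ap p' (oA' _ Ap') pp'; apply.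
  + by exists (-1 : R) => //; exact: rline_refl.
  + have [p Ap pp'] := h2 _ Ap'; have [k1 k2] := hd p Ap p' (oA' _ Ap') pp'.
    have [ps|ps] := pselect (p = star); last first.
      by exists (unwrap p); [left; exists p|exact: k1].
    have [h|h] := k2 ps; first by exists (1 : R); [exact: mem1|].
    by exists (-1 : R) => //; rewrite /nearby /= opprK.
  + by exists (-1 : R) => //; exact: rline_refl.
- apply: (fcont_image0 (@rline_mono R) (@plane_refl R) (@wrap_fcont [set x : R | -1 <= x <= 1] _)) => //.
  by move=> A [/cardle_fin].
- split=> // A [[cA oA] As]; split.
  + rewrite -addn1; apply: cardle_setU; first exact: cardle_image.
    by exists (fun=> (-1 : R)); apply/seteqP; split=> [x ->|_ [i _ <-]] //; exists ord0.
  + move=> x [[p Ap <-]|->]; first by apply: unwrap_range; exact: oA.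
    by rewrite lexx ltW.
  + by right.
  + by left; exists star => //; exact: unwrap_star.
- by [].
- split=> // A [cA hA AN1 A1]; split.
    split; last by move=> _ [x Ax <-]; apply: wrap_oncirc; exact: hA.
    (* Wrapping identifies the two end points, so at most n of the n + 1 points remain distinct. *)
    apply: (cardle_glue AN1 A1) => //; last by rewrite wrap1 wrapN1.
    by move=> e; have : (-1 : R) = 1 := e; lra.
  by exists (1 : R) => //; exact: wrap1.
- by [].
- move=> A [[_ oA] As]; rewrite /g /f image_setU image_set1 wrapN1.
  apply/seteqP; split=> [_ [[_ [p Ap <-] <-]|->]//|p Ap].
    by rewrite wrapK //; exact: oA.
  by left; exists (unwrap p); [exists p|rewrite wrapK //; exact: oA].
- move=> A [_ hA AN1 A1].
  have k x : A x -> x != -1 -> unwrap (wrap x) = x.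
    by move=> /hA/andP[h1 h2] xn; rewrite unwrapK // h2 lt_neqAle h1 eq_sym xn.
  apply/seteqP; split=> [_ [[_ [x Ax <-] <-]|->//]|x Ax].
    have [->|xn] := eqVneq x (-1); last by rewrite k.
    by rewrite wrapN1 unwrap_star.
  have [->|xn] := eqVneq x (-1); first by right.
  by left; exists (wrap x); [exists x|exact: k].
Qed.

(** Indices count vertices: n + 1 stands for dimension n, and n for dimension n - 1. *)
Lemma CN_homology j : homology_Z j (ptr CN) (zero_car HP) (j == if odd n then n.+1 else n).
Proof.
have s1 : subcar (zero_car HP) (ptr PN) by exact: subcar_red.
have s2 : subcar (ptr PN) (ptr CN) by split=> // A [].
have s3 : subcar (ptr UN) (ptr CN) by split=> // A [].
have s4 : subcar (ptr PN) (ptr UN).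
  split=> // A [CA As]; split=> //; exists star => //=.
  by rewrite (@lt_trans _ _ 0) // oppr_lt0 invr_gt0.
have hP i : homology_Z i (ptr PN) (zero_car HP) (~~ odd n && (i == n)).
  apply/(homology_Z_iso _ (PN_segE i)); apply: segE_homology; [lra|exact: ltnW].
have hCP i : homology_Z i (ptr CN) (ptr PN) (odd n && (i == n.+1)).
  apply/(homology_Z_iso _ (triple_sub i s4 s3 UN_PN)).
  rewrite {1}CN_UV; apply/(homology_Z_iso _ (base_excision CN_fin i hopen_U hopen_V erefl erefl)).
  by apply/(homology_Z_iso _ (VN_inside i)); exact: inside_homology.
have [on|en] := boolP (odd n).
  have tP : triv (ptr PN) (zero_car HP) by apply/trivP => i; have := hP i; rewrite on.
  by apply/(homology_Z_iso _ (triple_sub j s1 s2 tP)); have := hCP j; rewrite on.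
have tC : triv (ptr CN) (ptr PN) by apply/trivP => i; have := hCP i; rewrite (negbTE en).
by apply/(homology_Z_iso _ (triple_incl j s1 s2 tC)); have := hP j; rewrite (negbTE en).
Qed.

End CircleHomology.

(** * Comparison with the quotient topology *)

Section Frozen.
Variables (R : realType) (n : nat).
Notation HP := (hyper (plane R)).
Notation SC k := {freeg (simplex HP k.+1) / int}.
Notation CNR := (@CN R n).

Lemma Cn_CN : Cn R n = CNR.
Proof.
apply/seteqP; split=> [A [x tx ->]|A [[x ->] oA]].
  by split; [exists x|move=> _ [i _ <-]; exact: tx].
by exists x => // i; apply: oA; exists i.
Qed.

Lemma finType_min (I : finType) (P : I -> R -> Prop) :
  (forall i d d', d <= d' -> P i d' -> P i d) ->
  (forall i, exists2 d : R, 0 < d & P i d) ->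
  exists2 d : R, 0 < d & forall i, P i d.
Proof.
move=> Pm h; suff [d d0 hd] : exists2 d : R, 0 < d & forall i, i \in enum I -> P i d.
  by exists d => // i; apply: hd; rewrite mem_enum.
elim: (enum I) => [|i l [d d0 hd]]; first by exists 1.
have [d' d'0 hd'] := h i; exists (Num.min d d') => [|j]; first by rewrite lt_min d0.
rewrite inE => /orP[/eqP->|/hd]; [apply: Pm hd'|apply: Pm]; by rewrite ge_min lexx ?orbT.
Qed.

(* A configuration has only finitely many preimages in the torus. *)
Lemma Cn_open_hball (U : set (set (R * R))) (A : set (R * R)) : Cn_open R n U -> U A ->
  exists2 e : R, 0 < e & forall B, CNR B -> hball (T := plane R) A e B -> U B.
Proof.
move=> [UC oU] UA; have [x0 tx0 Ax0] := UC A UA.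
have [||e1 e10 he1] := @finType_min {ffun 'I_n -> 'I_n} (fun phi d =>
    range (x0 \o phi) = A -> forall y, torus R n y ->
      (forall i, `|(y i).1 - (x0 (phi i)).1| < d /\ `|(y i).2 - (x0 (phi i)).2| < d) ->
      U (config R n y)).
- move=> phi d d' dd' h hA y ty hy; apply: h => // i.
  by have [h1 h2] := hy i; split; exact: lt_le_trans dd'.
- move=> phi; have [hA|hA] := pselect (range (x0 \o phi) = A); last by exists 1.
  have [||e e0 he] := oU (x0 \o phi).
  + by move=> i; exact: tx0.
  + by split; [move=> i; exact: tx0|rewrite /config hA].
  by exists e => // _ y ty hy; have [] := he y ty hy.
have [||s s0 hs] := @finType_min ('I_n * 'I_n)%type (fun ij d => x0 ij.1 <> x0 ij.2 ->
    `|(x0 ij.1).1 - (x0 ij.2).1| < d -> `|(x0 ij.1).2 - (x0 ij.2).2| < d -> False).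
- move=> ij d d' dd' h ne h1 h2; apply: (h ne); exact: lt_le_trans dd'.
- move=> [i j] /=; have [e|ne] := pselect (x0 i = x0 j); first by exists 1.
  have [n1|n2] : (x0 i).1 - (x0 j).1 != 0 \/ (x0 i).2 - (x0 j).2 != 0.
    apply/orP; rewrite -negb_and; apply/negP => /andP[]; rewrite !subr_eq0 => /eqP h1 /eqP h2.
    by apply: ne; rewrite [x0 i]surjective_pairing h1 h2 -surjective_pairing.
  + by exists `|(x0 i).1 - (x0 j).1|; rewrite ?normr_gt0 // ltxx.
  + by exists `|(x0 i).2 - (x0 j).2|; rewrite ?normr_gt0 // ltxx.
exists (Num.min e1 (s / 2)) => [|B [[y ->] oB] [hAB hBA]].
  by rewrite lt_min e10 divr_gt0.
have /choice[phi0 hphi0] : forall i, exists j, @nearby R (plane R) (x0 j) (Num.min e1 (s / 2)) (y i).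
  move=> i; have [|a Aa ay] := hBA (y i); first by exists i.
  by move: Aa; rewrite Ax0 => -[j _ xj]; exists j; rewrite xj.
pose phi : {ffun 'I_n -> 'I_n} := [ffun i => phi0 i].
have hphi i : @nearby R (plane R) (x0 (phi i)) (Num.min e1 (s / 2)) (y i).
  by rewrite ffunE; exact: hphi0.
apply: (he1 phi).
(* Every a in A is within s/2 of some [y i], which is within s/2 of [x0 (phi i)]. Distinct points of
   A are at least s apart in one coordinate, so these two coincide and the range is all of A. *)
- apply/seteqP; split=> [_ [i _ <-]|a Aa]; first by rewrite Ax0; exists (phi i).
  have [_ [i _ <-] ai] := hAB a Aa; exists i => //=.
  move: (Aa); rewrite Ax0 => -[j _ xj]; apply: contrapT => ne.
  move: ai (hphi i); rewrite -xj /nearby /= !lt_min.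
  move=> [/andP[_ a1] /andP[_ a2]] [/andP[_ b1] /andP[_ b2]].
  apply: (hs (phi i, j)) => /=; first by rewrite xj.
    apply: (le_lt_trans (ler_distD (y i).1 _ _)).
    by rewrite distrC [ltRHS]splitr ltrD.
  apply: (le_lt_trans (ler_distD (y i).2 _ _)).
  by rewrite distrC [ltRHS]splitr ltrD.
- by move=> i; apply: oB; exists i.
- move=> i; have := hphi i; rewrite /nearby /= !lt_min.
  by move=> [/andP[h1 _] /andP[h2 _]].
Qed.

Lemma singular_simplexE k (s : simplex HP k.+1) :
  sing_simplex R n k s <-> carried (car (T := HP) CNR) s.
Proof.
split=> [[h1 h2 h3]|[_ [h1 h2] h3]].
  split=> //; last by move=> t ht; rewrite /= -Cn_CN; exact: h1.
  split=> // t ht e e0.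
  (* The ball of radius e is written with a smaller radius e', so that the triangle inequality
     leaves room (e - e')/2 around each of its members. *)
  pose U : set (set (R * R)) := [set B | CNR B /\ exists2 e', e' < e &
    hball (T := plane R) (s t) e' B].
  have oU : Cn_open R n U.
    split; first by move=> B [CB _]; rewrite Cn_CN.
    move=> x tx [_ [_ [e' ee' [hx1 hx2]]]]; exists ((e - e') / 2); first by rewrite divr_gt0 // subr_gt0.
    move=> y ty hy; split=> //; split; first by rewrite -Cn_CN; exists y.
    have tri (a b c : plane R) : nearby a e' b -> nearby b ((e - e') / 2) c ->
        nearby a ((e + e') / 2) c.
      move=> [a1 a2] [b1 b2].
      have -> : (e + e') / 2 = (e - e') / 2 + e' by field.
      split; [apply: le_lt_trans (ler_distD b.1 _ _) _|apply: le_lt_trans (ler_distD b.2 _ _) _];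
        exact: ltrD.
    exists ((e + e') / 2); first lra.
    split=> [a /hx1[_ [i _ <-] ai]|_ [i _ <-]].
      by exists (y i); [exists i|apply: tri ai _; exact: hy].
    have [|a Aa ax] := hx2 (x i); first by exists i.
    by exists a => //; apply: tri ax _; exact: hy.
  have Ut : U (s t).
    split; first by rewrite -Cn_CN; exact: h1.
    exists (e / 2); first by rewrite ltr_pdivrMr // ltr_pMr // ltr1n.
    by apply: (hyper_refl (@plane_refl R)); rewrite divr_gt0.
  have [d d0 hd] := h3 U oU t ht (conj ht Ut).
  exists d => // u hu tu; have [_ [_ [e' ee' he']]] := hd u hu tu.
  exact: (hball_mono (@plane_mono R) (ltW ee') he').
split=> //; first by move=> t ht; rewrite Cn_CN; exact: h3.
move=> U oU t ht [_ Ut]; have [e e0 he] := Cn_open_hball oU Ut.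
have [d d0 hd] := h2 t ht e e0; exists d => // u hu tu; split=> //.
by apply: he; [exact: h3|exact: hd].
Qed.

(** Here [k] is the dimension again, hence the shift to k + 1 vertices. *)
Definition coeffs k (x : SC k) : Defs.chain R k := fun s => coeff (s : simplex HP k.+1) x.

Lemma coeffs_inj k (x y : SC k) : coeffs x = coeffs y -> x = y.
Proof. by move=> e; apply/eqP/freeg_eqP => s; have := congr1 (@^~ s) e. Qed.

(** Functions of infinite support are not in the image of [coeffs]; a chosen inverse is arbitrary on
    them. *)
Lemma coeffs_retract k : exists inv : Defs.chain R k -> SC k, forall x, inv (coeffs x) = x.
Proof.
have /choice[inv hinv] : forall c : Defs.chain R k, exists x : SC k,
    (exists y : SC k, coeffs y = c) -> coeffs x = c.
  move=> c; have [[y yc]|h] := pselect (exists y : SC k, coeffs y = c); first by exists y.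
  by exists 0 => /h.
by exists inv => x; apply: coeffs_inj; apply: hinv; exists x.
Qed.

Lemma coeffs_onto k (c : Defs.chain R k) : finite_set [set s | c s != 0] ->
  exists x : SC k, coeffs x = c.
Proof.
move=> /(@finite_seqP (simplex HP k.+1))[r hr].
exists (\sum_(s <- undup r) << c s *g s >>); apply/funext => s.
rewrite /coeffs raddf_sum /=.
have [sr|sr] := boolP (s \in undup r).
  rewrite (bigD1_seq s) ?undup_uniq //= coeffU eqxx mulr1 big1 ?addr0 // => s' ss'.
  by rewrite coeffU (negbTE ss') mulr0.
have c0 : c s = 0.
  have [//|cs] := eqVneq (c s) 0; case/negP: sr; rewrite mem_undup.
  by have : [set` r] s by rewrite -hr.
rewrite c0 big_seq big1 // => s' s'r; rewrite coeffU (_ : s' == s = false) ?mulr0 //.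
by apply/negbTE/eqP => e; move: sr; rewrite -e s'r.
Qed.

Lemma is_chain_coeffs k (x : SC k) : Defs.is_chain R n k (coeffs x) <-> Ch (car (T := HP) CNR) x.
Proof.
split=> [[_ h] s hs|h]; first by apply/singular_simplexE; exact: h.
split; last by move=> s hs; apply/singular_simplexE; exact: h.
apply/(@finite_seqP (simplex HP k.+1)); exists (dom x); apply/seteqP.
by split=> s /=; rewrite mem_dom.
Qed.

Lemma coeffs_bdry k (x : SC k.+1) : Defs.bd R k (coeffs x) = coeffs (bdry x).
Proof.
apply/funext => u; rewrite /Defs.bd.
rewrite (@fsbigE _ _ _ (simplex HP k.+2) _ (dom x)) ?uniq_dom //; last first.
  by move=> s _ /coeff_outdom e; rewrite /coeffs e mul0r.
rewrite -[in RHS](freeg_sumE x) raddf_sum /coeffs raddf_sum /=.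
apply: eq_big => [s|s _]; first by rewrite in_setT.
have -> : << coeff s x *g s >> = << s >> *~ coeff s x.
  by rewrite freegU_mulz intz.
rewrite raddfMz /= bdU raddfMz /= raddf_sum -mulrzl intz; congr (_ * _).
apply: eq_bigr => i _; rewrite raddfMz /= coeffU mul1r -mulrzl.
congr (_ * _); first by rewrite intz.
Qed.

Lemma coeffs0 k (x : SC k) : (forall u, coeffs x u = 0) -> x = 0.
Proof. by move=> h; apply: coeffs_inj; apply/funext => u; rewrite h /coeffs coeff0. Qed.

Lemma cyc_red k (x : SC k.+1) : cyc (zero_car HP) x <-> forall u, Defs.bd R k (coeffs x) u = 0.
Proof.
rewrite coeffs_bdry /=; split=> [/Ch_red -> u|/coeffs0 ->]; last exact: Ch_0.
by rewrite /coeffs coeff0.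
Qed.

Lemma is_boundary_coeffs k (x : SC k) :
  Defs.is_boundary R n k (coeffs x) <-> rel_boundary (car (T := HP) CNR) (zero_car HP) x.
Proof.
split=> [[d hd]|[d [e [hd /Ch_red -> ->]]]].
  have [y yd] := coeffs_onto hd.1; rewrite -yd in hd *.
  rewrite coeffs_bdry => /coeffs_inj <-; apply: rel_boundary_bdry; exact/is_chain_coeffs.
by exists (coeffs d); [exact/is_chain_coeffs|rewrite coeffs_bdry addr0].
Qed.

Lemma is_cycle_coeffs k (c : Defs.chain R k.+1) : Defs.is_cycle R n k.+1 c ->
  exists2 x : SC k.+1, coeffs x = c & rel_cycle (car (T := HP) CNR) (zero_car HP) x.
Proof.
move=> [hc bc]; have [x xc] := coeffs_onto hc.1; exists x => //; rewrite -xc in hc bc.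
by split; [exact/is_chain_coeffs|exact/cyc_red].
Qed.

Lemma coeffs_is_cycle k (x : SC k.+1) : rel_cycle (car (T := HP) CNR) (zero_car HP) x ->
  Defs.is_cycle R n k.+1 (coeffs x).
Proof. by move=> [hx cx]; split; [exact/is_chain_coeffs|exact/cyc_red]. Qed.

Lemma homology_trivialP k : homology_Z k.+2 (car (T := HP) CNR) (zero_car HP) false ->
  homology_trivial R n k.+1.
Proof.
by move=> /homology_ZF h c /is_cycle_coeffs[x <- hx]; apply/is_boundary_coeffs; exact: h.
Qed.

Lemma homology_iso_ZP k : homology_Z k.+2 (car (T := HP) CNR) (zero_car HP) true ->
  homology_iso_Z R n k.+1.
Proof.
move=> [phi [pD p0 /(_ isT)[g hg pg] _]].
have [inv hinv] := coeffs_retract k.+1.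
exists (phi \o inv); split.
- move=> c d /is_cycle_coeffs[x <- hx] /is_cycle_coeffs[y <- hy] /=.
  rewrite (_ : coeffs x \+ coeffs y = coeffs (x + y)) ?hinv ?pD //.
  by apply/funext => s; rewrite /coeffs coeffD.
- move=> m; have [h1 h2] := phiMz m pD hg.
  by exists (coeffs (g *~ m)); [exact: coeffs_is_cycle|rewrite /= hinv h2 pg mul1r].
- move=> c /is_cycle_coeffs[x <- hx]; rewrite /= hinv p0 //.
  by split=> /is_boundary_coeffs.
Qed.

Lemma singular_fce0 (s : simplex HP 1) : carried (car (T := HP) CNR) s -> sface ord0 s = (fun=> set0).
Proof.
move=> [_ [s0 _] _]; apply/funext => t; rewrite /sface s0 // => /std_dinj; exact: std0.
Qed.

(** Each point has the single empty simplex as its boundary, so in index 1 the augmented boundary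
    counts the degree. *)
Lemma bdry_deg (x : SC 0) : Ch (car (T := HP) CNR) x ->
  bdry x = << (fun=> set0) : simplex HP 0 >> *~ deg x.
Proof.
apply: (@fg_ind _ _ (fun x : SC 0 => bdry x = << (fun=> set0) : simplex HP 0 >> *~ deg x)).
- by rewrite !raddf0 ?mulr0z.
- by move=> a b ha hb; rewrite [bdry _]raddfD [deg _]raddfD mulrzDr /= ha hb.
- by move=> a ha; rewrite [bdry _]raddfN [deg _]raddfN mulrNz /= ha.
- by move=> s hs; rewrite bdU big_ord1 expr0 degU singular_fce0.
Qed.

(** As reduced homology vanishes in index 1, chains of degree 0 bound. Conversely boundaries have
    degree 0, the augmented boundary being of square zero, and multiples of one constant simplex
    attain every degree. *)
Lemma homology_iso_Z0 : (0 < n)%N -> homology_Z 1 (car (T := HP) CNR) (zero_car HP) false ->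
  homology_iso_Z R n 0.
Proof.
move=> n0 /homology_ZF h.
have [inv hinv] := coeffs_retract 0.
have onto (c : Defs.chain R 0) : Defs.is_cycle R n 0 c -> exists2 x : SC 0, coeffs x = c &
    Ch (car (T := HP) CNR) x.
  move=> [hc _]; have [x xc] := coeffs_onto hc.1; exists x => //.
  by rewrite -xc in hc; exact/is_chain_coeffs.
exists (fun c => deg (inv c)); split.
- move=> c d /onto[x <- hx] /onto[y <- hy].
  rewrite (_ : coeffs x \+ coeffs y = coeffs (x + y)) ?hinv ?raddfD //.
  by apply/funext => s; rewrite /coeffs coeffD.
- move=> m; pose A : set (R * R) := [set star R].
  pose s : simplex HP 1 := fun t => if `[< std t >] then A else set0.
  have hs : carried (car (T := HP) CNR) s.
    split=> //; last first.
      move=> t ht; rewrite /s asboolT //; split; last first.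
        by move=> p ->; rewrite /oncirc /= expr1n expr0n addr0.
      by exists (fun=> star R); apply/seteqP; split=> [p ->|_ [i _ <-]] //; exists (Ordinal n0).
    split=> [t ht|t ht e e0]; first by rewrite /s asboolF.
    by exists 1 => // u hu _; rewrite /s !asboolT //; exact: (hyper_refl (@plane_refl R)).
  exists (coeffs (<< s >> *~ m : SC 0)).
    by split=> //; apply/is_chain_coeffs; apply: suppMz; exact: suppU.
  by rewrite hinv raddfMz /= degU intz.
- move=> c /onto[x <- hx]; rewrite hinv; split=> [dx|/is_boundary_coeffs[d [e [hd /Ch_red -> xE]]]].
    apply/is_boundary_coeffs; apply: h; split=> //=.
    by rewrite bdry_deg // dx mulr0z; exact: Ch_0.
  have : bdry x = 0 by rewrite xE addr0 (bdry_bdry hd).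
  rewrite bdry_deg // => /(congr1 (coeff ((fun=> set0) : simplex HP 0))).
  by rewrite coeff0 freegU_mulz coeffU eqxx mulr1 intz.
Qed.

End Frozen.

Local Close Scope ring_scope.
Local Close Scope classical_set_scope.
Unset Implicit Arguments.

Theorem theorem10p5 (R : realType) (n : nat) : 3 <= n ->
  (~~ odd n ->
     [/\ homology_iso_Z R n 0, homology_iso_Z R n n.-1 &
         forall k, k != 0 -> k != n.-1 -> homology_trivial R n k]) /\
  (odd n ->
     [/\ homology_iso_Z R n 0, homology_iso_Z R n n &
         forall k, k != 0 -> k != n -> homology_trivial R n k]).
Proof.
case: n => [|[|[|n]]] // _; have h := @CN_homology R n.+3 isT.
(* Index 1 is dimension 0, and it differs from the only index with nonzero reduced homology. *)
have h0 : homology_iso_Z R n.+3 0.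
  by apply: homology_iso_Z0 => //; have := h 1; case: ifP.
split=> [en|on]; split=> //.
- by apply: homology_iso_ZP; have := h n.+3; rewrite (negbTE en) eqxx.
- case=> [|k] // _ kn; apply: homology_trivialP; have := h k.+2.
  by rewrite (negbTE en) eqSS (negbTE kn).
- by apply: homology_iso_ZP; have := h n.+4; rewrite on eqxx.
- case=> [|k] // _ kn; apply: homology_trivialP; have := h k.+2.
  by rewrite on eqSS (negbTE kn).
Qed.
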